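(* Let $X=X(\mathbb T)$ be a Banach lattice satisfying Assumption A, and let $r,s\in\mathbb N$ with $2r\ge s$. Suppose that $\sup_n\|S_n\|_{X\to X}<\infty$, where $S_nf(x)=\sum_{k=-n}^n\widehat f(k)e^{ikx}$ are the partial Fourier sums. Let $\mathcal L_n$ be the trigonometric Lagrange interpolation operators $$\mathcal L_nf(x)=\frac1{2n+1}\sum_{k=0}^{2n}f(t_k)D_n(x-t_k),\qquad t_k=\frac{2\pi k}{2n+1},\quad D_n(x)=\sum_{k=-n}^ne^{ikx}.$$ Then for all $f\in X$ and all $\alpha\in(0,s)$ the following are equivalent: (i) $\|f-\mathcal L_nf\|_X=\mathcal O(n^{-\alpha})$ as $n\to\infty$; (ii) $\|(I-A_{\gamma/n})^rf\|_{X_n}+\|(I-\dot A_{\gamma/n})^sf\|_X=\mathcal O(n^{-\alpha})$ as $n\to\infty$.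
   Context: $\mathbb T$ is the unit circle identified with $[-\pi,\pi)$ (functions on $\mathbb T$ are $2\pi$-periodic), with normalized Lebesgue measure $\mu$. A Banach lattice $X=X(\mathbb T)$ is a Banach space of measurable functions on $\mathbb T$ such that: 1) if $f$ is measurable, $g\in X$ and $|f|\le|g|$, then $f\in X$ and $\|f\|_X\le\|g\|_X$; 2) if $f_n\in X$, $\sup_n\|f_n\|_X<\infty$ and $0\le f_n\uparrow f$, then $f\in X$ and $\|f_n\|_X\to\|f\|_X$; 3) for every measurable $E$ with $\mu(E)<\infty$, $\chi_E\in X$ and there is $c_E>0$ with $\int_E|f|\,d\mu\le c_E\|f\|_X$. Functions in $X$ are regarded as finite-valued and defined at every point, not as equivalence classes. Steklov averages: $A_hf(x)=\frac1h\int_{x-h/2}^{x+h/2}f(t)\,dt$ and $\dot A_hf(x)=A_hf(x+\tfrac h2)$ for $h>0$; $I$ is the identity. Assumption A: $A_hf\in X$ for all $f\in X$, $h>0$, and $\sup_{h>0,\,\|f\|_X\le1}\|A_hf\|_X<\infty$. Fourier coefficients: $\widehat f(k)=\frac1{2\pi}\int_{\mathbb T}f(x)e^{-ikx}\,dx$. The discrete semi-norm is $\|f\|_{X_n}=\big\|\sum_{k=0}^{2n}|f(t_k)|\chi_{[t_k,t_{k+1})}\big\|_X$ with $t_{2n+1}=2\pi$. The constant $\gamma>0$ is a fixed constant such that $\frac\gamma n\le t_{k+1}-t_k=\frac{2\pi}{2n+1}$ for all $n\in\mathbb N$. *)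

(* Defs.v *)
From HB Require Import structures.
From mathcomp Require Import all_boot all_order all_algebra.
From mathcomp Require Import all_classical all_reals all_analysis.
From mathcomp.real_closed Require Import complex.

Set Implicit Arguments.
Unset Strict Implicit.
Unset Printing Implicit Defensive.

Import Order.TTheory GRing.Theory Num.Theory.
Import numFieldNormedType.Exports.

Local Open Scope classical_set_scope.
Local Open Scope ring_scope.
Local Open Scope complex_scope.

(* Functions on the circle are 2 pi-periodic functions R -> R[i]. *)

(* R with the (complete) sigma-algebra of Lebesgue measurable sets, i.e. the
   domain of completed_lebesgue_measure. *)
Definition lebesgueType (R : realType) :=
  caratheodory_type ((wlength (@idfun R))^*)%mu.

Notation mu_leb R := (@completed_lebesgue_measure R).

Section Circle.
Context {R : realType}.
Implicit Types (f : R -> R[i]) (A E : set R) (x h : R) (n k : nat) (z : R[i]).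

Definition modulus z : R := Normc.normc z.

Definition cmeasurable f : Prop :=
  measurable_fun [set: lebesgueType R]
    ((fun x => complex.Re (f x)) : lebesgueType R -> R) /\
  measurable_fun [set: lebesgueType R]
    ((fun x => complex.Im (f x)) : lebesgueType R -> R).

Definition cintegral A f : R[i] :=
  (\int[mu_leb R]_(x in A) complex.Re (f x)) +i*
  (\int[mu_leb R]_(x in A) complex.Im (f x)).

Definition circle : set R := `[- pi, pi[.

(* The 2 pi-periodic subset of R corresponding to a subset of a period. *)
Definition periodize E : set R :=
  [set x | exists m : int, E (x + (pi *+ 2) *~ m)].

Definition of_real (u : R -> R) : R -> R[i] := fun x => (u x)%:C.

Definition steklov h f : R -> R[i] := fun x =>
  (h^-1)%:C * cintegral `[x - h / 2, x + h / 2] f.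

Definition steklov_fwd h f : R -> R[i] := fun x => steklov h f (x + h / 2).

Definition cis (t : R) : R[i] := cos t +i* sin t.

Definition fourier_coef f (k : int) : R[i] :=
  ((pi *+ 2)^-1)%:C *
  cintegral circle (fun x => f x * cis (- (k%:~R * x))).

(* The sum of a k over -n <= k <= n. *)
Definition sym_sum n (a : int -> R[i]) : R[i] :=
  \sum_(j < n.*2.+1) a (j%:Z - n%:Z).

Definition fourier_sum n f : R -> R[i] := fun x =>
  sym_sum n (fun k : int => fourier_coef f k * cis (k%:~R * x)).

Definition dirichlet n : R -> R[i] := fun x =>
  sym_sum n (fun k : int => cis (k%:~R * x)).

Definition node n k : R := (pi *+ 2) * k%:R / n.*2.+1%:R.

Definition interpolate n f : R -> R[i] := fun x =>
  (n.*2.+1%:R)^-1 *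
  \sum_(k < n.*2.+1) f (node n k) * dirichlet n (x - node n k).

Definition discretize n f : R -> R := fun x =>
  \sum_(k < n.*2.+1) modulus (f (node n k)) *
    \1_(periodize `[node n k, node n k.+1[) x.

(* ((I - T) ^ r) f *)
Definition diff_pow (T : (R -> R[i]) -> R -> R[i]) (r : nat) f : R -> R[i] :=
  iter r (fun g => g - T g) f.

End Circle.

(* Members of a Banach lattice are functions defined everywhere, and the order
   relations in bl_solid and bl_fatou are meant at every point; as usual for
   spaces of measurable functions, the norm separates functions only up to
   equality almost everywhere.  The values of bl_norm outside bl_mem are
   irrelevant. *)
Record banach_lattice (R : realType) := BanachLattice {
  bl_mem : set (R -> R[i]);
  bl_norm : (R -> R[i]) -> R;
  bl_measurable : forall f, bl_mem f -> cmeasurable f;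
  bl_periodic : forall f, bl_mem f -> periodic f (pi *+ 2);
  bl_add : forall f g, bl_mem f -> bl_mem g -> bl_mem (f + g);
  bl_scale : forall (c : R[i]) f, bl_mem f -> bl_mem (fun x => c * f x);
  bl_normD : forall f g, bl_mem f -> bl_mem g ->
    bl_norm (f + g) <= bl_norm f + bl_norm g;
  bl_normZ : forall (c : R[i]) f, bl_mem f ->
    bl_norm (fun x => c * f x) = modulus c * bl_norm f;
  bl_norm0 : forall f, bl_mem f -> bl_norm f = 0 ->
    {ae mu_leb R, forall x, f x = 0};
  bl_complete : forall u : nat -> R -> R[i], (forall n, bl_mem (u n)) ->
    (forall e : R, 0 < e -> exists n0 : nat, forall m n : nat,
      (n0 <= m)%N -> (n0 <= n)%N -> bl_norm (u m - u n) < e) ->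
    exists2 f, bl_mem f & bl_norm (u n - f) @[n --> \oo] --> (0 : R);
  bl_solid : forall f g, cmeasurable f -> periodic f (pi *+ 2) -> bl_mem g ->
    (forall x, modulus (f x) <= modulus (g x)) ->
    bl_mem f /\ bl_norm f <= bl_norm g;
  bl_fatou : forall (u : nat -> R -> R) (v : R -> R),
    (forall n, bl_mem (of_real (u n))) ->
    has_ubound (range (fun n => bl_norm (of_real (u n)))) ->
    (forall n x, 0 <= u n x) ->
    (forall x, nondecreasing_seq (u ^~ x)) ->
    (forall x, u n x @[n --> \oo] --> v x) ->
    bl_mem (of_real v) /\
    bl_norm (of_real (u n)) @[n --> \oo] --> bl_norm (of_real v);
  bl_indic : forall E : set (lebesgueType R),
    measurable E -> E `<=` circle ->
    bl_mem (of_real \1_(periodize E)) /\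
    exists2 c : R, 0 < c & forall f, bl_mem f ->
      (((pi *+ 2)^-1)%:E * \int[mu_leb R]_(x in E) (modulus (f x))%:E
        <= (c * bl_norm f)%:E)%E
}.

Section Operators.
Context {R : realType}.
Variable X : banach_lattice R.
Implicit Types (f : R -> R[i]) (n : nat).

Definition unit_ball : set (R -> R[i]) :=
  [set f | bl_mem X f /\ bl_norm X f <= 1].

Definition assumption_A : Prop :=
  (forall (h : R) f, 0 < h -> bl_mem X f -> bl_mem X (steklov h f)) /\
  (ereal_sup [set (bl_norm X (steklov h f))%:E |
     h in [set h : R | (0 < h)%R] & f in unit_ball]
   < +oo)%E.

Definition opnorm (T : (R -> R[i]) -> R -> R[i]) : \bar R :=
  ereal_sup [set (bl_norm X (T f))%:E | f in unit_ball].

Definition fourier_sums_bounded : Prop :=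
  (forall n f, (0 < n)%N -> bl_mem X f -> bl_mem X (fourier_sum n f)) /\
  (ereal_sup [set opnorm (fourier_sum n) | n in [set n | (0 < n)%N]] < +oo)%E.

Definition discrete_norm n f : R := bl_norm X (of_real (discretize n f)).

End Operators.

(* Main.v *)
From HB Require Import structures.
Require Import Defs.
From mathcomp Require Import all_boot all_order all_algebra.
From mathcomp Require Import all_classical all_reals all_analysis.
From mathcomp.real_closed Require Import complex.
From mathcomp Require Import measurable_realfun.
From mathcomp Require Import ring lra zify.

(** Both conditions say that f is approximated in X by trigonometric
    polynomials T_n of degree n at the rate n^-alpha.  All estimates come from
    the following three sources; below, |u| stands for the norm of u in X, and C
    and Q for constants independent of n and h.

    Assumption A together with the lattice order: a function whose modulus is
    dominated pointwise by averages of the modulus of g is controlled by |g|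
    (bl_dominated_by_averages).  This bounds every mean over an interval,
    gives I - A_h = O(h^2 D^2) and I - B_h = O(h D) on polynomials, with B_h the
    one-sided average (bl_steklov_diff_trig, bl_fwd_diff_trig), and compares
    values at the nodes with norms of means and derivatives.

    Boundedness of the S_n together with multiplication by exp(ikx), which is an
    isometry of X: all sums over an interval of frequencies are bounded, hence,
    by summation by parts, so are multipliers of bounded variation
    (bounded_variation_multiplier).  The multiplier ik on frequencies up to n is
    Bernstein's inequality (bernstein) and the multiplier 1/ik on frequencies
    above m is the Bohr-Favard inequality (bohr_favard).  Bernstein's inequality
    yields the Marcinkiewicz-Zygmund bound for the discrete norm of a polynomial
    (marcinkiewicz_zygmund), and also bounds L_n f by the discrete norm of f
    (interpolate_bound): a backward mean of L_n f over a short interval is S_n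
    applied to a train of bumps placed at the nodes, and L_n f differs from that
    mean by at most half of its norm.

    Pointwise Fourier inversion for smooth functions: it transfers the
    Bohr-Favard inequality from polynomials to X in the form
    |B_h^2 u| <= Q / (h n) |u| for u without frequencies up to n
    (high_frequency_decay).  Since I - B_h^2 = (I + B_h) (I - B_h), for h n large
    this gives |u| <= C |(I - B_h) u|, and s iterations give Jackson's inequality
    |f - S_n f| <= C |(I - B_h)^s f| (jackson).

    If |f - T_n| = O(n^-alpha) with alpha < s, summing the differences
    T_n - T_(n/2) over dyadic scales and applying Bernstein's inequality to each
    bounds the s-th derivative of T_n by O(n^(s - alpha)) (derivative_growth).
    Hence (I - B)^s T_n, and (I - A)^r T_n because 2 r >= s, are O(n^-alpha) at
    the scale 1 / n.  For (i) => (ii) take T_n = L_n f: the difference f - L_n f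
    vanishes at the nodes, so both terms of (ii) are controlled.  For (ii) => (i)
    take T_n = S_n f, which approximates at the right rate by Jackson's
    inequality; as L_n reproduces S_n f, it remains to bound the discrete norm of
    f - S_n f, which up to O(|f - S_n f|) is that of (I - A)^r (f - S_n f). *)

Set Implicit Arguments.
Unset Strict Implicit.
Unset Printing Implicit Defensive.

Import Order.TTheory GRing.Theory Num.Theory.
Import numFieldNormedType.Exports.

Local Open Scope classical_set_scope.
Local Open Scope ring_scope.

(** * Lebesgue measurability and translations *)

Section LebesgueIntervals.
Context {R : realType}.
Implicit Types (u v : R -> R) (a b c : R).

(** Measurability refers to the complete sigma-algebra, since members of a
    Banach lattice are only Lebesgue measurable. *)
Definition lmeas u : Prop :=
  measurable_fun [set: lebesgueType R] (u : lebesgueType R -> R).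

(** Local integrability.  It is what membership in a Banach lattice provides,
    and it makes all integrals below additive. *)
Definition lint u : Prop :=
  lmeas u /\ forall a b, (mu_leb R).-integrable `[a, b] (EFin \o u).

Definition rint a b u : R := \int[mu_leb R]_(x in `[a, b]) u x.

Lemma borel_lebesgue (A : set R) :
  measurable A -> measurable (A : set (lebesgueType R)).
Proof. exact: sub_caratheodory. Qed.

Lemma completed_lebesgueE (A : set R) : mu_leb R A = lebesgue_measure A.
Proof. by []. Qed.

Lemma lmeas_borel u : measurable_fun [set: R] u -> lmeas u.
Proof.
move=> mu _ Y mY; apply: borel_lebesgue.
by have := mu measurableT Y mY.
Qed.

Lemma lebesgue_borel_negligible (E : set R) :
  measurable (E : set (lebesgueType R)) ->
  exists A N : set R, [/\ measurable A, measurable N, lebesgue_measure N = 0%E,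
    A `<=` E & E `<=` A `|` N].
Proof.
have := @completed_caratheodory_measurable R.
rewrite g_sigma_completed_algebra_genE => eqm mE.
have e := congr1 (fun S : set (set R) => S E) eqm.
have transp (P Q : Prop) : P = Q -> Q -> P by move=> ->.
case: (transp _ _ e mE) => A mA [N [N' [mN' N'0 NN']] EAN].
exists A, N'; split => //; first by rewrite -EAN; exact: subsetUl.
by rewrite -EAN; apply: setUS.
Qed.

(** The sets where u < q, for rational q, are Borel up to null sets.  Deleting
    the countable union of these null sets makes all of them Borel at once, and
    they determine u.  Fubini's theorem needs Borel versions, since completeness
    is lost in products. *)
Lemma borel_version u : lmeas u ->
  exists2 u0 : R -> R, measurable_fun [set: R] u0 &
  exists N : set R, [/\ measurable N, lebesgue_measure N = 0%E &
    forall x, ~ N x -> u0 x = u x].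
Proof.
move=> mu.
have H (q : rat) : exists AN : set R * set R,
   [/\ measurable AN.1, measurable AN.2, lebesgue_measure AN.2 = 0%E,
   AN.1 `<=` u @^-1` `]-oo, ratr q[ &
   u @^-1` `]-oo, ratr q[ `<=` AN.1 `|` AN.2].
  have : measurable ((u @^-1` `]-oo, ratr q[) : set (lebesgueType R)).
    by have := mu measurableT `]-oo, ratr q[%classic (measurable_itv _); rewrite setTI.
  by case/lebesgue_borel_negligible => A [N] ?; exists (A, N).
have [F FP] := choice H.
(* The null sets are indexed by natural numbers to form a countable union. *)
pose G n := if unpickle n is Some q then (F q).2 else set0.
pose N := \bigcup_n G n.
have mG n : measurable (G n).
  by rewrite /G; case: unpickle => // q; have [] := FP q.
have G0 n : lebesgue_measure (G n) = 0%E.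
  by rewrite /G; case: unpickle => [q|]; [have [] := FP q | rewrite measure0].
have FN q : (F q).2 `<=` N.
  by move=> x Fx; exists (pickle q); [exact: I | rewrite /G pickleK].
have mN : measurable N by exact: bigcupT_measurable.
have N0 : lebesgue_measure N = 0%E.
  apply/negligibleP => //; apply: negligible_bigcup => n.
  by apply/negligibleP; [exact: mG | exact: G0].
have mNC : measurable (~` N) by exact: measurableC.
pose u0 x := if x \in N then 0 else u x.
exists u0; last first.
  by exists N; split => // x Nx; rewrite /u0; case: ifPn => // /set_mem.
have mq q : measurable ((F q).1 `\` N).
  by apply: measurableD => //; have [] := FP q.
apply: (measurability _ (RGenInftyO.measurableE R)) => _ [_ [x ->] <-].
rewrite setTI.
(* The sets where u < q have Borel parts off N, and their union over the
   rationals q < x is the set where u < x, off N. *)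
have -> : u0 @^-1` `]-oo, x[ =
    (\bigcup_(q in [set q : rat | ratr q < x]) ((F q).1 `\` N)) `|`
    (if 0 < x then N else set0).
  apply/seteqP; split => y; rewrite /u0 /=.
    rewrite in_itv /=; case: ifPn => [Ny x0|Ny uyx].
      by right; rewrite x0; exact/set_mem.
    left; have [q] := rat_in_itvoo uyx; rewrite in_itv /= => /andP[uq qx].
    exists q => //.
    have [_ _ _ _ /(_ y)] := FP q; rewrite /= in_itv /= uq.
    move=> /(_ isT)[Fy|/FN Nyy]; last by rewrite mem_set in Ny.
    by split => // Nyy; rewrite mem_set in Ny.
  rewrite in_itv /=; case=> [[q /= qx [Fy Ny]]|].
    rewrite memNset //; have [_ _ _ /(_ y Fy) + _] := FP q.
    by rewrite /= in_itv /= => uq; apply: lt_trans qx.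
  by case: ifPn => // x0 Ny; rewrite mem_set.
apply: measurableU; last by case: ifP.
rewrite bigcup_mkcond; apply: bigcupT_measurable_rat => q.
by case: ifP.
Qed.

Lemma measurable_shift c : measurable_fun [set: R] (fun x : R => x + c).
Proof. by apply: measurable_funD. Qed.

Lemma lebesgue_measure_shift c (A : set R) : measurable A ->
  lebesgue_measure ((fun x => x + c) @^-1` A) = lebesgue_measure A.
Proof.
move=> mA; symmetry.
have ms : measurable_fun [set: measurableTypeR R]
    ((fun x : R => x + c) : measurableTypeR R -> measurableTypeR R).
  exact: measurable_shift.
pose f : {mfun measurableTypeR R >-> measurableTypeR R} :=
  HB.pack (fun x : R => x + c) (isMeasurableFun.Build _ _ _ _ _ ms).
apply: (@lebesgue_measure_unique R (pushforward (@lebesgue_measure R) f)) => //.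
move=> _ [[a b] /= _ <-].
rewrite /pushforward /=.
have -> : (fun x => x + c) @^-1` `]a, b] = `]a - c, b - c]%classic.
  by apply/seteqP; split => x /=; rewrite !in_itv /=  ltrBlDr lerBrDr.
rewrite !lebesgue_measure_itv /= !lte_fin ltrD2r.
by case: ifP => // _; congr EFin; lra.
Qed.

Lemma null_ae_eq (D N : set R) (f g : R -> \bar R) :
  measurable N -> lebesgue_measure N = 0%E -> (forall x, ~ N x -> f x = g x) ->
  ae_eq (mu_leb R) D f g.
Proof.
move=> mN N0 fg; exists N; split => //; first exact: borel_lebesgue.
move=> x /= fgx; apply: contrapT => Nx; apply: fgx => _; exact: fg.
Qed.

Lemma ae_lmeas u v (N : set R) : measurable N -> lebesgue_measure N = 0%E ->
  (forall x, ~ N x -> u x = v x) -> lmeas u -> lmeas v.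
Proof.
move=> mN N0 uv mu; apply/measurable_EFinP.
apply: (ae_measurable_fun completed_lebesgue_measure_is_complete
  (f := EFin \o u)).
  by apply: (null_ae_eq _ mN N0) => x Nx /=; rewrite uv.
exact/measurable_EFinP.
Qed.

Lemma shift_null c (N : set R) : measurable N -> lebesgue_measure N = 0%E ->
  measurable ((fun x => x + c) @^-1` N) /\
  lebesgue_measure ((fun x => x + c) @^-1` N) = 0%E.
Proof.
move=> mN N0; split; last by rewrite lebesgue_measure_shift.
by rewrite -[X in measurable X]setTI; apply: measurable_shift.
Qed.

Lemma lmeas_shift c u : lmeas u -> lmeas (fun x => u (x + c)).
Proof.
move=> /borel_version[u0 mu0 [N [mN N0 uN]]].
have m0 : lmeas (fun x => u0 (x + c)).
  apply: lmeas_borel.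
  exact: (measurableT_comp mu0 (measurable_shift c)).
have [mN' N'0] := shift_null c mN N0.
by apply: (ae_lmeas mN' N'0 _ m0) => x /= Nx; exact: uN.
Qed.

Lemma integral_completed_borel (A : set R) (f : R -> \bar R) : measurable A ->
  measurable_fun [set: R] f ->
  (\int[mu_leb R]_(x in A) f x = \int[lebesgue_measure]_(x in A) f x)%E.
Proof.
move=> mA mf.
have mid : measurable_fun [set: lebesgueType R]
    ((fun x => x) : lebesgueType R -> measurableTypeR R).
  by move=> _ Y mY; rewrite setTI; exact: borel_lebesgue.
have H (g : R -> \bar R) : measurable_fun [set: R] g -> (forall x, 0 <= g x)%E ->
  (\int[mu_leb R]_(x in A) g x = \int[lebesgue_measure]_(x in A) g x)%E.
  move=> mg g0.
  apply: etrans (esym (@ge0_integral_pushforward _ _ _ (measurableTypeR R) R _ mid (mu_leb R) A g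
    mA (measurable_funTS mg) (fun y _ => g0 y))) _.
  by [].
rewrite integralE [RHS]integralE; congr (_ - _)%E; apply: H => //.
- exact: measurable_funepos.
- exact: measurable_funeneg.
Qed.

Lemma integral_borel_shift c (A : set R) (f : R -> \bar R) : measurable A ->
  measurable_fun [set: R] f ->
  (\int[lebesgue_measure]_(x in (fun x => x + c)%R @^-1` A) f (x + c)%R =
   \int[lebesgue_measure]_(x in A) f x)%E.
Proof.
move=> mA mf.
have ms : measurable_fun [set: measurableTypeR R]
    ((fun x : R => x + c) : measurableTypeR R -> measurableTypeR R).
  exact: measurable_shift.
have H (g : R -> \bar R) : measurable_fun [set: R] g -> (forall x, 0 <= g x)%E ->
  (\int[lebesgue_measure]_(x in (fun x => x + c)%R @^-1` A) g (x + c)%R =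
   \int[lebesgue_measure]_(x in A) g x)%E.
  move=> mg g0.
  apply: etrans (esym (@ge0_integral_pushforward _ _ _ (measurableTypeR R) R _ ms
    (@lebesgue_measure R) A g mA (measurable_funTS mg) (fun y _ => g0 y))) _.
  apply: eq_measure_integral => B mB _.
  exact: lebesgue_measure_shift.
rewrite integralE [RHS]integralE; congr (_ - _)%E.
- apply: etrans (H (f^\+)%E (measurable_funepos mf) (funepos_ge0 f)).
  by apply: eq_integral => x _; rewrite ?funeposE ?funenegE.
- apply: etrans (H (f^\-)%E (measurable_funeneg mf) (funeneg_ge0 f)).
  by apply: eq_integral => x _; rewrite ?funeposE ?funenegE.
Qed.

(** Translation invariance is proved for a Borel version, and the translate of
    the exceptional null set is again null. *)
Lemma integral_shift a b c u : lmeas u ->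
  (\int[mu_leb R]_(x in `[a, b]) (u (x + c)%R)%:E =
   \int[mu_leb R]_(x in `[(a + c)%R, (b + c)%R]) (u x)%:E)%E.
Proof.
move=> mu; have [u0 mu0 [N [mN N0 uN]]] := borel_version mu.
have [mN' N'0] := shift_null c mN N0.
have mE (v : R -> R) : lmeas v -> measurable_fun [set: lebesgueType R] (EFin \o v).
  by move=> ?; exact/measurable_EFinP.
have mu1 := lmeas_borel mu0.
have mab (x y : R) : measurable (`[x, y]%classic : set (lebesgueType R)).
  by apply: borel_lebesgue; exact: measurable_itv.
transitivity (\int[mu_leb R]_(x in `[a, b]) (u0 (x + c)%R)%:E)%E.
  apply: (@ae_eq_integral _ _ _ (mu_leb R)).
  - exact: mab.
  - by apply: measurable_funTS; apply: mE; exact: lmeas_shift.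
  - by apply: measurable_funTS; apply: mE; exact: lmeas_shift.
  - by apply: (null_ae_eq _ mN' N'0) => x /= Nx; rewrite uN.
transitivity (\int[mu_leb R]_(x in `[(a + c)%R, (b + c)%R]) (u0 x)%:E)%E; last first.
  apply: (@ae_eq_integral _ _ _ (mu_leb R)).
  - exact: mab.
  - by apply: measurable_funTS; apply: mE.
  - by apply: measurable_funTS; apply: mE.
  - by apply: (null_ae_eq _ mN N0) => x /= Nx; rewrite uN.
rewrite integral_completed_borel //; last first.
  apply/measurable_EFinP; exact: (measurableT_comp mu0 (measurable_shift c)).
rewrite integral_completed_borel //; last exact/measurable_EFinP.
rewrite -(@integral_borel_shift c `[(a + c)%R, (b + c)%R]%classic (EFin \o u0)) //.
  congr (\int[_]_(x in _) _)%E.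
  by apply/seteqP; split => x /=; rewrite !in_itv /= !lerD2r.
exact/measurable_EFinP.
Qed.

End LebesgueIntervals.

(** * Integrals over segments *)

Section RealIntegrals.
Context {R : realType}.
Implicit Types (u v w : R -> R) (a b c d K : R).

Lemma measurable_segment a b : measurable (`[a, b]%classic : set (lebesgueType R)).
Proof. by apply: borel_lebesgue; exact: measurable_itv. Qed.
Local Hint Resolve measurable_segment : core.

Lemma lebesgue_segment a b : (a <= b)%R -> mu_leb R `[a, b] = (b - a)%:E.
Proof.
move=> ab; rewrite completed_lebesgueE lebesgue_measure_itv /= lte_fin.
by case: ltP => // ba; rewrite (@le_anti _ _ a b) ?ab // subrr.
Qed.

Lemma null_point a :
  measurable ([set a] : set (lebesgueType R)) /\ mu_leb R [set a] = 0%E.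
Proof.
split; first by apply: borel_lebesgue; exact: measurable_set1.
by rewrite completed_lebesgueE lebesgue_measure_set1.
Qed.

Lemma segment_setU a b c : a <= b -> b <= c ->
  `[a, c]%classic = `[a, b]%classic `|` `]b, c]%classic :> set R.
Proof.
move=> ab bc.
apply/seteqP; split => x /=; rewrite !in_itv /=.
  by move=> /andP[ax xc]; case: (leP x b) => xb; [left; rewrite ax | right].
case=> /andP[h1 h2]; rewrite ?h1 ?h2 ?andbT /=.
  exact: le_trans h2 bc.
by rewrite (le_trans ab) // ltW.
Qed.

Lemma circleE : @circle R = `[- pi, pi] `\` [set pi].
Proof.
apply/seteqP; split => x; rewrite /circle /= !in_itv /=.
  by move=> /andP[-> xp]; rewrite (ltW xp); split => // xE; rewrite xE ltxx in xp.
by move=> [/andP[-> xp] /eqP xb] /=; rewrite lt_neqAle xb xp.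
Qed.

Lemma lebesgue_segment_fin a b : (mu_leb R `[a, b] < +oo)%E.
Proof.
rewrite completed_lebesgueE lebesgue_measure_itv /= lte_fin.
by case: ifP => // _; rewrite -EFinD ltry.
Qed.

Lemma lmeas_comp (g : R -> R) u : measurable_fun [set: R] g -> lmeas u ->
  lmeas (g \o u).
Proof. by move=> mg mu; apply: measurableT_comp. Qed.

Lemma lmeas_cst c : lmeas (fun=> c : R).
Proof. exact: measurable_cst. Qed.

Lemma lmeasD u v : lmeas u -> lmeas v -> lmeas (fun x => u x + v x).
Proof. by move=> mu mv; apply: measurable_funD. Qed.

Lemma lmeasB u v : lmeas u -> lmeas v -> lmeas (fun x => u x - v x).
Proof. by move=> mu mv; apply: measurable_funB. Qed.

Lemma lmeasM u v : lmeas u -> lmeas v -> lmeas (fun x => u x * v x).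
Proof. by move=> mu mv; apply: measurable_funM. Qed.

Lemma lmeas_continuous u : continuous u -> lmeas u.
Proof.
by move=> cu; apply: lmeas_borel; exact: continuous_measurable_fun.
Qed.

Lemma lmeas_norm u : lmeas u -> lmeas (fun x => `|u x|).
Proof. by move=> mu; apply: (lmeas_comp (@normr_measurable R setT) mu). Qed.

Lemma lmeas_EFin u a b : lmeas u ->
  measurable_fun (`[a, b]%classic : set (lebesgueType R)) (EFin \o u).
Proof. by move=> mu; apply/measurable_funTS/measurable_EFinP. Qed.

Lemma lint_meas u : lint u -> lmeas u. Proof. by case. Qed.

Lemma lint_integrable u a b : lint u ->
  (mu_leb R).-integrable `[a, b] (EFin \o u).
Proof. by case. Qed.

Lemma lint_bounded u K : lmeas u -> (forall x, `|u x| <= K) -> lint u.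
Proof.
move=> mu uK; split => // a b; apply: measurable_bounded_integrable => //.
- exact: lebesgue_segment_fin.
- exact: measurable_funTS.
- exists K; split => [|M KM x _ /=]; first exact: num_real.
  exact: le_trans (uK x) (ltW KM).
Qed.

Lemma lint_cst c : lint (fun=> c : R).
Proof. by apply: (@lint_bounded _ `|c|) => //; exact: lmeas_cst. Qed.

Lemma lintD u v : lint u -> lint v -> lint (fun x => u x + v x).
Proof.
move=> [mu iu] [mv iv]; split; first exact: lmeasD.
by move=> a b; have := integrableD (measurable_segment a b) (iu a b) (iv a b).
Qed.

Lemma lintN u : lint u -> lint (fun x => - u x).
Proof.
move=> [mu iu]; split; first exact: measurableT_comp.
by move=> a b; have := integrableN (iu a b).
Qed.

Lemma lintB u v : lint u -> lint v -> lint (fun x => u x - v x).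
Proof. by move=> iu iv; apply: lintD => //; exact: lintN. Qed.

Lemma lint_norm u : lint u -> lint (fun x => `|u x|).
Proof.
move=> [mu iu]; split; first exact: lmeas_norm.
by move=> a b; have := integrable_norm (iu a b).
Qed.

Lemma lint_le u v : lmeas u -> lint v -> (forall x, `|u x| <= v x) -> lint u.
Proof.
move=> mu [mv iv] uv; split => // a b.
apply: (le_integrable _ _ _ (iv a b)) => //.
  exact: lmeas_EFin.
move=> x _ /=; rewrite lee_fin; apply: le_trans (uv x) _; exact: ler_norm.
Qed.

Lemma lintZ c u : lint u -> lint (fun x => c * u x).
Proof.
move=> [mu iu]; split; first by apply: lmeasM => //; exact: lmeas_cst.
by move=> a b; have := integrableZl (measurable_segment a b) c (iu a b).
Qed.

Lemma lint_bndM w u K : lmeas w -> (forall x, `|w x| <= K) -> lint u ->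
  lint (fun x => w x * u x).
Proof.
move=> mw wK iu; apply: (@lint_le _ (fun x => K * `|u x|)).
- by apply: lmeasM => //; exact: lint_meas.
- by apply/lintZ/lint_norm.
- by move=> x; rewrite normrM ler_wpM2r.
Qed.

Lemma lint_shift c u : lint u -> lint (fun x => u (x + c)).
Proof.
move=> [mu iu]; split; first exact: lmeas_shift.
move=> a b; apply/integrableP; split; first exact/lmeas_EFin/lmeas_shift.
have := integral_shift a b c (lmeas_norm mu).
have /integrableP[_] := iu (a + c) (b + c).
by move=> /[swap] <-.
Qed.

Lemma rintD a b u v : lint u -> lint v ->
  rint a b (fun x => u x + v x) = rint a b u + rint a b v.
Proof. by move=> iu iv; apply: RintegralD => //; exact: lint_integrable. Qed.

Lemma rintB a b u v : lint u -> lint v ->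
  rint a b (fun x => u x - v x) = rint a b u - rint a b v.
Proof. by move=> iu iv; apply: RintegralB => //; exact: lint_integrable. Qed.

Lemma rintZ a b c u : lint u -> rint a b (fun x => c * u x) = c * rint a b u.
Proof. by move=> iu; apply: RintegralZl => //; exact: lint_integrable. Qed.

Lemma rint_cst a b c : a <= b -> rint a b (fun=> c) = c * (b - a).
Proof.
move=> ab; rewrite /rint Rintegral_cst //; congr (_ * _).
exact: (congr1 fine (lebesgue_segment ab)).
Qed.

Lemma eq_rint a b u v : (forall x, a <= x <= b -> u x = v x) ->
  rint a b u = rint a b v.
Proof.
move=> uv; apply: eq_Rintegral => x; rewrite inE /= in_itv /=; exact: uv.
Qed.

Lemma rint_ge0 a b u : (forall x, 0 <= u x) -> 0 <= rint a b u.
Proof. by move=> u0; apply: Rintegral_ge0. Qed.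

Lemma le_rint a b u v : lint u -> lint v ->
  (forall x, a <= x <= b -> u x <= v x) -> rint a b u <= rint a b v.
Proof.
move=> iu iv uv; apply: le_Rintegral; first exact: measurable_segment.
- exact: lint_integrable.
- exact: lint_integrable.
- by move=> x; rewrite /= in_itv /=; exact: uv.
Qed.

Lemma le_norm_rint a b u : lint u -> `|rint a b u| <= rint a b (fun x => `|u x|).
Proof. by move=> iu; apply: le_normr_Rintegral => //; exact: lint_integrable. Qed.

Lemma rint_shift a b c u : lmeas u ->
  rint a b (fun x => u (x + c)) = rint (a + c) (b + c) u.
Proof. by move=> mu; rewrite /rint /Rintegral integral_shift. Qed.

Lemma rint_cat a b c u : a <= b -> b <= c -> lint u ->
  rint a c u = rint a b u + rint b c u.
Proof.
move=> ab bc iu.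
have [mb bb] := null_point b.
have -> : rint b c u = \int[mu_leb R]_(x in `]b, c]) u x.
  rewrite /rint /Rintegral.
  rewrite (negligible_integral mb (measurable_segment b c)
    (lint_integrable b c iu) bb).
  congr (fine (\int[_]_(x in _) _)%E).
  apply/seteqP; split => x /=; rewrite !in_itv /=.
    by move=> [/andP[bx ->] /eqP xb]; rewrite andbT lt_neqAle bx eq_sym xb.
  by move=> /andP[bx ->]; rewrite (ltW bx); split => // xb; rewrite xb ltxx in bx.
have mo : measurable (`]b, c]%classic : set (lebesgueType R)).
  by apply: borel_lebesgue; exact: measurable_itv.
have E := segment_setU ab bc.
rewrite /rint E Rintegral_setU //.
  by rewrite -E; exact: lint_integrable.
by apply/disj_setPS => x /= []; rewrite !in_itv /= => /andP[_ xb] /andP[]; rewrite ltNge xb.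
Qed.

Lemma le_rint_itv a b c d u : c <= a -> a <= b -> b <= d -> lint u ->
  (forall x, 0 <= u x) -> rint a b u <= rint c d u.
Proof.
move=> ca ab bd iu u0.
rewrite (rint_cat ca (le_trans ab bd) iu) (rint_cat ab bd iu).
by have := rint_ge0 c a u0; have := rint_ge0 b d u0; lra.
Qed.

(** Continuous functions have the same integral for the complete measure as for
    the Borel one, so this is the usual fundamental theorem of calculus. *)
Lemma rint_FTC a b (f F : R -> R) : a <= b -> continuous f ->
  (forall x, is_derive x (1 : R) F (f x)) -> rint a b f = F b - F a.
Proof.
move=> ab cf dF; rewrite /rint /Rintegral integral_completed_borel; last 2 first.
- exact: measurable_itv.
- by apply/measurable_EFinP; exact: continuous_measurable_fun.
case: (ltgtP a b) ab => // [ab _|-> _]; last first.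
  by rewrite set_itv1 integral_set1 subrr.
rewrite (@continuous_FTC2 _ f F) //.
- exact: continuous_subspaceT.
- have dFx x : derivable F x 1 by have [] := dF x.
  have cF x : {for x, continuous F} by apply/differentiable_continuous/derivable1_diffP.
  split => [x _||]; first exact: dFx.
    by apply: cvg_at_right_filter; exact: cF.
  by apply: cvg_at_left_filter; exact: cF.
- by move=> x _; rewrite derive1E; have [_ ->] := dF x.
Qed.

End RealIntegrals.

(** * Exchange of two integrations *)

Section Fubini.
Context {R : realType}.
Implicit Types (u v w e : R -> R) (a b c d K : R).

Lemma lint_ae u v (N : set R) : measurable N -> lebesgue_measure N = 0%E ->
  (forall x, ~ N x -> u x = v x) -> lint u -> lint v.
Proof.
move=> mN N0 uv [mu iu]; have mv := ae_lmeas mN N0 uv mu.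
split => // a b; apply/integrableP; split; first exact: lmeas_EFin.
have /integrableP[_] := iu a b; congr (_ < _)%E.
apply: (@ae_eq_integral _ _ _ (mu_leb R)).
- exact: measurable_segment.
- by apply: measurableT_comp => //; exact: lmeas_EFin.
- by apply: measurableT_comp => //; exact: lmeas_EFin.
- by apply: (null_ae_eq _ mN N0) => x Nx /=; rewrite uv.
Qed.

Lemma rint_ae a b u v (N : set R) : measurable N -> lebesgue_measure N = 0%E ->
  (forall x, ~ N x -> u x = v x) -> lmeas u -> rint a b u = rint a b v.
Proof.
move=> mN N0 uv mu; have mv := ae_lmeas mN N0 uv mu.
congr fine; apply: (@ae_eq_integral _ _ _ (mu_leb R)).
- exact: measurable_segment.
- exact: lmeas_EFin.
- exact: lmeas_EFin.
- by apply: (null_ae_eq _ mN N0) => x Nx /=; rewrite uv.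
Qed.

Lemma integral_indicM (A : set R) (g : R -> R) :
  (\int[lebesgue_measure]_x (g x * \1_A x)%:E =
   \int[lebesgue_measure]_(x in A) (g x)%:E)%E.
Proof.
rewrite [RHS]integral_mkcond; apply: eq_integral => x _.
by rewrite patchE indicE; case: ifP => _; rewrite ?mulr1 ?mulr0.
Qed.

(** Cutting off with an indicator turns the inner integral over a segment into
    one over the line, the form in which Fubini's theorem applies. *)
Lemma integral_window u c d k x : measurable_fun [set: R] u -> lint u ->
  (\int[lebesgue_measure]_t (k * (u (x + t)%R * \1_`[c, d] t))%:E =
   (k * rint c d (fun t => u (x + t)%R))%:E)%E.
Proof.
move=> mu iu.
have mxu : measurable_fun [set: R] (fun t => u (x + t)).
  apply: (measurableT_comp mu); exact: measurable_funD.
have ixu : lint (fun t => u (x + t)).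
  by have := lint_shift x iu; under [X in lint X]eq_fun do rewrite addrC.
under eq_integral do rewrite mulrA.
rewrite integral_indicM -(integral_completed_borel (measurable_itv _)); last first.
  by apply/measurable_EFinP; exact: measurable_funM.
rewrite -rintZ // /rint /Rintegral fineK //.
apply: integrable_fin_num; first exact: measurable_segment.
exact: lint_integrable (lintZ k ixu).
Qed.

(** With both segments encoded by indicators, the integrand is a Borel function
    on the plane, integrable because |e| is bounded and |u| is integrable over
    the segment that contains all the translates. *)
Lemma rint_fubini_borel a b c d e u K : c <= d -> measurable_fun [set: R] u -> lint u ->
  continuous e -> (forall x, `|e x| <= K) ->
  rint a b (fun x => e x * rint c d (fun t => u (x + t))) =
  rint c d (fun t => rint a b (fun x => e x * u (x + t))).
Proof.
move=> cd mu iu ce eK.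
set A := `[a, b]%classic; set B := `[c, d]%classic.
have me : measurable_fun [set: R] e by exact: continuous_measurable_fun.
have mA : measurable A by exact: measurable_itv.
have mB : measurable B by exact: measurable_itv.
pose T := measurableTypeR R.
pose F (z : T * T) := (e z.1 * \1_A z.1 * (u (z.1 + z.2) * \1_B z.2))%:E.
have mF : measurable_fun [set: T * T] F.
  apply/measurable_EFinP; apply: measurable_funM; apply: measurable_funM.
  - exact: (measurableT_comp me).
  - exact: (measurableT_comp (measurable_indic mA)).
  - by apply: (measurableT_comp mu); apply: measurable_funD.
  - exact: (measurableT_comp (measurable_indic mB)).
have mnu : measurable_fun [set: R] (fun x => `|u x|).
  exact: (measurableT_comp (@normr_measurable R setT) mu).
have inu := lint_norm iu.
have K0 : 0 <= K by apply: le_trans (eK 0).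
pose U x := rint c d (fun t => u (x + t)).
pose V t := rint a b (fun x => e x * u (x + t)).
have FU x : (\int[lebesgue_measure]_t F (x, t) = (e x * \1_A x * U x)%:E)%E.
  exact: (integral_window c d (e x * \1_A x) x mu iu).
have FV t : (\int[lebesgue_measure]_x F (x, t) = (V t * \1_B t)%:E)%E.
  pose v x := e x * u (x + t).
  have mv : measurable_fun [set: R] v.
    apply: measurable_funM => //; apply: (measurableT_comp mu).
    exact: measurable_shift.
  have iv : lint v.
    apply: (@lint_bndM _ _ _ K) => //; first exact: lmeas_borel.
    exact: lint_shift.
  have := integral_window a b (\1_B t) 0 mv iv.
  under [X in _ = (_ * rint _ _ X)%:E -> _]eq_fun do rewrite add0r.
  rewrite mulrC => <-; apply: eq_integral => x _.
  by rewrite /F /v /= add0r; congr EFin; ring.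
have intF : (lebesgue_measure \x lebesgue_measure)%E.-integrable [set: T * T] F.
  apply/integrable12ltyP => //.
  pose C := rint (a + c) (b + d) (fun x => `|u x|).
  apply: (@le_lt_trans _ _
    (\int[lebesgue_measure]_x (K * C * \1_A x)%:E)%E); last first.
    rewrite (integral_indicM A (fun=> K * C)) integral_cst //.
    apply: lte_mul_pinfty => //.
      by rewrite lee_fin mulr_ge0 //; apply: rint_ge0.
    by have := lebesgue_segment_fin a b.
  apply: ge0_le_integral => //.
  - by move=> x _; apply: integral_ge0.
  - apply: (measurable_fun_fubini_tonelli_F (abse \o F)) => //=.
    exact: measurableT_comp.
  - apply/measurable_EFinP; apply: measurable_funM => //.
  - move=> x _.
    have -> : (\int[lebesgue_measure]_t `|F (x, t)| =
      (`|e x * \1_A x| * rint c d (fun t => `|u (x + t)%R|))%:E)%E.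
      rewrite -(integral_window _ _ _ _ mnu inu); apply: eq_integral => t _.
      rewrite /F /=; congr EFin; rewrite normrM [X in _ * X = _]normrM.
      by congr (_ * (_ * _)); rewrite ger0_norm.
    rewrite lee_fin indicE; have [/set_mem|_] := boolP (x \in A); last first.
      by rewrite !mulr0 normr0 mul0r.
    rewrite /A /= in_itv /= => /andP[ax xb]; rewrite !mulr1.
    apply: ler_pM => //; first exact: rint_ge0.
    have := @rint_shift R c d x (fun t => `|u t|) (lint_meas inu).
    under [X in rint _ _ X = _ -> _]eq_fun do rewrite addrC.
    by move=> ->; apply: le_rint_itv => //; lra.
have mFU : measurable_fun [set: T] (fun x => (e x * \1_A x * U x)%:E).
  have := measurable_fubini_F intF; rewrite /fubini_F.
  by under eq_fun do rewrite FU.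
have mFV : measurable_fun [set: T] (fun t => (V t * \1_B t)%:E).
  have := measurable_fubini_G intF; rewrite /fubini_G.
  by under eq_fun do rewrite FV.
have indic2 (D : set R) x : \1_D x * \1_D x = \1_D x :> R.
  by rewrite indicE; case: (x \in D); rewrite ?mulr1 ?mulr0.
have in1 x y z : x <= z <= y -> \1_(`[x, y]%classic : set R) z = 1 :> R.
  by move=> xyz; rewrite indicE mem_set //= in_itv.
have -> : rint a b (fun x => e x * U x) =
    fine (\int[lebesgue_measure]_x (e x * \1_A x * U x)%:E)%E.
  transitivity (rint a b (fun x => e x * \1_A x * U x)).
    by apply: eq_rint => x xab; rewrite in1 // mulr1.
  rewrite /rint /Rintegral integral_completed_borel //.
  rewrite -(integral_indicM A); congr fine; apply: eq_integral => x _.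
  by rewrite -!mulrA [_ * \1_A x]mulrC !mulrA -[e x * _ * _]mulrA indic2.
have -> : rint c d V = fine (\int[lebesgue_measure]_t (V t * \1_B t)%:E)%E.
  transitivity (rint c d (fun t => V t * \1_B t)).
    by apply: eq_rint => x xab; rewrite in1 // mulr1.
  rewrite /rint /Rintegral integral_completed_borel //.
  rewrite -(integral_indicM B); congr fine; apply: eq_integral => x _.
  by rewrite -mulrA indic2.
congr fine; under eq_integral do rewrite -FU.
rewrite (Fubini intF); apply: eq_integral => t _; exact: FV.
Qed.

(** Changing u on a null set changes none of the integrals, because every
    translate of a null set is null; so u may be taken Borel. *)
Lemma rint_fubini a b c d e u K : c <= d -> lint u ->
  continuous e -> (forall x, `|e x| <= K) ->
  rint a b (fun x => e x * rint c d (fun t => u (x + t))) =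
  rint c d (fun t => rint a b (fun x => e x * u (x + t))).
Proof.
move=> cd iu ce eK.
have [u0 mu0 [N [mN N0 uN]]] := borel_version (lint_meas iu).
have iu0 : lint u0 by apply: (lint_ae mN N0 _ iu) => x /uN.
have me := lmeas_continuous ce.
transitivity (rint a b (fun x => e x * rint c d (fun t => u0 (x + t)))).
  apply: eq_rint => x _; congr (_ * _).
  have [mN' N'0] := shift_null x mN N0.
  apply: (rint_ae _ _ mN' N'0) => [t /= Nt|]; first by rewrite uN // addrC.
  have := lmeas_shift x (lint_meas iu).
  by under [X in lmeas X -> _]eq_fun do rewrite addrC.
rewrite (rint_fubini_borel _ _ cd mu0 iu0 ce eK).
apply: eq_rint => t _; have [mN' N'0] := shift_null t mN N0.
apply: (rint_ae _ _ mN' N'0) => [x /= Nt|]; first by rewrite uN.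
by apply: lmeasM => //; apply: lmeas_shift; exact: lint_meas.
Qed.

End Fubini.

(** * Complex-valued integrals *)

Local Open Scope complex_scope.

Section ComplexBasics.
Context {R : realType}.
Implicit Types (z w : R[i]) (x y a b : R).

Lemma ReD z w : complex.Re (z + w) = complex.Re z + complex.Re w.
Proof. by case: z; case: w. Qed.
Lemma ImD z w : complex.Im (z + w) = complex.Im z + complex.Im w.
Proof. by case: z; case: w. Qed.
Lemma ReN z : complex.Re (- z) = - complex.Re z.
Proof. by case: z. Qed.
Lemma ImN z : complex.Im (- z) = - complex.Im z.
Proof. by case: z. Qed.
Lemma ReM z w : complex.Re (z * w) =
  complex.Re z * complex.Re w - complex.Im z * complex.Im w.
Proof. by case: z; case: w. Qed.
Lemma ImM z w : complex.Im (z * w) =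
  complex.Re z * complex.Im w + complex.Im z * complex.Re w.
Proof. by case: z; case: w. Qed.
Lemma complex_eq z w : complex.Re z = complex.Re w ->
  complex.Im z = complex.Im w -> z = w.
Proof. by case: z => ? ?; case: w => ? ? /= -> ->. Qed.

Lemma modulus_ge0 z : 0 <= modulus z.
Proof. by case: z => a b; apply: sqrtr_ge0. Qed.
Lemma modulus0 : modulus (0 : R[i]) = 0.
Proof. exact: Normc.normc0. Qed.
Lemma modulus1 : modulus (1 : R[i]) = 1.
Proof. exact: Normc.normc1. Qed.
Lemma modulus_eq0 z : modulus z = 0 -> z = 0.
Proof. exact: Normc.eq0_normc. Qed.
Lemma modulusM z w : modulus (z * w) = modulus z * modulus w.
Proof. exact: Normc.normcM. Qed.
Lemma modulusV z : modulus z^-1 = (modulus z)^-1.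
Proof. exact: Normc.normcV. Qed.
Lemma modulusD z w : modulus (z + w) <= modulus z + modulus w.
Proof. exact: le_normcD. Qed.
Lemma modulusN z : modulus (- z) = modulus z.
Proof. exact: normcN. Qed.
Lemma modulusB z w : modulus (z - w) <= modulus z + modulus w.
Proof. by rewrite -(modulusN w); exact: modulusD. Qed.
Lemma modulus_real x : modulus x%:C = `|x|.
Proof. by rewrite /modulus /= expr0n /= addr0 sqrtr_sqr. Qed.
Lemma modulus_sum (I : Type) (s : seq I) (P : pred I) (F : I -> R[i]) :
  modulus (\sum_(i <- s | P i) F i) <= \sum_(i <- s | P i) modulus (F i).
Proof.
elim/big_rec2 : _ => [|i r z _ IH]; first by rewrite modulus0.
by apply: le_trans (modulusD _ _) _; rewrite lerD2l.
Qed.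
Lemma le_Re z : `|complex.Re z| <= modulus z.
Proof.
case: z => a b; rewrite /modulus /= -sqrtr_sqr; apply: ler_wsqrtr.
by rewrite lerDl sqr_ge0.
Qed.
Lemma le_Im z : `|complex.Im z| <= modulus z.
Proof.
case: z => a b; rewrite /modulus /= -[X in X <= _]sqrtr_sqr; apply: ler_wsqrtr.
by rewrite lerDr sqr_ge0.
Qed.
Lemma modulus_le z : modulus z <= `|complex.Re z| + `|complex.Im z|.
Proof.
(* The triangle inequality for Re z + i Im z. *)
have {1}-> : z = (complex.Re z)%:C + (0 +i* 1) * (complex.Im z)%:C.
  by apply: complex_eq; rewrite ?(ReD, ImD, ReM, ImM) /=; ring.
apply: le_trans (modulusD _ _) _; rewrite modulusM !modulus_real lerD //.
by rewrite {1}/modulus /= expr0n /= add0r expr1n sqrtr1 mul1r.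
Qed.

Lemma modulus_cis x : modulus (cis x) = 1.
Proof. by rewrite /modulus /= cos2Dsin2 sqrtr1. Qed.
Lemma cisD x y : cis (x + y) = cis x * cis y.
Proof. by rewrite /cis; apply: complex_eq => /=; rewrite ?cosD ?sinD; ring. Qed.
Lemma cis0 : cis (0 : R) = 1.
Proof. by rewrite /cis cos0 sin0. Qed.
Lemma cisNM x : cis (- x) * cis x = 1.
Proof. by rewrite -cisD addNr cis0. Qed.
Lemma cisMn x n : cis (x *+ n) = cis x ^+ n.
Proof.
by elim: n => [|n IH]; rewrite ?mulr0n ?cis0 // mulrS cisD IH exprS.
Qed.
Lemma cis_2pi_int (m : int) : cis (m%:~R * (pi *+ 2)) = 1 :> R[i].
Proof.
have H (n : nat) : cis (pi *+ 2 *+ n) = 1 :> R[i].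
  by rewrite cisMn /cis cos2pi sin2pi -/(1 : R[i]) expr1n.
case: m => n; rewrite ?NegzE; first by rewrite mulr_natl H.
rewrite mulrNz mulNr mulr_natl -[LHS]mulr1 -[X in _ * X = _](H n.+1) cisNM //.
Qed.

End ComplexBasics.

Section ComplexIntegrals.
Context {R : realType}.
Implicit Types (f g : R -> R[i]) (a b c d h x y k K : R) (z w : R[i]).

Definition cint a b f : R[i] := cintegral `[a, b] f.

Definition clint f : Prop :=
  lint (fun x => complex.Re (f x)) /\ lint (fun x => complex.Im (f x)).

Lemma cintE a b f : cint a b f =
  rint a b (fun x => complex.Re (f x)) +i* rint a b (fun x => complex.Im (f x)).
Proof. by []. Qed.

Lemma cmeasurable_cst z : cmeasurable (fun=> z).
Proof. by split; exact: lmeas_cst. Qed.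

Lemma cmeasurableD f g : cmeasurable f -> cmeasurable g ->
  cmeasurable (fun x => f x + g x).
Proof.
move=> [f1 f2] [g1 g2]; split.
  by under eq_fun do rewrite ReD; exact: lmeasD.
by under eq_fun do rewrite ImD; exact: lmeasD.
Qed.

Lemma cmeasurableM f g : cmeasurable f -> cmeasurable g ->
  cmeasurable (fun x => f x * g x).
Proof.
move=> [f1 f2] [g1 g2]; split.
  by under eq_fun do rewrite ReM; apply: lmeasB; exact: lmeasM.
by under eq_fun do rewrite ImM; apply: lmeasD; exact: lmeasM.
Qed.

Lemma cmeasurable_sum (I : Type) (s : seq I) (F : I -> R -> R[i]) :
  (forall i, cmeasurable (F i)) -> cmeasurable (fun x => \sum_(i <- s) F i x).
Proof.
move=> mF; elim: s => [|i s IH].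
  by under eq_fun do rewrite big_nil; exact: cmeasurable_cst.
by under eq_fun do rewrite big_cons; exact: cmeasurableD.
Qed.

Lemma cmeasurable_shift c f : cmeasurable f -> cmeasurable (fun x => f (x + c)).
Proof. by case=> f1 f2; split; [exact: (lmeas_shift c f1) | exact: (lmeas_shift c f2)]. Qed.

Lemma cmeasurable_real (u : R -> R) : lmeas u -> cmeasurable (of_real u).
Proof. by move=> mu; split => //=; exact: lmeas_cst. Qed.

Lemma lmeas_modulus f : cmeasurable f -> lmeas (fun x => modulus (f x)).
Proof.
move=> [f1 f2].
have -> : (fun x => modulus (f x)) = (fun x =>
    Num.sqrt (complex.Re (f x) * complex.Re (f x) +
              complex.Im (f x) * complex.Im (f x))).
  by apply/funext => x; rewrite /modulus; case: (f x) => u v /=; rewrite !expr2.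
have ms : measurable_fun [set: R] (@Num.sqrt R).
  by apply: continuous_measurable_fun; exact: sqrt_continuous.
by apply: (lmeas_comp ms); apply: lmeasD; exact: lmeasM.
Qed.

Lemma cmeasurable_cis k : cmeasurable (fun x => cis (k * x)).
Proof.
split; apply: lmeas_continuous => x /=.
  apply: (@continuous_comp _ _ _ ( *%R k) cos); first exact: mulrl_continuous.
  exact: continuous_cos.
apply: (@continuous_comp _ _ _ ( *%R k) sin); first exact: mulrl_continuous.
exact: continuous_sin.
Qed.

Lemma clint_meas f : clint f -> cmeasurable f.
Proof. by move=> [[m1 _] [m2 _]]. Qed.

Lemma clint_modulus f : clint f -> lint (fun x => modulus (f x)).
Proof.
move=> cf; have [f1 f2] := cf; apply: (@lint_le _ _ (fun x =>
   `|complex.Re (f x)| + `|complex.Im (f x)|)).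
- by apply: lmeas_modulus; exact: clint_meas.
- by apply: lintD; exact: lint_norm.
- by move=> x; rewrite ger0_norm ?modulus_ge0 // modulus_le.
Qed.

Lemma clint_le f (u : R -> R) : cmeasurable f -> lint u ->
  (forall x, modulus (f x) <= u x) -> clint f.
Proof.
move=> [f1 f2] iu fu; split; apply: (lint_le _ iu) => // x.
  exact: le_trans (le_Re _) (fu x).
exact: le_trans (le_Im _) (fu x).
Qed.

Lemma clint_bounded f K : cmeasurable f -> (forall x, modulus (f x) <= K) ->
  clint f.
Proof. by move=> mf; apply: clint_le => //; exact: lint_cst. Qed.

Lemma clint_cst z : clint (fun=> z).
Proof. by apply: (@clint_bounded _ (modulus z)) => //; exact: cmeasurable_cst. Qed.

Lemma clintD f g : clint f -> clint g -> clint (fun x => f x + g x).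
Proof.
move=> cf cg; apply: (@clint_le _ (fun x => modulus (f x) + modulus (g x))).
- by apply: cmeasurableD; exact: clint_meas.
- by apply: lintD; exact: clint_modulus.
- by move=> x; exact: modulusD.
Qed.

Lemma clint_bndM f g K : cmeasurable g -> (forall x, modulus (g x) <= K) ->
  clint f -> clint (fun x => g x * f x).
Proof.
move=> mg gK cf; apply: (@clint_le _ (fun x => K * modulus (f x))).
- by apply: cmeasurableM; [exact: mg | exact: clint_meas].
- by apply: lintZ; exact: clint_modulus.
- by move=> x; rewrite modulusM ler_wpM2r // modulus_ge0.
Qed.

Lemma clintZ z f : clint f -> clint (fun x => z * f x).
Proof. by apply: (@clint_bndM _ _ (modulus z)) => //; exact: cmeasurable_cst. Qed.

Lemma clintB f g : clint f -> clint g -> clint (fun x => f x - g x).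
Proof.
move=> cf cg; apply: clintD => //.
by have := clintZ (-1) cg; under eq_fun do rewrite mulN1r.
Qed.

Lemma clint_cisM k f : clint f -> clint (fun x => cis (k * x) * f x).
Proof.
apply: (@clint_bndM _ _ 1); first exact: cmeasurable_cis.
by move=> x; rewrite modulus_cis.
Qed.

Lemma clint_sum (I : Type) (s : seq I) (F : I -> R -> R[i]) :
  (forall i, clint (F i)) -> clint (fun x => \sum_(i <- s) F i x).
Proof.
move=> mF; elim: s => [|i s IH].
  by under eq_fun do rewrite big_nil; exact: clint_cst.
by under eq_fun do rewrite big_cons; exact: clintD.
Qed.

Lemma clint_shift c f : clint f -> clint (fun x => f (x + c)).
Proof. by case=> f1 f2; split; [exact: (lint_shift c f1) | exact: (lint_shift c f2)]. Qed.

Lemma clint_cis k : clint (fun x => cis (k * x)).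
Proof.
apply: (@clint_bounded _ 1); first exact: cmeasurable_cis.
by move=> x; rewrite modulus_cis.
Qed.

Lemma eq_cint a b f g : (forall x, a <= x <= b -> f x = g x) ->
  cint a b f = cint a b g.
Proof.
by move=> fg; rewrite !cintE; congr (_ +i* _); apply: eq_rint => x xab; rewrite fg.
Qed.

Lemma cintD a b f g : clint f -> clint g ->
  cint a b (fun x => f x + g x) = cint a b f + cint a b g.
Proof.
move=> [f1 f2] [g1 g2]; rewrite !cintE; apply: complex_eq => /=.
  by under [LHS]eq_rint do rewrite ReD; exact: rintD.
by under [LHS]eq_rint do rewrite ImD; exact: rintD.
Qed.

Lemma cintZ a b z f : clint f -> cint a b (fun x => z * f x) = z * cint a b f.
Proof.
move=> [f1 f2]; rewrite !cintE; apply: complex_eq; rewrite ?ReM ?ImM /=.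
  under [LHS]eq_rint do rewrite ReM.
  by rewrite rintB ?rintZ //; exact: lintZ.
under [LHS]eq_rint do rewrite ImM.
by rewrite rintD ?rintZ //; exact: lintZ.
Qed.

Lemma cintB a b f g : clint f -> clint g ->
  cint a b (fun x => f x - g x) = cint a b f - cint a b g.
Proof.
move=> cf cg; have := cintD a b cf (clintZ (-1) cg).
by rewrite cintZ // mulN1r => <-; apply: eq_cint => x _; rewrite mulN1r.
Qed.

Lemma cint0 a b : cint a b (fun=> 0) = 0.
Proof.
rewrite -[RHS](mul0r (cint a b (fun=> 0))) -cintZ; last exact: clint_cst.
by apply: eq_cint => x _; rewrite mul0r.
Qed.

Lemma cint_sum (I : Type) (s : seq I) (F : I -> R -> R[i]) a b :
  (forall i, clint (F i)) ->
  cint a b (fun x => \sum_(i <- s) F i x) = \sum_(i <- s) cint a b (F i).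
Proof.
move=> mF; elim: s => [|i s IH].
  rewrite big_nil; apply: etrans (cint0 a b).
  by apply: eq_cint => x _; rewrite big_nil.
rewrite big_cons -IH -cintD //; last exact: clint_sum.
by apply: eq_cint => x _; rewrite big_cons.
Qed.

Lemma cint_cst a b z : a <= b -> cint a b (fun=> z) = (b - a)%:C * z.
Proof.
move=> ab; rewrite cintE; apply: complex_eq; rewrite ?ReM ?ImM /= rint_cst //.
  by rewrite mul0r subr0 mulrC.
by rewrite mul0r addr0 mulrC.
Qed.

Lemma cint_cat a b c f : a <= b -> b <= c -> clint f ->
  cint a c f = cint a b f + cint b c f.
Proof.
by move=> ab bc [f1 f2]; rewrite !cintE (rint_cat ab bc f1) (rint_cat ab bc f2).
Qed.

Lemma cint_shift a b c f : cmeasurable f ->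
  cint a b (fun x => f (x + c)) = cint (a + c) (b + c) f.
Proof.
move=> [f1 f2]; rewrite !cintE; congr (_ +i* _).
  exact: (rint_shift a b c f1).
exact: (rint_shift a b c f2).
Qed.

(** The constant 2 stems from estimating real and imaginary parts separately. *)
Lemma modulus_cint a b f : clint f ->
  modulus (cint a b f) <= 2 * rint a b (fun x => modulus (f x)).
Proof.
move=> cf; have [f1 f2] := cf; have im := clint_modulus cf.
rewrite cintE; apply: le_trans (modulus_le _) _; rewrite /= mulr2n mulrDl !mul1r.
apply: lerD; apply: le_trans (le_norm_rint _ _ _) _ => //; apply: le_rint => //.
- exact: lint_norm.
- by move=> x _; exact: le_Re.
- exact: lint_norm.
- by move=> x _; exact: le_Im.
Qed.

Lemma cint_period a b f : clint f -> periodic f (pi *+ 2) ->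
  cint a (a + pi *+ 2) f = cint b (b + pi *+ 2) f.
Proof.
wlog ab : a b / a <= b => [H cf pf|cf pf].
  by case: (leP a b) => [|/ltW] ab; [exact: H | exact/esym/H].
have p2 : 0 <= (pi *+ 2 : R) by rewrite mulrn_wge0 // pi_ge0.
have E1 := @cint_cat a (a + pi *+ 2) (b + pi *+ 2) f.
have E2 := @cint_cat a b (b + pi *+ 2) f.
have E3 : cint (a + pi *+ 2) (b + pi *+ 2) f = cint a b f.
  rewrite -cint_shift; last exact: clint_meas.
  by apply: eq_cint => x _; rewrite pf.
rewrite E3 in E1; apply: (addIr (cint a b f)).
rewrite -E1 ?lerD2r ?lerDl // E2 ?lerDl //; exact: addrC.
Qed.

Lemma cis_period (m : int) : periodic (fun x : R => cis (m%:~R * x)) (pi *+ 2).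
Proof. by move=> x; rewrite mulrDr cisD cis_2pi_int mulr1. Qed.

Lemma cint_period_shift (m : int) a f t : clint f -> periodic f (pi *+ 2) ->
  cint a (a + pi *+ 2) (fun x => cis (m%:~R * x) * f (x + t)) =
  cis (- m%:~R * t) * cint a (a + pi *+ 2) (fun x => cis (m%:~R * x) * f x).
Proof.
move=> cf pf; have cg := clint_cisM m%:~R cf.
rewrite (@cint_period a (a + t) (fun x => cis (m%:~R * x) * f x)) //; last first.
  by move=> x; rewrite cis_period pf.
rewrite [a + t + _]addrAC -cint_shift; last exact: clint_meas.
rewrite -cintZ; last exact: (clint_shift t cg).
apply: eq_cint => x _; rewrite mulrA -cisD; congr (cis _ * _); ring.
Qed.

Lemma cint_fubini_real c d a (m : int) (u : R -> R) : c <= d -> lint u ->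
  periodic u (pi *+ 2) ->
  cint a (a + pi *+ 2)
    (fun x => cis (m%:~R * x) * (rint c d (fun t => u (x + t)))%:C) =
  cint c d (fun t => cis (- m%:~R * t)) *
  cint a (a + pi *+ 2) (fun x => cis (m%:~R * x) * (u x)%:C).
Proof.
move=> cd iu pu; set k : R := m%:~R.
have cc : continuous (fun x : R => cos (k * x)).
  move=> x; apply: (@continuous_comp _ _ _ ( *%R k) cos); first exact: mulrl_continuous.
  exact: continuous_cos.
have cs : continuous (fun x : R => sin (k * x)).
  move=> x; apply: (@continuous_comp _ _ _ ( *%R k) sin); first exact: mulrl_continuous.
  exact: continuous_sin.
have c1 x : `|cos (k * x)| <= 1 by exact: cos_max.
have s1 x : `|sin (k * x)| <= 1 by exact: sin_max.
transitivity (cint c d (fun t =>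
    cint a (a + pi *+ 2) (fun x => cis (k * x) * (u (x + t))%:C))).
  rewrite !cintE; congr (_ +i* _) => /=.
    under eq_rint do rewrite mulr0 subr0.
    rewrite (rint_fubini _ _ cd iu cc c1); apply: eq_rint => t _.
    by apply: eq_rint => x _; rewrite mulr0 subr0.
  under eq_rint do rewrite mulr0 add0r.
  rewrite (rint_fubini _ _ cd iu cs s1); apply: eq_rint => t _.
  by apply: eq_rint => x _; rewrite mulr0 add0r.
have ciu : clint (of_real u) by split => //=; exact: lint_cst.
have pru : periodic (of_real u) (pi *+ 2) by move=> x; rewrite /of_real pu.
rewrite [RHS]mulrC -cintZ; last exact: clint_cis.
apply: eq_cint => t _; rewrite mulrC.
exact: (cint_period_shift m a t ciu pru).
Qed.

(** With the integrations exchanged, each translate of f contributes the same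
    coefficient up to the factor exp(-imt); this is why averaging acts on Fourier
    coefficients by multiplication. *)
Lemma cint_fubini c d a (m : int) f : c <= d -> clint f ->
  periodic f (pi *+ 2) -> clint (fun x => cint c d (fun t => f (x + t))) ->
  cint a (a + pi *+ 2)
    (fun x => cis (m%:~R * x) * cint c d (fun t => f (x + t))) =
  cint c d (fun t => cis (- m%:~R * t)) *
  cint a (a + pi *+ 2) (fun x => cis (m%:~R * x) * f x).
Proof.
move=> cd [f1 f2] pf [U1 U2].
have p1 : periodic (fun x => complex.Re (f x)) (pi *+ 2) by move=> x; rewrite pf.
have p2 : periodic (fun x => complex.Im (f x)) (pi *+ 2) by move=> x; rewrite pf.
have E1 := cint_fubini_real a m cd f1 p1.
have E2 := cint_fubini_real a m cd f2 p2.
have split_ri (g : R -> R[i]) : clint g ->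
    cint a (a + pi *+ 2) (fun x => cis (m%:~R * x) * g x) =
    cint a (a + pi *+ 2) (fun x => cis (m%:~R * x) * (complex.Re (g x))%:C) +
    (0 +i* 1) * cint a (a + pi *+ 2)
      (fun x => cis (m%:~R * x) * (complex.Im (g x))%:C).
  move=> [g1 g2].
  have cr : clint (of_real (fun x => complex.Re (g x))).
    by split => //=; exact: lint_cst.
  have ci : clint (of_real (fun x => complex.Im (g x))).
    by split => //=; exact: lint_cst.
  rewrite -cintZ; last exact: clint_cisM.
  rewrite -cintD; [|exact: clint_cisM|apply: clintZ; exact: clint_cisM].
  apply: eq_cint => x _; rewrite mulrCA -mulrDr; congr (_ * _).
  by apply: complex_eq; rewrite ?(ReD, ImD, ReM, ImM) /=; ring.
rewrite split_ri; last by split.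
rewrite [X in _ = _ * X]split_ri; last by split.
by rewrite /= E1 E2 mulrDr mulrCA.
Qed.

(** Stated as a product, so as to cover k = 0 without a division. *)
Lemma cint_cis a b k : a <= b ->
  (0 +i* k) * cint a b (fun x => cis (k * x)) = cis (k * b) - cis (k * a).
Proof.
move=> ab; have dk (x : R) : is_derive x (1 : R) (fun x : R => k * x) k.
  by rewrite -[X in is_derive _ _ _ X]mulr1; exact: is_deriveZ.
have ck (x : R) : {for x, continuous (fun x : R => k * x)}.
  exact: mulrl_continuous.
have dcos (x : R) : is_derive x (1 : R) (fun x : R => cos (k * x)) (- sin (k * x) * k).
  exact: is_derive1_comp.
have dsin (x : R) : is_derive x (1 : R) (fun x : R => sin (k * x)) (cos (k * x) * k).
  exact: is_derive1_comp.
have ccos : continuous (fun x : R => cos (k * x) * k).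
  move=> x; apply: cvgM; last exact: cvg_cst.
  by apply: continuous_comp; [exact: ck | exact: continuous_cos].
have csin : continuous (fun x : R => - sin (k * x) * k).
  move=> x; apply: cvgM; last exact: cvg_cst.
  by apply: cvgN; apply: continuous_comp; [exact: ck | exact: continuous_sin].
rewrite -cintZ; last exact: clint_cis.
rewrite cintE; apply: complex_eq; rewrite ?ReD ?ImD ?ReN ?ImN /=.
  rewrite -(rint_FTC ab csin dcos); apply: eq_rint => x _.
  by ring.
rewrite -(rint_FTC ab ccos dsin); apply: eq_rint => x _.
by ring.
Qed.

End ComplexIntegrals.

(** * Integrability and elementary norm estimates in a Banach lattice *)

Lemma two_pi_gt0 (R : realType) : 0 < (pi *+ 2 : R).
Proof. by rewrite mulrn_wgt0 // pi_gt0. Qed.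

Section PeriodicIntegrable.
Context {R : realType}.
Implicit Types (u : R -> R) (a b c : R).

Lemma le_integral_cat a b c u : a <= b -> b <= c -> lmeas u ->
  (forall x, 0 <= u x) ->
  (\int[mu_leb R]_(x in `[a, c]) (u x)%:E <=
   \int[mu_leb R]_(x in `[a, b]) (u x)%:E +
   \int[mu_leb R]_(x in `[b, c]) (u x)%:E)%E.
Proof.
move=> ab bc mu u0.
have mo : measurable (`]b, c]%classic : set (lebesgueType R)).
  by apply: borel_lebesgue; exact: measurable_itv.
have E := segment_setU ab bc.
have me : measurable_fun [set: lebesgueType R] (EFin \o u) by exact/measurable_EFinP.
rewrite E ge0_integral_setU.
- rewrite leeD2l //; apply: ge0_subset_integral.
  + exact: mo.
  + exact: measurable_segment.
  + exact: measurable_funTS.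
  + by move=> x _; rewrite lee_fin.
  + by move=> x /=; rewrite !in_itv /= => /andP[/ltW -> ->].
- exact: measurable_segment.
- exact: mo.
- exact: measurable_funTS.
- by move=> x _; rewrite lee_fin.
- by apply/disj_setPS => x /= []; rewrite !in_itv /= => /andP[_ xb] /andP[]; rewrite ltNge xb.
Qed.

(** Every segment lies in finitely many periods, over each of which the integral
    is the same. *)
Lemma lint_periodic u : lmeas u -> periodic u (pi *+ 2) ->
  (forall x, 0 <= u x) ->
  (\int[mu_leb R]_(x in `[(- pi)%R, pi]) (u x)%:E < +oo)%E -> lint u.
Proof.
move=> mu pu u0 ufin.
have pZ (m : int) x : u (x + m%:~R * (pi *+ 2)) = u x.
  have H (n : nat) y : u (y + n%:R * (pi *+ 2)) = u y.
    by rewrite mulr_natl; exact: (periodicn pu).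
  case: m => n; first exact: H.
  by rewrite NegzE mulrNz mulNr -[LHS](H n.+1) addrNK.
pose G a b := (\int[mu_leb R]_(x in `[a, b]) (u x)%:E)%E.
have GZ (m : int) a b : G (a + m%:~R * (pi *+ 2)) (b + m%:~R * (pi *+ 2)) = G a b.
  rewrite /G -integral_shift //; apply: eq_integral => x _.
  by rewrite pZ.
have p2 := two_pi_gt0 R.
have Gn (n : nat) : (G (- pi)%R (- pi + n%:R * (pi *+ 2))%R < +oo)%E.
  elim: n => [|n IH].
    apply: le_lt_trans ufin; rewrite mul0r addr0; apply: ge0_subset_integral.
    + exact: measurable_segment.
    + exact: measurable_segment.
    + exact: lmeas_EFin.
    + by move=> x _; rewrite lee_fin.
    + move=> x /=; rewrite !in_itv /= => /andP[-> h] /=; apply: le_trans h _.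
      by have := @pi_ge0 R; lra.
  apply: (@le_lt_trans _ _ (G (- pi)%R (- pi + n%:R * (pi *+ 2))%R +
     G (- pi + n%:R * (pi *+ 2))%R (- pi + n.+1%:R * (pi *+ 2))%R)%E).
    apply: le_integral_cat => //; first by rewrite lerDl mulr_ge0 // ltW.
    by rewrite lerD2l ler_wpM2r ?ler_nat // ltW.
  rewrite lte_add_pinfty //.
  have -> : - pi + n.+1%:R * (pi *+ 2) = pi + n%:R * (pi *+ 2) :> R.
    by rewrite -natr1; ring.
  by rewrite (GZ n).
split => // a b; apply/integrableP; split; first exact: lmeas_EFin.
under eq_integral => x _ do rewrite /= ger0_norm //.
(* Periods needed to the left and to the right of [-pi, pi] to cover [a, b]. *)
pose m := Num.bound `|(- pi - a) / (pi *+ 2)|.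
pose n := Num.bound `|(b + pi) / (pi *+ 2)|.
have mP : (- pi - a) < m%:R * (pi *+ 2).
  by rewrite -ltr_pdivrMr //; apply: le_lt_trans (ler_norm _) _; exact: archi_boundP.
have nP : (b + pi) < n%:R * (pi *+ 2).
  by rewrite -ltr_pdivrMr //; apply: le_lt_trans (ler_norm _) _; exact: archi_boundP.
have := Gn (m + n)%N; rewrite -(GZ (- m%:Z)); apply: le_lt_trans.
apply: ge0_subset_integral.
- exact: measurable_segment.
- exact: measurable_segment.
- exact: lmeas_EFin.
- by move=> x _; rewrite lee_fin.
- move=> x /=; rewrite !in_itv /= => /andP[ax xb].
  by rewrite mulrNz /= natrD mulrDl -!pmulrn; apply/andP; split; lra.
Qed.

End PeriodicIntegrable.

(** Assumption A and the hypothesis on the S_n, with explicit constants. *)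
Local Notation averages_bounded X K :=
  (forall h f, 0 < h -> bl_mem X f -> bl_mem X (steklov h f) /\
    bl_norm X (steklov h f) <= K * bl_norm X f).
Local Notation partial_sums_bounded X K :=
  (forall n f, (0 < n)%N -> bl_mem X f -> bl_mem X (fourier_sum n f) /\
    bl_norm X (fourier_sum n f) <= K * bl_norm X f).

Section Lattice.
Context {R : realType} (X : banach_lattice R).
Implicit Types (f g : R -> R[i]) (a b c h x y K : R) (z w : R[i]).

Lemma covers_circle x : periodize (@circle R) x.
Proof.
have p2 := two_pi_gt0 R.
exists (- Num.floor ((x + pi) / (pi *+ 2))); rewrite /circle /= in_itv /=.
set t := (x + pi) / (pi *+ 2).
have -> : x = t * (pi *+ 2) - pi by rewrite /t mulfVK ?gt_eqF // addrK.
have /andP[h1 h2] := floor_itv t.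
rewrite -[(pi *+ 2) *~ _]mulrzr mulrNz mulrN.
have : 0 <= (t - (Num.floor t)%:~R) * (pi *+ 2) by rewrite mulr_ge0 ?subr_ge0 // ltW.
have : (t - (Num.floor t)%:~R) * (pi *+ 2) < 1 * (pi *+ 2).
  by rewrite ltr_pM2r // ltrBlDr addrC -[X in _ < _ + X]/(1%:~R) -intrD.
rewrite mul1r mulrBl; move: (t * _) => T; rewrite [_ * (Num.floor t)%:~R]mulrC.
by move: ((Num.floor t)%:~R * _) => F h3 h4; apply/andP; split; lra.
Qed.

Lemma bl_mem1 : bl_mem X (of_real (fun=> 1)).
Proof.
have mc : measurable (@circle R : set (lebesgueType R)).
  by apply: borel_lebesgue; exact: measurable_itv.
have [m _] := bl_indic X mc (@subset_refl _ _).
suff -> : of_real (fun=> 1) = of_real (\1_(periodize (@circle R)) : R -> R) by [].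
by apply/funext => x; rewrite /of_real indicE mem_set //; exact: covers_circle.
Qed.

Lemma bl_mem0 : bl_mem X (fun=> 0).
Proof.
have := bl_scale 0 bl_mem1; congr (bl_mem X _).
by apply/funext => x; rewrite mul0r.
Qed.

Lemma bl_memD f g : bl_mem X f -> bl_mem X g -> bl_mem X (fun x => f x + g x).
Proof. exact: bl_add. Qed.

(** Sums appear below under a binder rather than as sums of functions. *)
Lemma bl_normD' f g : bl_mem X f -> bl_mem X g ->
  bl_norm X (fun x => f x + g x) <= bl_norm X f + bl_norm X g.
Proof. exact: bl_normD. Qed.

Lemma bl_memN f : bl_mem X f -> bl_mem X (fun x => - f x).
Proof.
move=> mf; have := bl_scale (-1) mf; congr (bl_mem X _).
by apply/funext => x; rewrite mulN1r.
Qed.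

Lemma bl_normN f : bl_mem X f -> bl_norm X (fun x => - f x) = bl_norm X f.
Proof.
move=> mf; have := bl_normZ (-1) mf; rewrite modulusN modulus1 mul1r => <-.
by congr (bl_norm X _); apply/funext => x; rewrite mulN1r.
Qed.

Lemma bl_memB f g : bl_mem X f -> bl_mem X g -> bl_mem X (fun x => f x - g x).
Proof. by move=> mf mg; apply: bl_memD => //; exact: bl_memN. Qed.

Lemma bl_normB f g : bl_mem X f -> bl_mem X g ->
  bl_norm X (fun x => f x - g x) <= bl_norm X f + bl_norm X g.
Proof.
by move=> mf mg; rewrite -(bl_normN mg); apply: bl_normD' => //; exact: bl_memN.
Qed.

Lemma bl_norm_cst0 : bl_norm X (fun=> 0) = 0.
Proof.
rewrite -[RHS](mul0r (bl_norm X (fun=> 0))) -[X in X * _](@modulus0 R).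
rewrite -(bl_normZ 0 bl_mem0).
by congr (bl_norm X _); apply/funext => x; rewrite mul0r.
Qed.

Lemma bl_norm_ge0 f : bl_mem X f -> 0 <= bl_norm X f.
Proof.
move=> mf; have := bl_normB mf mf.
have -> : (fun x => f x - f x) = fun=> 0 by apply/funext => x; rewrite subrr.
by rewrite bl_norm_cst0; lra.
Qed.

Lemma bl_mem_sum (I : Type) (s : seq I) (F : I -> R -> R[i]) :
  (forall i, bl_mem X (F i)) -> bl_mem X (fun x => \sum_(i <- s) F i x).
Proof.
move=> mF; elim: s => [|i s IH].
  by under eq_fun do rewrite big_nil; exact: bl_mem0.
by under eq_fun do rewrite big_cons; exact: bl_memD.
Qed.

Lemma bl_norm_sum (I : Type) (s : seq I) (F : I -> R -> R[i]) :
  (forall i, bl_mem X (F i)) ->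
  bl_norm X (fun x => \sum_(i <- s) F i x) <= \sum_(i <- s) bl_norm X (F i).
Proof.
move=> mF; elim: s => [|i s IH].
  by under eq_fun do rewrite big_nil; rewrite bl_norm_cst0 big_nil.
under eq_fun do rewrite big_cons; rewrite big_cons.
apply: le_trans (bl_normD' _ _) _ => //; first exact: bl_mem_sum.
by rewrite lerD2l.
Qed.

Lemma bl_le f (u : R -> R) : cmeasurable f -> periodic f (pi *+ 2) ->
  bl_mem X (of_real u) -> (forall x, modulus (f x) <= u x) ->
  bl_mem X f /\ bl_norm X f <= bl_norm X (of_real u).
Proof.
move=> mf pf mu fu; apply: (bl_solid mf pf mu) => x; rewrite /of_real modulus_real.
by apply: le_trans (fu x) (ler_norm _).
Qed.

Lemma bl_bounded f K : cmeasurable f -> periodic f (pi *+ 2) ->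
  (forall x, modulus (f x) <= K) ->
  bl_mem X f /\ bl_norm X f <= K * bl_norm X (of_real (fun=> 1)).
Proof.
move=> mf pf fK.
have K0 : 0 <= K by apply: le_trans (fK 0); exact: modulus_ge0.
have mK := bl_scale K%:C bl_mem1.
have nK := bl_normZ K%:C bl_mem1; rewrite modulus_real ger0_norm // in nK.
rewrite -nK; apply: (bl_solid mf pf mK) => x.
by rewrite modulusM !modulus_real normr1 mulr1 (le_trans (fK x)) // ler_norm.
Qed.

Lemma bl_modulus f : bl_mem X f ->
  bl_mem X (of_real (fun x => modulus (f x))) /\
  bl_norm X (of_real (fun x => modulus (f x))) <= bl_norm X f.
Proof.
move=> mf; apply: (bl_solid _ _ mf).
- by apply: cmeasurable_real; apply: lmeas_modulus; exact: (bl_measurable mf).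
- by move=> x; rewrite /of_real (bl_periodic mf).
- by move=> x; rewrite modulus_real ger0_norm // modulus_ge0.
Qed.

(** The embedding of X into the integrable functions over a period.  It makes the
    Fourier coefficients continuous on X and lets all integrals be manipulated. *)
Lemma bl_clint_bound : exists2 c : R, 0 < c & forall f, bl_mem X f ->
  clint f /\ rint (- pi) pi (fun x => modulus (f x)) <= c * bl_norm X f.
Proof.
have mc : measurable (@circle R : set (lebesgueType R)).
  by apply: borel_lebesgue; exact: measurable_itv.
have [_ [c c0 H]] := bl_indic X mc (@subset_refl _ _).
have p2 := two_pi_gt0 R.
exists (pi *+ 2 * c); first exact: mulr_gt0.
move=> f mf.
have mm := lmeas_modulus (bl_measurable mf).
have [mb bb] := null_point (pi : R).
have E : (\int[mu_leb R]_(x in `[(- pi)%R, pi]) (modulus (f x))%:E =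
          \int[mu_leb R]_(x in @circle R) (modulus (f x))%:E)%E.
  rewrite (ge0_negligible_integral mb (measurable_segment _ _)).
  - by rewrite circleE.
  - exact: lmeas_EFin.
  - by move=> x _; rewrite lee_fin modulus_ge0.
  - exact: bb.
have B : (\int[mu_leb R]_(x in `[(- pi)%R, pi]) (modulus (f x))%:E <=
   (pi *+ 2 * c * bl_norm X f)%:E)%E.
  rewrite E; have := H f mf; rewrite -lee_pdivlMl ?invr_gt0 //.
  by rewrite invrK -EFinM mulrA.
have im : lint (fun x => modulus (f x)).
  apply: lint_periodic => //.
  - by move=> x; rewrite (bl_periodic mf).
  - by move=> x; exact: modulus_ge0.
  - exact: le_lt_trans B (ltry _).
split; first exact: (clint_le (bl_measurable mf) im).
rewrite -lee_fin; apply: le_trans B; rewrite /rint /Rintegral fineK //.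
apply: integrable_fin_num; first exact: measurable_segment.
exact: lint_integrable.
Qed.

Lemma bl_clint f : bl_mem X f -> clint f.
Proof. by have [c _ H] := bl_clint_bound => /H[]. Qed.

(** For a function of norm 0 all its multiples lie in the unit ball, so that the
    image has norm 0 as well; otherwise one normalizes. *)
Lemma ball_bound (T : (R -> R[i]) -> R -> R[i]) K :
  (forall z f, bl_mem X f -> bl_norm X (T (fun x => z * f x)) =
     modulus z * bl_norm X (T f)) ->
  (forall f, bl_mem X f -> bl_norm X f <= 1 -> bl_norm X (T f) <= K) ->
  0 <= K -> forall f, bl_mem X f -> bl_norm X (T f) <= K * bl_norm X f.
Proof.
move=> TZ TK K0 f mf; have := bl_norm_ge0 mf; rewrite le_eqVlt => /predU1P[n0|n0].
  rewrite -n0 mulr0 leNgt; apply/negP => tpos.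
  pose c := (K + 1) / bl_norm X (T f).
  have c0 : 0 < c by rewrite divr_gt0 // ltr_wpDl.
  have := TK (fun x => c%:C * f x) (bl_scale _ mf).
  rewrite bl_normZ // -n0 mulr0 ler01 TZ // modulus_real gtr0_norm //.
  by rewrite /c mulfVK ?gt_eqF // => /(_ isT); lra.
have c0 : 0 < (bl_norm X f)^-1 by rewrite invr_gt0.
have := TK (fun x => ((bl_norm X f)^-1)%:C * f x) (bl_scale _ mf).
rewrite bl_normZ // TZ // modulus_real gtr0_norm // mulVf ?gt_eqF //.
by rewrite ler_pdivrMl // mulrC => /(_ (lexx _)).
Qed.

End Lattice.

(** * Means over intervals and Assumption A *)

Section Means.
Context {R : realType}.
Implicit Types (f g : R -> R[i]) (a b c h x y K : R) (z w : R[i]).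

(** Means over [x + a, x + b] include the averages A_h (a = -h/2, b = h/2), the
    one-sided averages (a = 0, b = h) and the backward averages needed for
    interpolation. *)
Definition mean a b f x : R[i] := ((b - a)^-1)%:C * cint (x + a) (x + b) f.

Lemma steklovE h f : steklov h f = mean (- (h / 2)) (h / 2) f.
Proof.
apply/funext => x; rewrite /steklov /mean opprK.
by have -> : h / 2 + h / 2 = h by lra.
Qed.

Lemma steklov_fwdE h f : steklov_fwd h f = mean 0 h f.
Proof.
apply/funext => x; rewrite /steklov_fwd /steklov /mean subr0 addr0.
have -> : x + h / 2 - h / 2 = x by lra.
by have -> : x + h / 2 + h / 2 = x + h by lra.
Qed.

Lemma mean_steklov a b f x : mean a b f x = steklov (b - a) f (x + (a + b) / 2).
Proof.
rewrite /mean /steklov.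
have -> : x + (a + b) / 2 - (b - a) / 2 = x + a by lra.
by have -> : x + (a + b) / 2 + (b - a) / 2 = x + b by lra.
Qed.

Lemma meanB a b f g : clint f -> clint g ->
  mean a b (fun x => f x - g x) = (fun x => mean a b f x - mean a b g x).
Proof. by move=> cf cg; apply/funext => x; rewrite /mean cintB // mulrBr. Qed.

Lemma meanZ a b z f : clint f ->
  mean a b (fun x => z * f x) = (fun x => z * mean a b f x).
Proof. by move=> cf; apply/funext => x; rewrite /mean cintZ // mulrCA. Qed.

Lemma mean_sum (I : Type) (s : seq I) (F : I -> R -> R[i]) a b :
  (forall i, clint (F i)) ->
  mean a b (fun x => \sum_(i <- s) F i x) =
  (fun x => \sum_(i <- s) mean a b (F i) x).
Proof.
by move=> cF; apply/funext => x; rewrite /mean cint_sum // mulr_sumr.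
Qed.

Lemma mean_periodic a b f : cmeasurable f -> periodic f (pi *+ 2) ->
  periodic (mean a b f) (pi *+ 2).
Proof.
move=> mf pf x; rewrite /mean; congr (_ * _).
rewrite [x + _ + a]addrAC [x + _ + b]addrAC -cint_shift //.
by apply: eq_cint => y _; rewrite pf.
Qed.

Lemma modulus_mean a b f x : a < b -> clint f ->
  modulus (mean a b f x) <=
  2 / (b - a) * rint (x + a) (x + b) (fun y => modulus (f y)).
Proof.
move=> ab cf; rewrite /mean modulusM modulus_real gtr0_norm; last first.
  by rewrite invr_gt0 subr_gt0.
rewrite -mulrA mulrCA ler_pM2l ?invr_gt0 ?subr_gt0 //.
exact: modulus_cint.
Qed.

End Means.

Section AverageBound.
Context {R : realType} (X : banach_lattice R).
Implicit Types (f g : R -> R[i]) (a b c h x y K : R) (z w : R[i]).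

Lemma ereal_sup_fin_bound (S : set (\bar R)) : (ereal_sup S < +oo)%E ->
  exists2 K, 0 <= K & forall r : R, S r%:E -> r <= K.
Proof.
move=> Sfin; case E : (ereal_sup S) Sfin => [k| |] // _.
  exists (Num.max k 0); first by rewrite le_max lexx orbT.
  move=> r Sr; rewrite le_max -[r <= k]lee_fin -E.
  by rewrite (ereal_sup_ubound Sr).
by exists 0 => // r /ereal_sup_ubound; rewrite E leeNy_eq.
Qed.

Lemma steklov_bound : assumption_A X -> exists2 K, 0 <= K & averages_bounded X K.
Proof.
move=> [mA /ereal_sup_fin_bound[K K0 HK]]; exists K => // h f h0 mf.
split; first exact: mA.
apply: (ball_bound _ _ K0 mf) => {f mf} [z f mf|f mf nf].
  rewrite steklovE meanZ; last exact: bl_clint mf.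
  by rewrite -steklovE bl_normZ //; exact: mA.
by apply: HK; exists h => //; exists f.
Qed.

End AverageBound.

Section Domination.
Context {R : realType} (X : banach_lattice R) (KA : R).
Hypothesis KA0 : 0 <= KA.
Hypothesis HA : averages_bounded X KA.
Implicit Types (f g : R -> R[i]) (a b c h x y K H : R) (z w : R[i]).

(** The averages of |f| form the function A_H |f|, to which Assumption A applies;
    solidity then passes the bound to g. *)
Lemma bl_dominated_by_averages C H f g : 0 < H -> 0 <= C -> bl_mem X f -> cmeasurable g ->
  periodic g (pi *+ 2) ->
  (forall x, modulus (g x) <=
     C * (H^-1 * rint (x - H / 2) (x + H / 2) (fun y => modulus (f y)))) ->
  bl_mem X g /\ bl_norm X g <= C * KA * bl_norm X f.
Proof.
move=> H0 C0 mf mg pg gC.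
have [mm nm] := bl_modulus mf.
have [ms ns] := HA H0 mm.
have mu := bl_scale C%:C ms.
have E : (fun x => C%:C * steklov H (of_real (fun x => modulus (f x))) x) =
  of_real (fun x => C * (H^-1 *
    rint (x - H / 2) (x + H / 2) (fun y => modulus (f y)))).
  apply/funext => x; rewrite /of_real /steklov !rmorphM /=; congr (_ * (_ * _)).
  rewrite -/(cint _ _ _) cintE /=; apply: complex_eq => //=.
  by have := rint_cst 0 (_ : x - H / 2 <= x + H / 2); rewrite mul0r; apply; lra.
have nu := bl_normZ C%:C ms.
rewrite E in mu nu; have [mg' ng] := bl_le mg pg mu gC; split => //.
apply: le_trans ng _; rewrite nu modulus_real ger0_norm // -mulrA ler_wpM2l //.
by apply: le_trans ns _; rewrite ler_wpM2l.
Qed.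

(** A mean over a part of [x - H/2, x + H/2] is dominated by the average over the
    whole of it, at the cost of the ratio of the lengths. *)
Lemma bl_mean a b H f : a < b -> - (H / 2) <= a -> b <= H / 2 -> bl_mem X f ->
  bl_mem X (mean a b f) /\
  bl_norm X (mean a b f) <= 2 * H / (b - a) * KA * bl_norm X f.
Proof.
move=> ab aH bH mf; have H0 : 0 < H by lra.
have ba : 0 < b - a by rewrite subr_gt0.
have cf := bl_clint mf; have im := clint_modulus cf.
apply: (bl_dominated_by_averages H0 _ mf).
- by rewrite !mulr_ge0 // ?invr_ge0 ltW.
- have -> : mean a b f = fun x => steklov (b - a) f (x + (a + b) / 2).
    by apply/funext => x; exact: mean_steklov.
  apply: cmeasurable_shift; apply: bl_measurable; exact: (HA ba mf).1.
- exact: mean_periodic (clint_meas cf) (bl_periodic mf).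
- move=> x; apply: le_trans (modulus_mean x ab cf) _.
  rewrite [2 * H / _]mulrAC -[2 / (b - a) * H * _]mulrA; apply: ler_wpM2l.
    by rewrite mulr_ge0 // invr_ge0 ltW.
  rewrite mulrA mulfV ?gt_eqF // mul1r; apply: le_rint_itv => //.
  + by rewrite lerD2l.
  + by rewrite lerD2l ltW.
  + by rewrite lerD2l.
  + by move=> y; exact: modulus_ge0.
Qed.

Lemma bl_mem_mean a b f : a < b -> bl_mem X f -> bl_mem X (mean a b f).
Proof.
move=> ab mf; have := @bl_mean a b (2 * (`|a| + `|b|)) f ab.
have na := ler_norm (- a); rewrite normrN in na.
have nb := ler_norm b; have a0 := normr_ge0 a; have b0 := normr_ge0 b.
by move=> []; [lra|lra| |].
Qed.

Lemma bl_mean_fwd h f : 0 < h -> bl_mem X f ->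
  bl_mem X (mean 0 h f) /\ bl_norm X (mean 0 h f) <= 4 * KA * bl_norm X f.
Proof.
move=> h0 mf; have [] := @bl_mean 0 h (2 * h) f h0; [lra|lra|by []|].
move=> m n; split => //; congr (_ <= _): n.
by rewrite subr0 mulrA mulfK ?gt_eqF //; congr (_ * _ * _); rewrite -natrM.
Qed.

End Domination.

(** * Fourier coefficients and trigonometric polynomials *)

Section SymSum.
Context {R : realType}.
Implicit Types (a b : int -> R[i]) (n : nat) (k : int).

Lemma sym_sumE n a : sym_sum n a = \sum_(0 <= j < n.*2.+1) a (j%:Z - n%:Z).
Proof. by rewrite big_mkord. Qed.

Lemma eq_sym_sum n a b : (forall k, (`|k| <= n)%N -> a k = b k) ->
  sym_sum n a = sym_sum n b.
Proof. by move=> ab; apply: eq_bigr => j _; apply: ab; have := ltn_ord j; lia. Qed.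

Lemma sym_sumD n a b : sym_sum n (fun k => a k + b k) = sym_sum n a + sym_sum n b.
Proof. exact: big_split. Qed.

Lemma sym_sumZ n (z : R[i]) a : sym_sum n (fun k => z * a k) = z * sym_sum n a.
Proof. by rewrite /sym_sum mulr_sumr. Qed.

Lemma sym_sumS n a :
  sym_sum n.+1 a = sym_sum n a + (a n.+1%:Z + a (- n.+1%:Z)).
Proof.
rewrite /sym_sum doubleS big_ord_recr big_ord_recl /=.
have -> : n.*2.+2%:Z - n.+1%:Z = n.+1%:Z :> int by lia.
rewrite sub0r -addrA [LHS]addrC -addrA; congr (_ + (_ + _)).
by apply: eq_bigr => j _; congr a; rewrite /bump /=; lia.
Qed.

Lemma sym_sum_delta n k (z : R[i]) :
  sym_sum n (fun j => if j == k then z else 0) = if (`|k| <= n)%N then z else 0.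
Proof.
elim: n => [|n IH].
  by rewrite /sym_sum big_ord1 subrr leqn0 absz_eq0 eq_sym.
rewrite sym_sumS IH; have [E1|E1] := eqVneq n.+1%:Z k;
  have [E2|E2] := eqVneq (- n.+1%:Z) k; case: ifP => h1; case: ifP => h2;
  rewrite ?addr0 ?add0r //; exfalso; lia.
Qed.

Lemma sym_sum_widen m n a : (m <= n)%N ->
  sym_sum m a = sym_sum n (fun k => if (`|k| <= m)%N then a k else 0).
Proof.
elim: n => [|n IH].
  by rewrite leqn0 => /eqP ->; apply: eq_sym_sum => k ->.
rewrite leq_eqVlt => /predU1P[->|]; first by apply: eq_sym_sum => k ->.
rewrite ltnS => mn; rewrite sym_sumS -(IH mn) !ifF ?addr0 //; lia.
Qed.

Lemma modulus_sym_sum n a :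
  modulus (sym_sum n a) <= \sum_(j < n.*2.+1) modulus (a (j%:Z - n%:Z)).
Proof. exact: modulus_sum. Qed.

End SymSum.

Section Coefficients.
Context {R : realType}.
Implicit Types (f g : R -> R[i]) (x a b : R) (z : R[i]) (c : int -> R[i]).
Implicit Types (n m : nat) (k j : int).

Definition e_ k x : R[i] := cis (k%:~R * x).

Definition trig n c x : R[i] := sym_sum n (fun k => c k * e_ k x).

Lemma e_D k j x : e_ (k + j) x = e_ k x * e_ j x.
Proof. by rewrite /e_ intrD mulrDl cisD. Qed.

Lemma e_0 x : e_ 0 x = 1.
Proof. by rewrite /e_ mul0r cis0. Qed.

Lemma modulus_e k x : modulus (e_ k x) = 1.
Proof. exact: modulus_cis. Qed.

Lemma e_periodic k : periodic (e_ k) (pi *+ 2).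
Proof. exact: cis_period. Qed.

Lemma clint_e k : clint (e_ k).
Proof. exact: clint_cis. Qed.

Lemma cmeasurable_e k : cmeasurable (e_ k).
Proof. exact: cmeasurable_cis. Qed.

Lemma clint_eM k f : clint f -> clint (fun x => e_ k x * f x).
Proof. exact: clint_cisM. Qed.

Lemma cintegral_circle f : clint f -> cintegral (@circle R) f = cint (- pi) pi f.
Proof.
move=> [f1 f2]; suff H (u : R -> R) : lint u ->
    \int[mu_leb R]_(x in @circle R) u x = rint (- pi) pi u.
  by rewrite cintE /cintegral !H.
move=> iu.
have [mb bb] := null_point (pi : R).
rewrite /rint /Rintegral.
rewrite (negligible_integral mb (measurable_segment _ _)
  (lint_integrable _ _ iu) bb).
by rewrite circleE.
Qed.

Lemma fourier_coefE f k : clint f -> fourier_coef f k =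
  ((pi *+ 2)^-1)%:C * cint (- pi) (- pi + pi *+ 2) (fun x => e_ (- k) x * f x).
Proof.
move=> cf; rewrite /fourier_coef; congr (_ * _).
have -> : (fun x => f x * cis (- (k%:~R * x))) = (fun x => e_ (- k) x * f x).
  by apply/funext => x; rewrite mulrC /e_ mulrNz mulNr.
rewrite cintegral_circle; last exact: clint_eM.
by have -> : - pi + pi *+ 2 = pi :> R by rewrite mulr2n; ring.
Qed.

Lemma fourier_coefD f g k : clint f -> clint g ->
  fourier_coef (fun x => f x + g x) k = fourier_coef f k + fourier_coef g k.
Proof.
move=> cf cg; rewrite !fourier_coefE //; last exact: clintD.
rewrite -mulrDr -cintD; [|exact: clint_eM|exact: clint_eM].
by congr (_ * _); apply: eq_cint => x _; rewrite mulrDr.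
Qed.

Lemma fourier_coefZ z f k : clint f ->
  fourier_coef (fun x => z * f x) k = z * fourier_coef f k.
Proof.
move=> cf; rewrite !fourier_coefE //; last exact: clintZ.
rewrite [RHS]mulrCA; congr (_ * _); rewrite -cintZ; last exact: clint_eM.
by apply: eq_cint => x _; rewrite mulrCA.
Qed.

Lemma fourier_coefB f g k : clint f -> clint g ->
  fourier_coef (fun x => f x - g x) k = fourier_coef f k - fourier_coef g k.
Proof.
move=> cf cg; have -> : (fun x => f x - g x) = (fun x => f x + -1 * g x).
  by apply/funext => x; rewrite mulN1r.
by rewrite fourier_coefD ?fourier_coefZ ?mulN1r //; exact: clintZ.
Qed.

Lemma fourier_coef_sum (I : Type) (s : seq I) (F : I -> R -> R[i]) k :
  (forall i, clint (F i)) ->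
  fourier_coef (fun x => \sum_(i <- s) F i x) k =
  \sum_(i <- s) fourier_coef (F i) k.
Proof.
move=> cF; rewrite fourier_coefE; last exact: clint_sum.
transitivity (((pi *+ 2)^-1)%:C *
    cint (- pi) (- pi + pi *+ 2) (fun x => \sum_(i <- s) e_ (- k) x * F i x)).
  by congr (_ * _); apply: eq_cint => x _; rewrite mulr_sumr.
rewrite cint_sum; last by move=> i; exact: clint_eM.
by rewrite mulr_sumr; apply: eq_bigr => i _; rewrite fourier_coefE.
Qed.

Lemma fourier_coef_e j k : fourier_coef (e_ j) k = if j == k then 1 else 0.
Proof.
have p2 := two_pi_gt0 R.
have pp : - pi <= - pi + pi *+ 2 :> R by rewrite lerDl ltW.
rewrite fourier_coefE; last exact: clint_e.
transitivity (((pi *+ 2)^-1)%:C * cint (- pi) (- pi + pi *+ 2) (@e_ (j - k))).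
  by congr (_ * _); apply: eq_cint => x _; rewrite -e_D addrC.
have [->|jk] := eqVneq j k.
  rewrite subrr (eq_cint (g := fun=> 1)); last by move=> x _; exact: e_0.
  rewrite cint_cst // mulr1 [- pi + _]addrC addrK -rmorphM mulVf ?rmorph1 //.
  by rewrite gt_eqF.
have := cint_cis (j - k)%:~R pp; rewrite mulrDr cisD cis_2pi_int mulr1 subrr.
move/eqP; rewrite mulf_eq0 => /predU1P[|/eqP ->]; last by rewrite mulr0.
by move=> [] /eqP; rewrite intr_eq0 subr_eq0 (negbTE jk).
Qed.

Lemma fourier_coef_modulate (m : int) f k : clint f ->
  fourier_coef (fun x => e_ m x * f x) k = fourier_coef f (k - m).
Proof.
move=> cf; rewrite !fourier_coefE //; last exact: clint_eM.
congr (_ * _); apply: eq_cint => x _.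
by rewrite mulrA -e_D; congr (e_ _ _ * _); ring.
Qed.

(** The symbol of the mean: its value on the exponential of frequency k, at 0. *)
Definition mean_mult a b k : R[i] := ((b - a)^-1)%:C * cint a b (e_ k).

Lemma fourier_coef_mean a b f k : a <= b -> clint f ->
  periodic f (pi *+ 2) -> clint (mean a b f) ->
  fourier_coef (mean a b f) k = mean_mult a b k * fourier_coef f k.
Proof.
move=> ab cf pf cm.
have E x : mean a b f x = ((b - a)^-1)%:C * cint a b (fun t => f (x + t)).
  rewrite /mean; congr (_ * _).
  rewrite [x + a]addrC [x + b]addrC -cint_shift; last exact: clint_meas.
  by apply: eq_cint => t _; rewrite addrC.
move: ab; rewrite le_eqVlt => /predU1P[ab|ab].
  have -> : mean a b f = fun=> 0 * 0.
    by apply/funext => x; rewrite E ab subrr invr0 mul0r mulr0.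
  rewrite fourier_coefZ; last exact: clint_cst.
  by rewrite /mean_mult ab subrr invr0 !mul0r.
have cU : clint (fun x => cint a b (fun t => f (x + t))).
  have := clintZ (b - a)%:C cm; congr clint; apply/funext => x.
  by rewrite E mulrA -rmorphM mulfV ?rmorph1 ?mul1r // subr_eq0 gt_eqF.
rewrite !fourier_coefE //.
have -> : cint (- pi) (- pi + pi *+ 2) (fun x => e_ (- k) x * mean a b f x) =
   ((b - a)^-1)%:C * cint (- pi) (- pi + pi *+ 2)
      (fun x => e_ (- k) x * cint a b (fun t => f (x + t))).
  rewrite -cintZ; last exact: clint_eM.
  by apply: eq_cint => x _; rewrite E mulrCA.
rewrite (cint_fubini _ _ (ltW ab) cf pf cU) /mean_mult.
rewrite -!mulrA mulrCA; congr (_ * _); rewrite mulrCA; congr (_ * _ ).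
by apply: eq_cint => t _; rewrite /e_ mulrNz opprK.
Qed.

Lemma mean_e a b k x : mean a b (e_ k) x = mean_mult a b k * e_ k x.
Proof.
rewrite /mean /mean_mult -mulrA; congr (_ * _).
rewrite [x + a]addrC [x + b]addrC -cint_shift; last exact: cmeasurable_e.
rewrite mulrC -cintZ; last exact: clint_e.
by apply: eq_cint => t _; rewrite /e_ mulrDr cisD mulrC.
Qed.

Lemma clint_trig n c : clint (trig n c).
Proof. by apply: clint_sum => j; apply: clintZ; exact: clint_e. Qed.

Lemma trig_periodic n c : periodic (trig n c) (pi *+ 2).
Proof. by move=> x; apply: eq_bigr => j _; rewrite e_periodic. Qed.

Lemma modulus_trig n c x :
  modulus (trig n c x) <= \sum_(j < n.*2.+1) modulus (c (j%:Z - n%:Z)).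
Proof.
apply: le_trans (modulus_sym_sum _ _) _; apply: ler_sum => j _.
by rewrite modulusM modulus_e mulr1.
Qed.

Lemma eq_trig n c d : (forall k, (`|k| <= n)%N -> c k = d k) ->
  trig n c = trig n d.
Proof. by move=> cd; apply/funext => x; apply: eq_sym_sum => k /cd ->. Qed.

Lemma trigD n c d x : trig n (fun k => c k + d k) x = trig n c x + trig n d x.
Proof. by rewrite /trig -sym_sumD; apply: eq_sym_sum => k _; rewrite mulrDl. Qed.

Lemma trigZ n z c x : trig n (fun k => z * c k) x = z * trig n c x.
Proof. by rewrite /trig -sym_sumZ; apply: eq_sym_sum => k _; rewrite mulrA. Qed.

Lemma trigB n c d x : trig n (fun k => c k - d k) x = trig n c x - trig n d x.
Proof.
rewrite -mulN1r -trigZ -trigD; congr trig.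
by apply/funext => k; rewrite mulN1r.
Qed.

Lemma trig_widen m n c : (m <= n)%N ->
  trig m c = trig n (fun k => if (`|k| <= m)%N then c k else 0).
Proof.
move=> mn; apply/funext => x; rewrite /trig (sym_sum_widen _ mn).
by apply: eq_sym_sum => k _; case: ifP; rewrite ?mul0r.
Qed.

Lemma fourier_coef_trig n c k :
  fourier_coef (trig n c) k = if (`|k| <= n)%N then c k else 0.
Proof.
rewrite fourier_coef_sum; last by move=> j; apply: clintZ; exact: clint_e.
rewrite -(sym_sum_delta n k); apply: eq_bigr => j _.
rewrite fourier_coefZ; last exact: clint_e.
by rewrite fourier_coef_e; case: eqP => [->|_]; rewrite ?mulr1 ?mulr0.
Qed.

Lemma fourier_sumE n f : fourier_sum n f = trig n (fourier_coef f).
Proof. by []. Qed.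

Lemma mean_trig a b n c :
  mean a b (trig n c) = trig n (fun k => mean_mult a b k * c k).
Proof.
rewrite mean_sum; last by move=> j; apply: clintZ; exact: clint_e.
apply/funext => x; apply: eq_bigr => j _.
rewrite meanZ; last exact: clint_e.
by rewrite mean_e mulrCA mulrA.
Qed.

End Coefficients.

(** * Multipliers of bounded variation *)

Section SummationByParts.
Context {R : realType}.

(** Summation by parts, which reduces multipliers to initial segments. *)
Lemma abel_sum (w a : nat -> R[i]) m :
  \sum_(i < m.+1) w i * a i = w m * (\sum_(i < m.+1) a i) -
  \sum_(i < m) (w i.+1 - w i) * (\sum_(j < i.+1) a j).
Proof.
elim: m => [|m IH]; first by rewrite !big_ord1 big_ord0 subr0.
rewrite big_ord_recr /= IH [in RHS]big_ord_recr /= [X in _ = _ - X]big_ord_recr /=.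
ring.
Qed.

End SummationByParts.

Section SymbolicCalculus.
Context {R : realType}.
Implicit Types (c : int -> R[i]) (n m : nat) (k : int).

Definition deriv_coef c k : R[i] := (0 +i* k%:~R) * c k.

Definition trig_deriv s n c := trig n (iter s deriv_coef c).

Lemma modulus_imag (r : R) : modulus (0 +i* r) = `|r|.
Proof. by rewrite /modulus /= expr0n /= add0r sqrtr_sqr. Qed.

(** The symbol 1/(ik) of integration, cut off to frequencies above m. *)
Definition reciprocal_mult m k : R[i] :=
  if (m < `|k|)%N then 0 +i* - (k%:~R)^-1 else 0.

Definition antideriv_coef m c k : R[i] := reciprocal_mult m k * c k.

Lemma deriv_antideriv_coef m c : (forall k, (`|k| <= m)%N -> c k = 0) ->
  deriv_coef (antideriv_coef m c) =1 c.
Proof.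
move=> c0 k; rewrite /deriv_coef /antideriv_coef /reciprocal_mult mulrA; case: ltnP => km.
  have k0 : (k%:~R : R) != 0 by rewrite intr_eq0; lia.
  rewrite -[RHS]mul1r; congr (_ * _).
  by apply: complex_eq; rewrite ?(ReM, ImM) /=; field.
by rewrite c0 // !mulr0.
Qed.

(** The cut-off reciprocal jumps by 1/(m+1) on both sides, and is monotone
    outside [-m, m], which accounts for another 1/(m+1) on each side; the last
    1/(m+1) bounds the final value. *)
Lemma reciprocal_variation n m (w := reciprocal_mult m) :
  modulus (w n%:Z) + \sum_(i < n.*2) modulus (w (i.+1%:Z - n%:Z) - w (i%:Z - n%:Z))
  <= 5 / m.+1%:R.
Proof.
pose v k : R := if (m < `|k|)%N then (k%:~R)^-1 else 0.
have wv k : w k = 0 +i* - v k.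
  by rewrite /w /reciprocal_mult /v; case: ifP => // _; rewrite oppr0.
have dw i j : modulus (w i - w j) = `|v i - v j|.
  rewrite !wv; have -> : (0 +i* - v i) - (0 +i* - v j) = 0 +i* (v j - v i).
    by apply: complex_eq; rewrite ?(ReD, ImD, ReN, ImN) /=; ring.
  by rewrite modulus_imag distrC.
rewrite wv modulus_imag normrN; under eq_bigr do rewrite dw.
have vN k : v (- k) = - v k.
  rewrite /v abszN; case: ifP => _; last by rewrite oppr0.
  by rewrite mulrNz invrN.
have m0 : 0 < (m.+1%:R : R)^-1 by rewrite invr_gt0 ltr0n.
have vn (p : nat) : v p%:Z = if (m < p)%N then (p%:R)^-1 else 0.
  by rewrite /v absz_nat -pmulrn.
have inv_le (p q : nat) : (0 < p)%N -> (p <= q)%N -> (q%:R : R)^-1 <= (p%:R)^-1.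
  move=> p0 pq; rewrite lef_pV2 ?posrE ?ltr0n ?ler_nat //; lia.
(* The exact variation over [-p, p]: none before the jump, then
   2/(m+1) for the jumps and 2/(m+1) - 2/p for the monotone tails. *)
have S p : \sum_(i < p.*2) `|v (i.+1%:Z - p%:Z) - v (i%:Z - p%:Z)| <=
    if (p <= m)%N then 0 else 4 / m.+1%:R - 2 / p%:R.
  elim: p => [|p IH]; first by rewrite big_ord0.
  rewrite doubleS big_ord_recr big_ord_recl /=.
  have -> : `|v (p.*2.+2%:Z - p.+1%:Z) - v (p.*2.+1%:Z - p.+1%:Z)| =
      `|v p.+1%:Z - v p%:Z|.
    by congr (`|v _ - v _|); lia.
  have -> : `|v (1%:Z - p.+1%:Z) - v (0%:Z - p.+1%:Z)| = `|v p.+1%:Z - v p%:Z|.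
    have -> : 1%:Z - p.+1%:Z = - p%:Z by lia.
    by rewrite sub0r !vN opprK addrC.
  have -> : \sum_(i < p.*2)
      `|v ((bump 0 i).+1%:Z - p.+1%:Z) - v ((bump 0 i)%:Z - p.+1%:Z)| =
      \sum_(i < p.*2) `|v (i.+1%:Z - p%:Z) - v (i%:Z - p%:Z)|.
    by apply: eq_bigr => i _; congr (`|v _ - v _|); rewrite /bump /=; lia.
  move: IH; set S0 := \sum_(i < _) _ => IH; rewrite !vn.
  case: (ltngtP p m) IH => pm IH.
  - have -> : (m < p.+1)%N = false by lia.
    by move: IH; rewrite subr0 normr0; lra.
  - have -> : (m < p.+1)%N by lia.
    rewrite ler0_norm ?subr_le0; last by apply: inv_le; lia.
    by move: (p.+1%:R^-1) (p%:R^-1) (m.+1%:R^-1) IH => A B C IH; lra.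
  - rewrite pm ltnSn; move: IH; rewrite subr0 => IH.
    by rewrite gtr0_norm //; move: (m.+1%:R^-1) => C; lra.
have := S n; set S0 := \sum_(i < _) _; rewrite vn.
case: (ltnP m n) => mn; last first.
  by rewrite normr0; move: (m.+1%:R^-1) m0 => C C0; lra.
have n0 : 0 < (n%:R : R)^-1 by rewrite invr_gt0 ltr0n; lia.
rewrite gtr0_norm //; have := inv_le m.+1 n isT mn.
by move: (n%:R^-1) (m.+1%:R^-1) n0 m0 => A C A0 C0; lra.
Qed.

End SymbolicCalculus.

Section Multipliers.
Context {R : realType} (X : banach_lattice R) (KS : R).
Hypothesis KS0 : 0 <= KS.
Hypothesis HS : partial_sums_bounded X KS.
Implicit Types (f g : R -> R[i]) (x : R) (z : R[i]) (c w : int -> R[i]).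
Implicit Types (n m l : nat) (k j : int).

Lemma bl_trig n c : bl_mem X (trig n c).
Proof.
apply: (bl_bounded _ (clint_meas (clint_trig n c)) (trig_periodic n c) _).1.
by move=> x; exact: modulus_trig.
Qed.

(** Multiplication by an exponential preserves the modulus, and the lattice norm
    depends on nothing else. *)
Lemma bl_modulate k f : bl_mem X f ->
  bl_mem X (fun x => e_ k x * f x) /\
  bl_norm X (fun x => e_ k x * f x) <= bl_norm X f.
Proof.
move=> mf; apply: (bl_solid _ _ mf).
- apply: cmeasurableM; [exact: cmeasurable_e | exact: bl_measurable mf].
- by move=> x; rewrite e_periodic (bl_periodic mf).
- by move=> x; rewrite modulusM modulus_e mul1r.
Qed.

(** S_N cuts out a symmetric window of frequencies.  Modulating moves one end of
    such a window to the required place, while its other end stays beyond the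
    spectrum of the polynomial. *)
Lemma initial_segment_bound n c l : (l <= n.*2.+1)%N ->
  bl_norm X (fun x => \sum_(i < l) c (i%:Z - n%:Z) * e_ (i%:Z - n%:Z) x) <=
  KS * bl_norm X (trig n c).
Proof.
have T0 := bl_norm_ge0 (bl_trig n c); have mT := bl_trig n c.
case: l => [|l] ln.
  under eq_fun do rewrite big_ord0.
  by rewrite bl_norm_cst0 mulr_ge0.
(* The window of S_(n+1), shifted by p, ends at the frequency l - n and starts
   below -n, because l <= 2n. *)
pose p : int := l%:Z - n%:Z - n.+1%:Z.
have [m1 n1] := bl_modulate (- p) mT.
have [m2 n2] := HS (ltn0Sn n) m1.
have [m3 n3] := bl_modulate p m2.
suff -> : (fun x => \sum_(i < l.+1) c (i%:Z - n%:Z) * e_ (i%:Z - n%:Z) x) =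
   (fun x => e_ p x * fourier_sum n.+1 (fun x => e_ (- p) x * trig n c x) x).
  apply: le_trans n3 _; apply: le_trans n2 _.
  by rewrite ler_wpM2l.
apply/funext => x.
pose G k := (if (`|k| <= n)%N then c k else 0) * e_ k x.
transitivity (\sum_(0 <= i < n.+1.*2.+1) G (i%:Z - n.+1%:Z + p)); last first.
  rewrite fourier_sumE /trig sym_sumE mulr_sumr; apply: eq_bigr => j _.
  rewrite fourier_coef_modulate; last exact: clint_trig.
  by rewrite opprK fourier_coef_trig mulrCA -e_D /G; congr (_ * e_ _ _); ring.
rewrite (@big_cat_nat _ _ _ (n.+2.*2 - l.+2)%N) /=; [|lia|lia].
rewrite [X in _ = X + _]big1_seq ?add0r; last first.
  move=> i /andP[_]; rewrite mem_index_iota => /andP[_ iN].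
  by rewrite /G ifF ?mul0r //; rewrite /p; lia.
rewrite -{1}[(n.+2.*2 - l.+2)%N]add0n big_addn.
have -> : (n.+1.*2.+1 - (n.+2.*2 - l.+2) = l.+1)%N by lia.
rewrite big_mkord; apply: eq_bigr => i _; have := ltn_ord i => il.
have -> : (i + (n.+2.*2 - l.+2))%:Z - n.+1%:Z + p = i%:Z - n%:Z by rewrite /p; lia.
by rewrite /G ifT //; lia.
Qed.

Lemma bl_norm_sumZ (I : Type) (s : seq I) (a : I -> R[i]) (F : I -> R -> R[i]) K :
  (forall i, bl_mem X (F i)) -> (forall i, bl_norm X (F i) <= K) ->
  bl_norm X (fun x => \sum_(i <- s) a i * F i x) <=
  (\sum_(i <- s) modulus (a i)) * K.
Proof.
move=> mF nF.
apply: le_trans (bl_norm_sum s (fun i => bl_scale (a i) (mF i))) _.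
rewrite mulr_suml; apply: ler_sum => i _; rewrite bl_normZ //.
by rewrite ler_wpM2l // modulus_ge0.
Qed.

(** Summation by parts writes the multiplier as a combination of initial
    segments, which are uniformly bounded; the coefficients add up to the
    variation of w and its last value. *)
Lemma bounded_variation_multiplier n w c :
  bl_norm X (trig n (fun k => w k * c k)) <=
  (modulus (w n%:Z) + \sum_(i < n.*2) modulus (w (i.+1%:Z - n%:Z) - w (i%:Z - n%:Z)))
  * (KS * bl_norm X (trig n c)).
Proof.
pose Q l x := \sum_(i < l) c (i%:Z - n%:Z) * e_ (i%:Z - n%:Z) x.
have mQ l : bl_mem X (Q l).
  apply: bl_mem_sum => i; apply: bl_scale.
  have -> : e_ (i%:Z - n%:Z) = (fun x : R => e_ (i%:Z - n%:Z) x * 1).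
    by apply/funext => x; rewrite mulr1.
  exact: (bl_modulate _ (bl_mem1 X)).1.
have -> : trig n (fun k => w k * c k) = (fun x => w n%:Z * Q n.*2.+1 x -
   \sum_(i < n.*2) (w (i.+1%:Z - n%:Z) - w (i%:Z - n%:Z)) * Q i.+1 x).
  apply/funext => x; rewrite /trig /sym_sum.
  have := abel_sum (fun i => w (i%:Z - n%:Z))
    (fun i => c (i%:Z - n%:Z) * e_ (i%:Z - n%:Z) x) n.*2.
  have -> : n.*2%:Z - n%:Z = n%:Z by lia.
  by move=> <-; apply: eq_bigr => i _; rewrite mulrA.
rewrite mulrDl; apply: le_trans (bl_normB _ _) _.
- exact: bl_scale.
- by apply: bl_mem_sum => i; exact: bl_scale.
apply: lerD.
  rewrite bl_normZ // ler_wpM2l ?modulus_ge0 //.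
  by apply: initial_segment_bound.
have nQ (i : 'I_n.*2) : bl_norm X (Q i.+1) <= KS * bl_norm X (trig n c).
  by apply: initial_segment_bound; have := ltn_ord i; lia.
exact: bl_norm_sumZ.
Qed.

(** The symbol ik has variation 2 n on [-n, n] and final value n. *)
Lemma bernstein n c : (0 < n)%N ->
  bl_norm X (trig n (deriv_coef c)) <= 3 * KS * n%:R * bl_norm X (trig n c).
Proof.
move=> n0; apply: le_trans (bounded_variation_multiplier n _ c) _.
have E : \sum_(i < n.*2) modulus ((0 +i* (i.+1%:Z - n%:Z)%:~R) -
   (0 +i* (i%:Z - n%:Z)%:~R) : R[i]) = n.*2%:R.
  rewrite (eq_bigr (fun=> 1)); first by rewrite sumr_const card_ord.
  move=> i _.
  have -> : (0 +i* (i.+1%:Z - n%:Z)%:~R) - (0 +i* (i%:Z - n%:Z)%:~R) =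
      0 +i* 1 :> R[i].
    apply: complex_eq; rewrite ?(ReD, ImD, ReN, ImN) /= ?subr0 //.
    by rewrite -intrB; have -> : i.+1%:Z - n%:Z - (i%:Z - n%:Z) = 1 by lia.
  by rewrite modulus_imag normr1.
rewrite E modulus_imag ger0_norm // -addnn natrD -pmulrn.
by rewrite le_eqVlt; apply/orP; left; apply/eqP; ring.
Qed.

(** Integrating a function with frequencies above m gains a factor 1/m; for a
    general c only its frequencies above m are integrated. *)
Lemma bohr_favard n m c :
  bl_norm X (trig n (antideriv_coef m c)) <= 5 / m.+1%:R * KS * bl_norm X (trig n c).
Proof.
apply: le_trans (bounded_variation_multiplier n _ c) _.
rewrite mulrA; apply: ler_wpM2r; first exact/bl_norm_ge0/bl_trig.
apply: ler_wpM2r => //; exact: reciprocal_variation.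
Qed.

End Multipliers.

(** * Means of trigonometric polynomials *)

Section PointwiseDefect.
Context {R : realType}.
Implicit Types (f g : R -> R[i]) (a b h x y H M : R) (c w : int -> R[i]).
Implicit Types (n m l : nat) (k j : int).

Lemma lint_continuous (u : R -> R) : continuous u -> lint u.
Proof.
move=> cu; split; first exact: lmeas_continuous.
move=> a b; apply/integrableP; split; first exact/lmeas_EFin/lmeas_continuous.
have cab : (@lebesgue_measure R).-integrable `[a, b] (EFin \o u).
  apply: continuous_compact_integrable; first exact: segment_compact.
  exact: continuous_subspaceT.
have mau : measurable_fun [set: R] (fun x => `|(u x)%:E|%E).
  apply: measurableT_comp => //; apply/measurable_EFinP.
  exact: continuous_measurable_fun.
have /integrableP[_] := cab; congr (_ < _)%E.
exact: esym (integral_completed_borel (measurable_itv `[a, b]) mau).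
Qed.

Lemma trig_FTC n c x y : x <= y ->
  trig n c y - trig n c x = cint x y (trig n (deriv_coef c)).
Proof.
move=> xy; rewrite cint_sum; last by move=> j; apply: clintZ; exact: clint_e.
rewrite /trig /sym_sum -sumrB; apply: eq_bigr => j _.
rewrite cintZ; last exact: clint_e.
by rewrite /deriv_coef -mulrBr -cint_cis // mulrCA mulrA.
Qed.

(** The increments of a polynomial are integrals of its derivative. *)
Lemma trig_oscillation n c p q x y : p <= x <= q -> p <= y <= q ->
  modulus (trig n c x - trig n c y) <=
  2 * rint p q (fun z => modulus (trig n (deriv_coef c) z)).
Proof.
wlog xy : x y / y <= x => [W|].
  case: (leP y x) => [yx|/ltW xy] xpq ypq; first exact: W.
  by rewrite -modulusN opprB; exact: W.
move=> /andP[px xq] /andP[py yq]; rewrite trig_FTC //.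
have ct := clint_trig n (deriv_coef c).
apply: le_trans (modulus_cint _ _ ct) _; apply: ler_wpM2l => //.
apply: le_rint_itv => //; first exact: clint_modulus.
by move=> z; exact: modulus_ge0.
Qed.

Lemma modulus_cint_le a b f M : a <= b -> clint f ->
  (forall x, a <= x <= b -> modulus (f x) <= M) ->
  modulus (cint a b f) <= 2 * (M * (b - a)).
Proof.
move=> ab cf fM; apply: le_trans (modulus_cint _ _ cf) _.
rewrite ler_pM2l // -rint_cst //; apply: le_rint => //.
- exact: clint_modulus.
- exact: lint_cst.
Qed.

Lemma sub_meanE a b f x : a < b -> clint f ->
  f x - mean a b f x = ((b - a)^-1)%:C * cint (x + a) (x + b) (fun y => f x - f y).
Proof.
move=> ab cf; rewrite cintB //; last exact: clint_cst.
rewrite cint_cst; last by rewrite lerD2l ltW.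
rewrite mulrBr mulrA -rmorphM.
have -> : x + b - (x + a) = b - a by lra.
by rewrite mulVf ?subr_eq0 ?gt_eqF // rmorph1 mul1r.
Qed.

(** The defect at x is an average of f(x) - f(y), but f(x) - f(y) may be replaced
    by any g with the same integral; this is the freedom used to gain a second
    order in trig_steklov_defect. *)
Lemma modulus_sub_mean a b f g x M : a < b -> clint g ->
  f x - mean a b f x = ((b - a)^-1)%:C * cint (x + a) (x + b) g ->
  (forall y, x + a <= y <= x + b -> modulus (g y) <= M) ->
  modulus (f x - mean a b f x) <= 2 * M.
Proof.
move=> ab cg -> gM; have ba : 0 < b - a by rewrite subr_gt0.
rewrite modulusM modulus_real gtr0_norm ?invr_gt0 //.
rewrite ler_pdivrMl // mulrCA [(b - a) * M]mulrC.
have -> : b - a = (x + b) - (x + a) by lra.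
by apply: modulus_cint_le => //; rewrite lerD2l ltW.
Qed.

Lemma trig_mean_defect n c a b H x : a < b -> - (H / 2) <= a -> b <= H / 2 ->
  modulus (trig n c x - mean a b (trig n c) x) <= 4 *
    rint (x - H / 2) (x + H / 2) (fun z => modulus (trig n (deriv_coef c) z)).
Proof.
move=> ab aH bH; have ct := clint_trig n c.
have -> : 4 = 2 * 2 :> R by rewrite -natrM.
rewrite -mulrA; apply: (modulus_sub_mean ab _ (sub_meanE x ab ct)).
  by apply: clintB => //; exact: clint_cst.
move=> y /andP[y1 y2]; apply: trig_oscillation; apply/andP; split; lra.
Qed.

Lemma cint_odd h x (z : R[i]) : 0 < h ->
  cint (x - h) (x + h) (fun y => z * (y - x)%:C) = 0.
Proof.
move=> h0.
have cl : continuous (fun y : R => y - x).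
  by move=> y; apply: cvgB; [exact: cvg_id | exact: cvg_cst].
have ll := lint_continuous cl.
have cc : clint (fun y => (y - x)%:C).
  by split => //=; exact: lint_cst.
rewrite cintZ // cintE /=.
have xh : x - h <= x + h by lra.
rewrite rint_cst // mul0r.
suff -> : rint (x - h) (x + h) (fun y => y - x) = 0 by rewrite mulr0.
have dF (y : R) : is_derive y (1 : R) (fun y : R => (y - x) ^+ 2 / 2) (y - x).
  have d1 : is_derive y (1 : R) (fun y : R => y - x) 1.
    by rewrite -[X in is_derive _ _ _ X]subr0; exact: is_deriveB.
  have -> : (fun y : R => (y - x) ^+ 2 / 2) =
      (fun y => 2^-1 * ((y - x) * (y - x))).
    by apply/funext => t; rewrite mulrC expr2.
  apply: (is_derive_eq (is_deriveZ 2^-1 (is_deriveM d1 d1))); rewrite /GRing.scale /=; lra.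
by rewrite (rint_FTC xh cl dF); field.
Qed.

(** By symmetry of the interval, the linear Taylor term of f(x) - f(y) integrates
    to 0; what is left is controlled by the second derivative. *)
Lemma trig_steklov_defect n c h x : 0 < h ->
  modulus (trig n c x - steklov h (trig n c) x) <= 4 * h *
    rint (x - h / 2) (x + h / 2)
      (fun z => modulus (trig n (deriv_coef (deriv_coef c)) z)).
Proof.
move=> h0; rewrite steklovE; set J := rint _ _ _.
have ab : - (h / 2) < h / 2 by lra.
have ct := clint_trig n c; have ct' := clint_trig n (deriv_coef c).
have cl : continuous (fun y : R => y - x).
  by move=> y; apply: cvgB; [exact: cvg_id | exact: cvg_cst].
have cc : clint (fun y => (y - x)%:C).
  by split => /=; [exact: lint_continuous | exact: lint_cst].
(* The first order Taylor remainder, up to sign. *)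
pose g y := trig n c x - trig n c y + trig n (deriv_coef c) x * (y - x)%:C.
have cg : clint g.
  by apply: clintD; [apply: clintB => //; exact: clint_cst | exact: clintZ].
have -> : 4 * h * J = 2 * (2 * (2 * J * (h / 2))) by field.
apply: (@modulus_sub_mean _ _ _ g) => //.
  have c1 : clint (fun y => trig n c x - trig n c y).
    by apply: clintB; [exact: clint_cst | exact: ct].
  have := cintD (x + - (h / 2)) (x + h / 2) c1 (clintZ (trig n (deriv_coef c) x) cc).
  rewrite cint_odd; last lra.
  by rewrite addr0 => ->; rewrite (sub_meanE _ ab ct).
have osc z : x - h / 2 <= z <= x + h / 2 ->
    modulus (trig n (deriv_coef c) z - trig n (deriv_coef c) x) <= 2 * J.
  by move=> zx; apply: trig_oscillation => //; apply/andP; split; lra.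
have J0 : 0 <= J by apply: rint_ge0 => z; exact: modulus_ge0.
move=> y /andP[y1 y2].
have cd : clint (fun z => trig n (deriv_coef c) z - trig n (deriv_coef c) x).
  by apply: clintB => //; exact: clint_cst.
case: (leP x y) => xy.
  have -> : g y = - cint x y (fun z => trig n (deriv_coef c) z - trig n (deriv_coef c) x).
    rewrite cintB //; last exact: clint_cst.
    by rewrite -trig_FTC // cint_cst // /g mulrC; ring.
  rewrite modulusN; apply: le_trans (modulus_cint_le xy cd (M := 2 * J) _) _.
    by move=> z /andP[z1 z2]; apply: osc; apply/andP; split; lra.
  rewrite ler_pM2l // ler_wpM2l ?mulr_ge0 //; lra.
have -> : g y = cint y x (fun z => trig n (deriv_coef c) z - trig n (deriv_coef c) x).
  rewrite cintB //; last exact: clint_cst.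
  rewrite -trig_FTC ?ltW // cint_cst ?ltW // /g mulrC.
  by rewrite -[y - x]opprB rmorphN /=; ring.
apply: le_trans (modulus_cint_le (ltW xy) cd (M := 2 * J) _) _.
  by move=> z /andP[z1 z2]; apply: osc; apply/andP; split; lra.
rewrite ler_pM2l // ler_wpM2l ?mulr_ge0 //; lra.
Qed.

End PointwiseDefect.

Section NormDefect.
Context {R : realType} (X : banach_lattice R) (KA : R).
Hypothesis KA0 : 0 <= KA.
Hypothesis HA : averages_bounded X KA.
Implicit Types (f g : R -> R[i]) (a b h x y H M : R) (c w : int -> R[i]).
Implicit Types (n m l : nat) (k j : int).

Lemma bl_mean_defect n c a b H : a < b -> - (H / 2) <= a -> b <= H / 2 ->
  bl_norm X (fun x => trig n c x - mean a b (trig n c) x) <=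
  4 * H * KA * bl_norm X (trig n (deriv_coef c)).
Proof.
move=> ab aH bH; have H0 : 0 < H by lra.
have mT := bl_trig X n (deriv_coef c).
have md : bl_mem X (fun x => trig n c x - mean a b (trig n c) x).
  by apply: bl_memB; [exact: bl_trig | apply: (bl_mem_mean KA0 HA ab); exact: bl_trig].
apply: (bl_dominated_by_averages KA0 HA H0 _ mT (bl_measurable md) (bl_periodic md) _).2.
  by rewrite mulr_ge0 // ltW.
move=> x; have -> : forall J : R, 4 * H * (H^-1 * J) = 4 * J.
  by move=> J; field; rewrite gt_eqF.
exact: trig_mean_defect.
Qed.

Lemma bl_steklov_defect n c h : 0 < h ->
  bl_norm X (fun x => trig n c x - steklov h (trig n c) x) <=
  4 * h ^+ 2 * KA * bl_norm X (trig n (deriv_coef (deriv_coef c))).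
Proof.
move=> h0; have mT := bl_trig X n (deriv_coef (deriv_coef c)).
have md : bl_mem X (fun x => trig n c x - steklov h (trig n c) x).
  by apply: bl_memB; [exact: bl_trig | apply: (HA h0 _).1; exact: bl_trig].
apply: (bl_dominated_by_averages KA0 HA h0 _ mT (bl_measurable md) (bl_periodic md) _).2.
  by rewrite mulr_ge0 // exprn_ge0 // ltW.
move=> x; have -> : forall J : R, 4 * h ^+ 2 * (h^-1 * J) = 4 * h * J.
  by move=> J; field; rewrite gt_eqF.
exact: trig_steklov_defect.
Qed.

(** The powers of a bound that loses a derivative: multiplying by a symbol
    commutes with the operator D on coefficients, so the losses accumulate in
    D^s. *)
Lemma iter_multiplier_bound n (w : int -> R[i]) (D : (int -> R[i]) -> int -> R[i]) C s c :
  0 <= C ->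
  (forall c, bl_norm X (trig n (fun k => w k * c k)) <= C * bl_norm X (trig n (D c))) ->
  (forall c, D (fun k => w k * c k) = (fun k => w k * D c k)) ->
  bl_norm X (trig n (iter s (fun c k => w k * c k) c)) <=
  C ^+ s * bl_norm X (trig n (iter s D c)).
Proof.
move=> C0 HC comm; elim: s c => [|s IH] c; first by rewrite expr0 mul1r.
have commi (d : int -> R[i]) : D (iter s (fun c k => w k * c k) d) =
    iter s (fun c k => w k * c k) (D d).
  by elim: s {IH} => //= s IHs; rewrite comm IHs.
rewrite iterS; apply: le_trans (HC _) _.
rewrite commi iterSr exprS -mulrA ler_wpM2l //; exact: IH.
Qed.

(** On polynomials the differences I - T act on coefficients, by the symbol
    1 - mean_mult. *)
Lemma diff_pow_trig (T : (R -> R[i]) -> R -> R[i]) a b n s c :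
  (forall f, T f = mean a b f) ->
  diff_pow T s (trig n c) =
  trig n (iter s (fun c k => (1 - mean_mult a b k) * c k) c).
Proof.
move=> TE; elim: s => //= s IH; rewrite /diff_pow /= -/(diff_pow T s _) IH.
apply/funext => x; rewrite TE mean_trig /=.
rewrite [LHS](_ : _ = trig n (iter s (fun c k => (1 - mean_mult a b k) * c k) c) x -
  trig n (fun k => mean_mult a b k *
    iter s (fun c k => (1 - mean_mult a b k) * c k) c k) x) //.
by rewrite -trigB; congr (trig n _ x); apply/funext => k; ring.
Qed.

Lemma bl_fwd_diff_trig n s c h : 0 < h ->
  bl_norm X (diff_pow (steklov_fwd h) s (trig n c)) <=
  (8 * h * KA) ^+ s * bl_norm X (trig_deriv s n c).
Proof.
move=> h0; rewrite (diff_pow_trig (a := 0) (b := h)); last exact: steklov_fwdE.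
apply: iter_multiplier_bound; first by rewrite !mulr_ge0 // ltW.
  move=> d; have := @bl_mean_defect n d 0 h (2 * h) h0.
  rewrite [4 * _]mulrA -natrM => H; apply: le_trans (H _ _); [|lra|lra].
  rewrite le_eqVlt; apply/orP; left; apply/eqP; congr (bl_norm X _).
  apply/funext => x; rewrite mean_trig -trigB; congr (trig n _ x).
  by apply/funext => k; ring.
by move=> d; apply/funext => k; rewrite /deriv_coef mulrCA.
Qed.

Lemma bl_steklov_diff_trig n r c h : 0 < h ->
  bl_norm X (diff_pow (steklov h) r (trig n c)) <=
  (4 * h ^+ 2 * KA) ^+ r * bl_norm X (trig_deriv (r * 2) n c).
Proof.
move=> h0; rewrite (diff_pow_trig (a := - (h / 2)) (b := h / 2)); last exact: steklovE.
rewrite /trig_deriv; have -> : iter (r * 2) deriv_coef c = iter r (fun d => deriv_coef (deriv_coef d)) c.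
  by elim: r => //= r ->.
apply: iter_multiplier_bound.
- by rewrite mulr_ge0 // mulr_ge0 // exprn_ge0 // ltW.
- move=> d; have := @bl_steklov_defect n d h h0.
  rewrite steklovE => H; apply: le_trans H.
  rewrite le_eqVlt; apply/orP; left; apply/eqP; congr (bl_norm X _).
  apply/funext => x; rewrite mean_trig -trigB; congr (trig n _ x).
  by apply/funext => k; ring.
- by move=> d; apply/funext => k; rewrite /deriv_coef; ring.
Qed.

End NormDefect.

(** * Values at the nodes *)

Section Nodes.
Context {R : realType}.
Implicit Types (f g : R -> R[i]) (x y : R) (n k : nat).

Definition gap n : R := pi *+ 2 / n.*2.+1%:R.

Lemma gap_gt0 n : 0 < gap n.
Proof. by apply: divr_gt0; [rewrite mulrn_wgt0 ?pi_gt0 | rewrite ltr0n]. Qed.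

Lemma nodeE n k : node n k = gap n * k%:R :> R.
Proof. by rewrite /node /gap mulrAC. Qed.

Lemma nodeS n k : node n k.+1 = node n k + gap n :> R.
Proof. by rewrite !nodeE -natr1 mulrDr mulr1. Qed.

Lemma gapM n : gap n * n.*2.+1%:R = pi *+ 2.
Proof. by rewrite /gap mulfVK // pnatr_eq0. Qed.

Lemma gap_le n : (0 < n)%N -> gap n * n%:R <= pi.
Proof.
move=> n0; have := gapM n; have := gap_gt0 n.
have -> : n.*2.+1%:R = 2 * n%:R + 1 :> R by rewrite -addnn -natr1 natrD; ring.
rewrite mulr2n; move: (gap n) (n%:R : R) => d N d0.
by rewrite mulrDr mulr1 mulrCA; lra.
Qed.

(** The nodes cut the period into cells, so modulo the period each x lies in
    exactly one of them. *)
Lemma node_cell n x : exists2 k, (k < n.*2.+1)%N & exists2 m : int,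
  node n k <= x + (pi *+ 2) *~ m < node n k.+1 &
  forall j, (j < n.*2.+1)%N ->
    periodize `[node n j, node n j.+1[ x <-> j = k.
Proof.
have p2 := two_pi_gt0 R.
have d0 := gap_gt0 n.
have [m /andP[y0 y2]] : exists m : int, 0 <= x + (pi *+ 2) *~ m < pi *+ 2.
  exists (- Num.floor (x / (pi *+ 2))).
  set t := x / (pi *+ 2).
  have -> : x = t * (pi *+ 2) by rewrite /t mulfVK ?gt_eqF.
  have /andP[h1 h2] := floor_itv t.
  rewrite -[(pi *+ 2) *~ _]mulrzl mulrNz mulNr -mulrBl.
  rewrite mulr_ge0 ?subr_ge0 ?(ltW p2) //= -[X in _ < X]mul1r ltr_pM2r //.
  by rewrite ltrBlDr addrC -[X in _ < _ + X]/(1%:~R) -intrD.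
set y := x + _ in y0 y2.
have yd0 : 0 <= y / gap n by rewrite divr_ge0 // ltW.
have /andP[k1 k2] := truncn_itv yd0.
set k := Num.truncn (y / gap n) in k1 k2.
have yk1 : node n k <= y by rewrite nodeE -ler_pdivlMl // mulrC.
have yk2 : y < node n k.+1 by rewrite nodeE -ltr_pdivrMl // mulrC.
have kn : (k < n.*2.+1)%N.
  rewrite -(ltr_nat R) -(ltr_pM2l d0) gapM -nodeE; exact: le_lt_trans yk1 y2.
exists k => //; exists m; first by rewrite yk1.
move=> j jn; split; last first.
  by move=> ->; exists m; rewrite /= in_itv /= yk1.
case=> m'; rewrite /= in_itv /= => /andP[j1 j2].
have mm : m' = m.
  have z1 : 0 <= x + (pi *+ 2) *~ m'.
    by apply: le_trans j1; rewrite nodeE mulr_ge0 // ltW.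
  have z2 : x + (pi *+ 2) *~ m' < pi *+ 2.
    apply: lt_le_trans j2 _; by rewrite nodeE -(gapM n) ler_pM2l // ler_nat.
  have e1 : (m' - m)%:~R < 1 :> R.
    rewrite -(ltr_pM2l p2) mulr1 intrB mulrBr !mulrzr; rewrite /y in y0 y2; lra.
  have e2 : -1 < (m' - m)%:~R :> R.
    rewrite -(ltr_pM2l p2) mulrN1 intrB mulrBr !mulrzr; rewrite /y in y0 y2; lra.
  have e3 : m' - m < 1 by rewrite -(ltr_int R).
  have e4 : - 1 < m' - m by rewrite -(ltr_int R) mulrNz.
  by clear -e3 e4; lia.
rewrite mm -/y in j1 j2.
apply/eqP; rewrite eqn_leq -[(j <= k)%N]ltnS -[(k <= j)%N]ltnS.
apply/andP; split; rewrite -(ltr_nat R) -(ltr_pM2l d0) -!nodeE.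
  exact: le_lt_trans j1 yk2.
exact: le_lt_trans yk1 j2.
Qed.

(** The step function takes at x the value of |f| at the left end of the cell of
    x; the cell is common to all f. *)
Lemma discretizeE n x : exists2 k, (k < n.*2.+1)%N & exists2 m : int,
  node n k <= x + (pi *+ 2) *~ m < node n k.+1 &
  forall f, discretize n f x = modulus (f (node n k)).
Proof.
have [k kn [m km H]] := node_cell n x; exists k => //; exists m => // f.
rewrite /discretize (bigD1 (Ordinal kn)) //= big1 ?addr0.
  by rewrite indicE mem_set ?mulr1 //; apply/H.
move=> j jk; rewrite indicE memNset ?mulr0 // => /H - /(_ (ltn_ord j)) jE.
by move/eqP: jk; apply; apply: val_inj.
Qed.

Lemma measurable_periodize (E : set R) : measurable E -> measurable (periodize E).
Proof.
move=> mE.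
have -> : periodize E = \bigcup_n (if unpickle n is Some m then
    (fun x : R => x + (pi *+ 2) *~ m) @^-1` E else set0).
  apply/seteqP; split => x.
    by move=> [m Em]; exists (pickle m); [exact: I | rewrite pickleK].
  by move=> [n _]; case: (unpickle n) => // m Em; exists m.
apply: bigcupT_measurable => n; case: unpickle => // m.
by rewrite -[X in measurable X]setTI; apply: measurable_shift.
Qed.

Lemma periodize_periodic (E : set R) x :
  periodize E (x + pi *+ 2) <-> periodize E x.
Proof.
split => -[m Em].
  by exists (1 + m); rewrite mulrzDr mulr1z addrA.
by exists (m - 1); rewrite mulrzBr mulr1z -addrA [_ + (_ - _)]addrC subrK.
Qed.

Lemma lmeas_indic_periodize (a b : R) : lmeas (\1_(periodize `[a, b[)).
Proof.
apply: lmeas_borel; apply: measurable_indic.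
by apply: measurable_periodize; exact: measurable_itv.
Qed.

Lemma indic_periodize_periodic (E : set R) x :
  \1_(periodize E) (x + pi *+ 2) = \1_(periodize E) x :> R.
Proof.
have xE : (x + pi *+ 2 \in periodize E) = (x \in periodize E).
  by apply/idP/idP => /set_mem H; apply/mem_set/periodize_periodic.
by rewrite !indicE xE.
Qed.

Lemma cmeasurable_discretize n f : cmeasurable (of_real (discretize n f)).
Proof.
apply: cmeasurable_real.
suff H (s : seq 'I_n.*2.+1) : lmeas (fun x => \sum_(k <- s) modulus (f (node n k)) *
    \1_(periodize `[node n k, node n k.+1[) x) by exact: H.
elim: s => [|k s IH].
  by under eq_fun do rewrite big_nil; exact: lmeas_cst.
under eq_fun do rewrite big_cons; apply: lmeasD => //.
apply: lmeasM; [exact: lmeas_cst | exact: lmeas_indic_periodize].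
Qed.

Lemma discretize_periodic n f : periodic (of_real (discretize n f)) (pi *+ 2).
Proof.
move=> x; rewrite /of_real; congr (_ %:C); apply: eq_bigr => k _.
by rewrite indic_periodize_periodic.
Qed.

End Nodes.

Section DiscreteNorm.
Context {R : realType} (X : banach_lattice R) (KA KS : R).
Hypothesis KA0 : 0 <= KA.
Hypothesis HA : averages_bounded X KA.
Hypothesis KS0 : 0 <= KS.
Hypothesis HS : partial_sums_bounded X KS.
Implicit Types (f g : R -> R[i]) (a b h x y H M C : R) (c w : int -> R[i]).
Implicit Types (n m l k : nat).

Lemma discretize_ge0 n f x : 0 <= discretize n f x.
Proof. by have [k _ [m _ ->]] := discretizeE n x; exact: modulus_ge0. Qed.

Lemma bl_mem_discretize n f : bl_mem X (of_real (discretize n f)).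
Proof.
apply: (bl_bounded X (cmeasurable_discretize n f) (discretize_periodic n f)
  (K := \sum_(k < n.*2.+1) modulus (f (node n k))) _).1.
move=> x; rewrite modulus_real ger0_norm ?discretize_ge0 //.
by apply: ler_sum => k _; rewrite ler_piMr ?modulus_ge0.
Qed.

Lemma discrete_norm_ge0 n f : 0 <= discrete_norm X n f.
Proof. exact/bl_norm_ge0/bl_mem_discretize. Qed.

Lemma discrete_norm_le n f g :
  (forall k, modulus (f (node n k)) <= modulus (g (node n k))) ->
  discrete_norm X n f <= discrete_norm X n g.
Proof.
move=> fg; apply: (bl_le (cmeasurable_discretize n f) (discretize_periodic n f)
  (bl_mem_discretize n g) _).2 => x.
rewrite modulus_real ger0_norm ?discretize_ge0 //.
by have [k _ [m _ E]] := discretizeE n x; rewrite !E.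
Qed.

Lemma discrete_normD n f g :
  discrete_norm X n (fun x => f x + g x) <= discrete_norm X n f + discrete_norm X n g.
Proof.
apply: le_trans (bl_normD (bl_mem_discretize n f) (bl_mem_discretize n g)).
apply: (bl_solid (cmeasurable_discretize n _) (discretize_periodic n _)
  (bl_add (bl_mem_discretize n f) (bl_mem_discretize n g)) _).2 => x.
have -> : (of_real (discretize n f) + of_real (discretize n g)) x =
    (discretize n f x + discretize n g x)%:C by rewrite rmorphD.
rewrite !modulus_real !ger0_norm ?addr_ge0 ?discretize_ge0 //.
by have [k _ [m _ E]] := discretizeE n x; rewrite !E; exact: modulusD.
Qed.

Lemma discrete_normB n f g :
  discrete_norm X n (fun x => f x - g x) <= discrete_norm X n f + discrete_norm X n g.
Proof.
apply: le_trans (discrete_normD _ _ _) _; rewrite lerD2l.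
by apply: discrete_norm_le => k; rewrite modulusN.
Qed.

Lemma discrete_norm0 n f : (forall k, (k < n.*2.+1)%N -> f (node n k) = 0) ->
  discrete_norm X n f = 0.
Proof.
move=> f0; rewrite /discrete_norm -(bl_norm_cst0 X); congr (bl_norm X _).
apply/funext => x; rewrite /of_real; have [k kn [m _ ->]] := discretizeE n x.
by rewrite f0 // modulus0.
Qed.

Lemma rint_periodic_shift (u : R -> R) x H (m : int) : lmeas u ->
  periodic u (pi *+ 2) ->
  rint (x + (pi *+ 2) *~ m - H) (x + (pi *+ 2) *~ m + H) u = rint (x - H) (x + H) u.
Proof.
move=> mu pu.
have pZ (j : int) y : u (y + (pi *+ 2) *~ j) = u y.
  have Hn (p : nat) z : u (z + (pi *+ 2) *+ p) = u z by exact: (periodicn pu).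
  case: j => p; first exact: Hn.
  by rewrite NegzE mulrNz -[LHS](Hn p.+1) -pmulrn subrK.
rewrite [_ - H]addrAC [_ + H]addrAC -rint_shift //.
by apply: eq_rint => y _; rewrite pZ.
Qed.

(** The counterpart of bl_dominated_by_averages: averages around every point of a
    cell must dominate the value at its left node. *)
Lemma discrete_norm_dominated n C H f g : 0 < H -> 0 <= C -> bl_mem X g ->
  (forall k x, node n k <= x <= node n k + gap n ->
     modulus (f (node n k)) <=
     C * (H^-1 * rint (x - H / 2) (x + H / 2) (fun y => modulus (g y)))) ->
  discrete_norm X n f <= C * KA * bl_norm X g.
Proof.
move=> H0 C0 mg fC.
apply: (bl_dominated_by_averages KA0 HA H0 C0 mg (cmeasurable_discretize n f) (discretize_periodic n f) _).2.
move=> x; rewrite modulus_real ger0_norm ?discretize_ge0 //.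
have [k _ [m /andP[km mk] ->]] := discretizeE n x.
rewrite -(rint_periodic_shift x (H / 2) m (lmeas_modulus (bl_measurable mg))).
  by apply: fC; rewrite km -nodeS ltW.
by move=> y; rewrite (bl_periodic mg).
Qed.

(** Node values of a mean over an interval no longer than the mesh are dominated
    by averages at the scale of the mesh, whatever the point of the cell. *)
Lemma discrete_mean n a b f : a < b -> - (gap n) <= a -> b <= gap n -> bl_mem X f ->
  discrete_norm X n (mean a b f) <= 8 * gap n / (b - a) * KA * bl_norm X f.
Proof.
move=> ab ad db mf; have d0 := @gap_gt0 R n; have ba : 0 < b - a by rewrite subr_gt0.
have cf := bl_clint mf; have im := clint_modulus cf.
apply: (@discrete_norm_dominated n _ (4 * gap n)).
- lra.
- by apply: divr_ge0; lra.
- exact: mf.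
move=> k x /andP[kx xk]; apply: le_trans (modulus_mean _ ab cf) _.
have -> : forall J : R, 8 * gap n / (b - a) * ((4 * gap n)^-1 * J) = 2 / (b - a) * J.
  by move=> J; field; rewrite (gt_eqF d0) (gt_eqF ba).
apply: ler_wpM2l; first by apply: divr_ge0; lra.
apply: le_rint_itv => //; try lra.
by move=> y; exact: modulus_ge0.
Qed.

(** The value at a node is the mean over the next cell up to the integral of the
    derivative.  Means are controlled by the norm, and Bernstein's inequality
    pays for the derivative because the mesh is of the order of 1/n. *)
Lemma marcinkiewicz_zygmund n c : (0 < n)%N ->
  discrete_norm X n (trig n c) <= (8 * KA + 48 * pi * KA * KS) * bl_norm X (trig n c).
Proof.
move=> n0; have d0 := @gap_gt0 R n; have mT := bl_trig X n c.
have N0 := bl_norm_ge0 mT.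
pose M := mean 0 (gap n) (trig n c).
have -> : trig n c = (fun x => M x + (trig n c x - M x)).
  by apply/funext => x; rewrite addrC subrK.
apply: le_trans (discrete_normD _ _ _) _.
have -> : (fun x => M x + (trig n c x - M x)) = trig n c.
  by apply/funext => x; rewrite addrC subrK.
rewrite mulrDl; apply: lerD.
  apply: le_trans (discrete_mean _ _ _ _) _ => //; first by lra.
  by rewrite subr0 mulfK ?gt_eqF.
apply: (@le_trans _ _ (16 * gap n * KA * bl_norm X (trig n (deriv_coef c)))).
  apply: (@discrete_norm_dominated n _ (4 * gap n)).
  - lra.
  - lra.
  - exact: bl_trig.
  move=> k x /andP[kx xk].
  have -> : forall J : R, 16 * gap n * ((4 * gap n)^-1 * J) = 4 * J.
    by move=> J; field; rewrite gt_eqF.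
  apply: le_trans (trig_mean_defect n c (H := 2 * gap n) _ d0 _ _) _; [lra|lra|].
  apply: ler_wpM2l => //; apply: le_rint_itv; try lra.
  - exact/clint_modulus/clint_trig.
  - by move=> y; exact: modulus_ge0.
have B := bernstein KS0 HS c n0.
apply: le_trans (ler_wpM2l _ B) _; first by rewrite mulr_ge0 // mulr_ge0 // ltW.
rewrite [X in X <= _](_ : _ = 48 * (gap n * n%:R) * (KA * KS * bl_norm X (trig n c))).
  rewrite [X in _ <= X](_ : _ = 48 * pi * (KA * KS * bl_norm X (trig n c))); last by ring.
  apply: ler_wpM2r; first by rewrite mulr_ge0 // mulr_ge0.
  by apply: ler_wpM2l => //; exact: gap_le.
by ring.
Qed.

End DiscreteNorm.

(** * Boundedness of interpolation *)

Section Interpolation.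
Context {R : realType}.
Implicit Types (f g : R -> R[i]) (x y a b t : R) (n : nat) (c : int -> R[i]).

Lemma cis_neq1 t : 0 < `|t| -> `|t| < pi *+ 2 -> cis t != 1 :> R[i].
Proof.
move=> t0 t2; apply/eqP => /(congr1 (@complex.Re R)) /= cos1.
have : cos (`|t| / 2 *+ 2) = 1 :> R.
  by rewrite -mulr_natr mulfVK ?pnatr_eq0 // cos_norm.
rewrite cos_mulr2n cos2sin2 => c1.
have : 0 < sin (`|t| / 2) :> R.
  by apply: sin_gt0_pi; rewrite mulr2n in t2; apply/andP; split; lra.
move=> s0; have := exprn_gt0 2 s0; rewrite mulr2n in c1; lra.
Qed.

Lemma e_node n (d : int) j : e_ d (node n j) = e_ d (gap n) ^+ j :> R[i].
Proof.
rewrite /e_ -cisMn nodeE; congr cis.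
by rewrite mulrA mulr_natr.
Qed.

(** A geometric sum over the roots of unity of order 2n+1. *)
Lemma discrete_orthogonality n (d : int) : (`|d| <= n.*2)%N ->
  \sum_(j < n.*2.+1) e_ d (node n j) = if d == 0 then n.*2.+1%:R else 0 :> R[i].
Proof.
move=> dn; have [->|d0] := eqVneq d 0.
  rewrite (eq_bigr (fun=> 1)) ?sumr_const ?card_ord // => j _; exact: e_0.
under eq_bigr do rewrite e_node.
(* w^(2n+1) = 1 while w is not 1, so the geometric sum of its powers vanishes. *)
set w := e_ d (gap n).
have w1 : w != 1.
  have p2 := two_pi_gt0 R.
  apply: cis_neq1; rewrite normrM (gtr0_norm (gap_gt0 n)).
    by rewrite mulr_gt0 ?gap_gt0 // normr_gt0 intr_eq0.
  rewrite -(gapM n) mulrC ltr_pM2l ?gap_gt0 //.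
  rewrite -intr_norm -abszE -pmulrn ltr_nat; lia.
apply/eqP; have := subrX1 w n.*2.+1.
have -> : w ^+ n.*2.+1 = 1.
  rewrite -e_node nodeE gapM; exact: cis_2pi_int.
rewrite subrr => /esym/eqP; rewrite mulf_eq0 subr_eq0 (negbTE w1) /=.
by [].
Qed.

Definition dft n f (k : int) : R[i] :=
  (n.*2.+1%:R)^-1 * \sum_(j < n.*2.+1) f (node n j) * e_ (- k) (node n j).

Lemma e_N (k : int) x : e_ (- k) x = e_ k (- x) :> R[i].
Proof. by rewrite /e_ mulrNz mulNr mulrN. Qed.

Lemma e_Dx (k : int) x y : e_ k (x + y) = e_ k x * e_ k y :> R[i].
Proof. by rewrite /e_ mulrDr cisD. Qed.

Lemma interpolateE n f : interpolate n f = trig n (dft n f).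
Proof.
apply/funext => x; rewrite /interpolate /trig /dirichlet /dft.
transitivity ((n.*2.+1%:R)^-1 * sym_sum n (fun k =>
   (\sum_(j < n.*2.+1) f (node n j) * e_ (- k) (node n j)) * e_ k x)); last first.
  by rewrite -sym_sumZ; apply: eq_sym_sum => k _; rewrite mulrA.
congr (_ * _); rewrite /sym_sum.
under [RHS]eq_bigr do rewrite mulr_suml.
rewrite exchange_big; apply: eq_bigr => j _.
rewrite mulr_sumr; apply: eq_bigr => l _.
by rewrite -[RHS]mulrA e_N -e_Dx [- _ + x]addrC.
Qed.

(** The Dirichlet kernel vanishes at all nodes but 0, by discrete orthogonality. *)
Lemma interpolate_node n f j : (j < n.*2.+1)%N ->
  interpolate n f (node n j) = f (node n j).
Proof.
move=> jn; rewrite /interpolate (bigD1 (Ordinal jn)) //= big1.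
  rewrite addr0 subrr /dirichlet (eq_sym_sum (b := fun=> 1)).
    rewrite /sym_sum sumr_const card_ord mulrCA mulVf ?mulr1 //.
  by move=> k _; rewrite mulr0 cis0.
move=> k kj; rewrite (_ : dirichlet _ _ = 0) ?mulr0 //.
have kj' : (k : nat) != j by apply: contraNneq kj => kj; apply/eqP/val_inj.
have kn := ltn_ord k.
transitivity (e_ (- n%:Z) (node n j - node n k) *
   \sum_(i < n.*2.+1) e_ (j%:Z - k%:Z) (node n i) : R[i]).
  rewrite mulr_sumr; apply: eq_bigr => i _.
  transitivity (e_ (- n%:Z + i%:Z) (node n j - node n k) : R[i]).
    by rewrite /e_ [- _ + _]addrC.
  rewrite [LHS]e_D; congr (_ * _).
  rewrite /e_ !nodeE; congr cis; rewrite intrB -!pmulrn; ring.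
rewrite discrete_orthogonality; last by lia.
by rewrite ifF ?mulr0 //; lia.
Qed.

Lemma interpolate_trig n c : interpolate n (trig n c) = trig n c.
Proof.
rewrite interpolateE; apply: eq_trig => k kn; rewrite /dft.
under eq_bigr do rewrite mulr_suml.
rewrite exchange_big /=.
under eq_bigr => l _.
  under eq_bigr => j _ do rewrite -mulrA -e_D.
  rewrite -mulr_sumr discrete_orthogonality; last by have := ltn_ord l; lia.
  rewrite (_ : (l%:Z - n%:Z - k == 0) = (l%:Z - n%:Z == k)); last by rewrite subr_eq0.
  over.
have := sym_sum_delta n k (c k * n.*2.+1%:R); rewrite kn /sym_sum => E.
rewrite (eq_bigr (fun l : 'I_n.*2.+1 => if l%:Z - n%:Z == k then c k * n.*2.+1%:R else 0)).
  by rewrite E mulrCA mulVf ?mulr1 // pnatr_eq0.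
by move=> l _; case: eqP => [->|_]; rewrite ?mulr0.
Qed.

End Interpolation.

Section BumpTrain.
Context {R : realType}.
Implicit Types (f g : R -> R[i]) (x y a b t : R) (n : nat) (c : int -> R[i]).

Lemma cint_eq_off_point a b p f g : clint f -> clint g ->
  (forall x, a <= x <= b -> x != p -> f x = g x) -> cint a b f = cint a b g.
Proof.
move=> cf cg fg.
have H (u v : R -> R) : lint u -> lint v ->
    (forall x, a <= x <= b -> x != p -> u x = v x) -> rint a b u = rint a b v.
  move=> iu iv uv; pose h x := if x == p then v x else u x.
  have p0 : lebesgue_measure [set p] = 0%E by rewrite lebesgue_measure_set1.
  rewrite (@rint_ae R a b u h [set p] (measurable_set1 p) p0) //.
  - by apply: eq_rint => x xab; rewrite /h; case: eqVneq => // xp; exact: uv.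
  - by move=> x /= /eqP xp; rewrite /h (negbTE xp).
  - exact: lint_meas.
case: cf cg => f1 f2 [g1 g2].
rewrite !cintE; congr (_ +i* _); apply: H => // x xab xp; by rewrite fg.
Qed.

Definition bump t eta : R -> R := \1_(periodize `[t, t + eta[).

Lemma cmeasurable_bump t eta : cmeasurable (of_real (bump t eta)).
Proof. by apply: cmeasurable_real; exact: lmeas_indic_periodize. Qed.

Lemma bump_periodic t eta : periodic (of_real (bump t eta)) (pi *+ 2).
Proof. by move=> x; rewrite /of_real /bump indic_periodize_periodic. Qed.

Lemma bump_le1 t eta x : modulus (of_real (bump t eta) x) <= 1.
Proof.
by rewrite modulus_real /bump indicE; case: (_ \in _); rewrite ?normr1 ?normr0.
Qed.

Lemma clint_bump t eta : clint (of_real (bump t eta)).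
Proof.
by apply: (@clint_bounded _ _ 1); [exact: cmeasurable_bump | exact: bump_le1].
Qed.

Lemma bumpE t eta x : 0 < eta -> eta <= pi *+ 2 -> t <= x < t + pi *+ 2 ->
  bump t eta x = if x < t + eta then 1 else 0.
Proof.
move=> e0 e2 /andP[tx xt]; rewrite /bump indicE; case: ltP => xe.
  by rewrite mem_set //; exists 0; rewrite mulr0z addr0 /= in_itv /= tx.
rewrite memNset // => -[m]; rewrite /= in_itv /= => /andP[m1 m2].
have p2 := two_pi_gt0 R.
have h1 : m%:~R < (0 : R).
  by rewrite -(ltr_pM2l p2) mulr0 mulrzr; lra.
have h2 : -1 < (m%:~R : R).
  by rewrite -(ltr_pM2l p2) mulrN1 mulrzr; lra.
have h3 : m < 0 by rewrite -(ltr_int R).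
have h4 : - 1 < m by rewrite -(ltr_int R) mulrNz.
by clear -h3 h4; lia.
Qed.

Lemma fourier_coef_bump t eta k : 0 < eta -> eta <= pi *+ 2 ->
  fourier_coef (of_real (bump t eta)) k =
  ((pi *+ 2)^-1)%:C * cint t (t + eta) (@e_ R (- k)).
Proof.
move=> e0 e2; have cb := clint_bump t eta; have ceb := clint_eM (- k) cb.
rewrite fourier_coefE //; congr (_ * _).
rewrite (cint_period _ t ceb); last by move=> x; rewrite e_periodic bump_periodic.
rewrite (@cint_cat _ t (t + eta)) ?lerD2l ?lerDl ?(ltW e0) //.
have c0 := @clint_cst R 0.
rewrite [X in _ + X](@cint_eq_off_point _ _ (t + pi *+ 2) _ (fun=> 0) ceb c0); last first.
  move=> x /andP[x1 x2] xp; rewrite /of_real bumpE //.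
    by rewrite ltNge x1 mulr0.
  by rewrite lt_neqAle xp x2; lra.
rewrite cint0 addr0; apply: (@cint_eq_off_point _ _ (t + eta) _ _ ceb (clint_e _)).
move=> x /andP[x1 x2] xp; have xe : x < t + eta by rewrite lt_neqAle xp.
by rewrite /of_real bumpE // ?xe ?mulr1 // x1 /=; lra.
Qed.

Lemma cint_e_shift k t eta :
  cint t (t + eta) (@e_ R k) = e_ k t * cint 0 eta (e_ k).
Proof.
rewrite -{1}[t]add0r [t + eta]addrC -cint_shift; last exact: cmeasurable_e.
rewrite -cintZ; last exact: clint_e.
by apply: eq_cint => x _; rewrite e_Dx mulrC.
Qed.

Lemma cint_e_reflect (k : int) eta : 0 <= eta ->
  cint 0 eta (@e_ R (- k)) = cint (- eta) 0 (e_ k).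
Proof.
move=> e0; have [->|k0] := eqVneq k 0.
  rewrite oppr0 (eq_cint (g := fun=> 1)); last by move=> x _; exact: e_0.
  rewrite [RHS](eq_cint (g := fun=> 1)); last by move=> x _; exact: e_0.
  by rewrite !cint_cst ?oppr_le0 // subr0 sub0r opprK.
have en : - eta <= 0 by rewrite oppr_le0.
have E1 := cint_cis (- k)%:~R e0; have E2 := cint_cis k%:~R en.
have kn : (0 +i* k%:~R : R[i]) != 0.
  by apply/eqP => -[] /eqP; rewrite intr_eq0 (negbTE k0).
apply: (mulfI kn); rewrite /e_ E2.
have -> : 0 +i* k%:~R = - (0 +i* (- k)%:~R) :> R[i].
  by apply: complex_eq; rewrite ?ReN ?ImN /= ?oppr0 // mulrNz opprK.
by rewrite mulNr E1 mulrNz mulNr mulrN !mulr0 opprB.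
Qed.

(** Node values concentrated on intervals of length gap/N.  The weight N makes
    the averages of the train over one mesh comparable to the node values. *)
Definition bump_train n (N : nat) f x : R[i] :=
  \sum_(j < n.*2.+1) (N%:R * f (node n j)) *
    of_real (bump (node n j) (gap n / N%:R)) x.

Lemma gap_div_le n N : (0 < N)%N -> 0 < gap n / N%:R :> R /\
  gap n / N%:R <= gap n :> R /\ gap n / N%:R <= pi *+ 2 :> R.
Proof.
move=> N0; have d0 := @gap_gt0 R n; have N1 : 1 <= N%:R :> R by rewrite ler1n.
have H : gap n / N%:R <= gap n :> R.
  by rewrite ler_pdivrMr ?ltr0n // ler_peMr // ltW.
split; first by rewrite divr_gt0 // ltr0n.
split => //; apply: le_trans H _; rewrite -(gapM n).
by rewrite ler_peMr ?ler1n // ltW.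
Qed.

(** The coefficients of a train are discrete Fourier coefficients times the
    symbol of a mean; the bumps lie to the right of the nodes, so reflection
    makes it a backward mean. *)
Lemma fourier_sum_bump_train n N f : (0 < N)%N ->
  fourier_sum n (bump_train n N f) = mean (- (gap n / N%:R)) 0 (interpolate n f).
Proof.
move=> N0; have [e0 [_ e2]] := gap_div_le n N0; set eta := gap n / N%:R in e0 e2 *.
rewrite fourier_sumE interpolateE mean_trig; congr trig; apply/funext => k.
rewrite fourier_coef_sum; last by move=> j; apply: clintZ; exact: clint_bump.
rewrite /dft mulrCA mulrA !mulr_sumr; apply: eq_bigr => j _.
rewrite fourier_coefZ; last exact: clint_bump.
rewrite fourier_coef_bump // cint_e_shift cint_e_reflect ?ltW //.
rewrite /mean_mult sub0r opprK.
have -> : (eta^-1)%:C = N%:R * n.*2.+1%:R * ((pi *+ 2)^-1)%:C :> R[i].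
  have -> : eta^-1 = N%:R * n.*2.+1%:R * (pi *+ 2)^-1.
    have p2 : (pi *+ 2 : R) != 0 by rewrite gt_eqF // mulrn_wgt0 // pi_gt0.
    have N1 : (N%:R : R) != 0 by rewrite pnatr_eq0 -lt0n.
    have M1 : (n.*2.+1%:R : R) != 0 by rewrite pnatr_eq0.
    rewrite /eta /gap; move: (pi *+ 2) (N%:R : R) (n.*2.+1%:R : R) p2 N1 M1.
    by move=> P Q M p2 N1 M1; field; rewrite p2 N1 M1.
  by rewrite !rmorphM /= !rmorph_nat.
have M0 : n.*2.+1%:R != 0 :> R[i] by rewrite pnatr_eq0.
move: (((pi *+ 2)^-1)%:C : R[i]) (n.*2.+1%:R : R[i]) M0 => P M M0; by field.
Qed.

End BumpTrain.

Section InterpolationBound.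
Context {R : realType} (X : banach_lattice R) (KA KS : R).
Hypothesis KA0 : 0 <= KA.
Hypothesis HA : averages_bounded X KA.
Hypothesis KS0 : 0 <= KS.
Hypothesis HS : partial_sums_bounded X KS.

Lemma bl_bump_train n N f : (0 < N)%N -> bl_mem X (bump_train n N f) /\
  bl_norm X (bump_train n N f) <= N%:R * discrete_norm X n f.
Proof.
move=> N0; have [e0 [ed _]] := @gap_div_le R n N N0.
have nN := bl_normZ N%:R (bl_mem_discretize X n f).
have mN := bl_scale N%:R (bl_mem_discretize X n f).
have modN : modulus (N%:R : R[i]) = N%:R.
  by rewrite -(rmorph_nat (real_complex R)) modulus_real normr_nat.
rewrite modN in nN; rewrite /discrete_norm -nN.
apply: (bl_solid _ _ mN).
- apply: cmeasurable_sum => j; apply: cmeasurableM; first exact: cmeasurable_cst.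
  exact: cmeasurable_bump.
- by move=> x; apply: eq_bigr => j _; rewrite bump_periodic.
- move=> x; apply: le_trans (modulus_sum _ _ _) _.
  rewrite modulusM modN modulus_real ger0_norm ?discretize_ge0 // /discretize mulr_sumr.
  apply: ler_sum => j _; rewrite !modulusM modN -mulrA ler_wpM2l ?ler0n //.
  rewrite ler_wpM2l ?modulus_ge0 // modulus_real ger0_norm; last first.
    by rewrite /bump indicE ler0n.
  rewrite /bump !indicE ler_nat.
  have [/set_mem[m]|_] := boolP (x \in periodize `[node n j, node n j + _[) => //.
  rewrite /= in_itv /= => /andP[m1 m2]; rewrite mem_set //; exists m.
  rewrite /= in_itv /= m1 nodeS; apply: lt_le_trans m2 _.
  by rewrite lerD2l.
Qed.

(** A bump train has norm at most N times the discrete norm of f, hence so has, up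
    to the constant of S_n, the mean of L_n f over a length gap/N.  By Bernstein's
    inequality L_n f differs from this mean by O(1/N) of its own norm, so that a
    large N, independent of n, allows absorbing the difference. *)
Lemma interpolate_bound : exists2 KL, 0 <= KL & forall n f, (0 < n)%N ->
  bl_norm X (interpolate n f) <= KL * discrete_norm X n f.
Proof.
have A0 : 0 <= 48 * pi * KA * KS by rewrite !mulr_ge0 // pi_ge0.
(* 48 pi KA KS = 2 * (8 KA) * (3 KS) * pi: a mean over a length eta costs 8 KA eta
   times the derivative, Bernstein's inequality 3 KS n, and n times the mesh is at
   most pi; the factor 2 is for absorbing half of the norm. *)
pose N := (Num.bound (48 * pi * KA * KS)).+1.
have N0 : (0 < N)%N by [].
have NA : 48 * pi * KA * KS <= N%:R.
  apply: le_trans (ltW (archi_boundP A0)) _; rewrite ler_nat; exact: leqnSn.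
exists (2 * KS * N%:R); first by rewrite !mulr_ge0.
move=> n f n0; have [e0 [ed _]] := @gap_div_le R n N N0.
have [mF nF] := bl_bump_train n f N0.
have [mS nS] := HS n0 mF.
rewrite fourier_sum_bump_train // in nS mS.
have := @bl_mean_defect R X KA KA0 HA n (dft n f) (- (gap n / N%:R)) 0
  (2 * (gap n / N%:R)).
rewrite -interpolateE => D.
have B := bernstein KS0 HS (dft n f) n0.
rewrite -interpolateE in B.
have mT : bl_mem X (interpolate n f) by rewrite interpolateE; exact: bl_trig.
have T0 := bl_norm_ge0 mT.
have tri : bl_norm X (interpolate n f) <=
   bl_norm X (fun x => interpolate n f x - mean (- (gap n / N%:R)) 0 (interpolate n f) x) +
   bl_norm X (mean (- (gap n / N%:R)) 0 (interpolate n f)).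
  have -> : bl_norm X (interpolate n f) = bl_norm X (fun x =>
    (interpolate n f x - mean (- (gap n / N%:R)) 0 (interpolate n f) x) +
    mean (- (gap n / N%:R)) 0 (interpolate n f) x).
    by congr (bl_norm X _); apply/funext => x; rewrite subrK.
  by apply: bl_normD' => //; exact: bl_memB.
have half : 4 * (2 * (gap n / N%:R)) * KA * bl_norm X (trig n (deriv_coef (dft n f))) <=
    2^-1 * bl_norm X (interpolate n f).
  apply: le_trans (ler_wpM2l _ B) _.
    by rewrite mulr_ge0 // mulr_ge0 // mulr_ge0 // ltW.
  rewrite [leLHS]mulrA; apply: ler_wpM2r => //.
  have N1 : 0 < N%:R :> R by rewrite ltr0n.
  have aux (g M k a t : R) : 0 < M ->
      4 * (2 * (g / M)) * a * (3 * t * k) = (g * k) * (24 * a * t) / M.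
    by move=> M0; field; rewrite gt_eqF.
  rewrite (aux _ _ _ _ _ N1).
  rewrite ler_pdivrMr //; apply: (@le_trans _ _ (pi * (24 * KA * KS))).
    by apply: ler_wpM2r; [rewrite !mulr_ge0 | exact: gap_le].
  lra.
have {}D : bl_norm X (fun x => interpolate n f x -
    mean (- (gap n / N%:R)) 0 (interpolate n f) x) <= 2^-1 * bl_norm X (interpolate n f).
  by apply: le_trans half; apply: D; lra.
have : bl_norm X (mean (- (gap n / N%:R)) 0 (interpolate n f)) <=
   KS * (N%:R * discrete_norm X n f).
  by apply: le_trans nS _; rewrite ler_wpM2l.
by rewrite !mulrA; lra.
Qed.

End InterpolationBound.

(** * Small Fourier coefficients *)

Section RiemannLebesgue.
Context {R : realType}.
Implicit Types (f g v w : R -> R[i]) (x y a b t K L : R) (n m N : nat) (k : int).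

Definition energy g : R := rint (- pi) (- pi + pi *+ 2) (fun x => modulus (g x) ^+ 2).

Lemma energy_ge0 g : 0 <= energy g.
Proof. by apply: rint_ge0 => x; exact: sqr_ge0. Qed.

Lemma sqr_modulus (z : R[i]) :
  modulus z ^+ 2 = complex.Re z ^+ 2 + complex.Im z ^+ 2.
Proof. by case: z => a b; rewrite /modulus /= sqr_sqrtr // addr_ge0 ?sqr_ge0. Qed.

Lemma lint_sqr_modulus g K : cmeasurable g -> (forall x, modulus (g x) <= K) ->
  lint (fun x => modulus (g x) ^+ 2).
Proof.
move=> mg gK; apply: (@lint_bounded _ _ (K ^+ 2)).
  under eq_fun do rewrite expr2.
  by apply: lmeasM; exact: lmeas_modulus.
move=> x; rewrite ger0_norm ?sqr_ge0 //.
by rewrite ler_sqr ?nnegrE ?modulus_ge0 // (le_trans (modulus_ge0 (g x))).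
Qed.

(** Subtracting one Fourier mode is an orthogonal projection. *)
Lemma energy_sub_mode g k K : cmeasurable g -> (forall x, modulus (g x) <= K) ->
  energy (fun x => g x - fourier_coef g k * e_ k x) =
  energy g - pi *+ 2 * modulus (fourier_coef g k) ^+ 2.
Proof.
move=> mg gK; have cg := clint_bounded mg gK.
have p2 := two_pi_gt0 R.
set z := fourier_coef g k.
have E x : modulus (g x - z * e_ k x) ^+ 2 = modulus (g x) ^+ 2 -
   2 * complex.Re (conjc z * (e_ (- k) x * g x)) + modulus z ^+ 2.
  rewrite !sqr_modulus /e_ mulrNz mulNr /cis cosN sinN.
  have := cos2Dsin2 (k%:~R * x); move: (cos _) (sin _) => C S CS.
  clearbody z; case: (g x) => a b; case: z => p q /=.
  have -> : p ^+ 2 + q ^+ 2 = (p ^+ 2 + q ^+ 2) * (C ^+ 2 + S ^+ 2).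
    by rewrite CS mulr1.
  ring.
have c1 : clint (fun x => conjc z * (e_ (- k) x * g x)).
  by apply: clintZ; exact: clint_eM.
have l1 := lint_sqr_modulus mg gK.
have l2 : lint (fun x => 2 * complex.Re (conjc z * (e_ (- k) x * g x))).
  by apply: lintZ; case: c1.
rewrite /energy; under eq_rint do rewrite E.
rewrite rintD; [|exact: lintB|exact: lint_cst].
rewrite rintB // rintZ; last by case: c1.
rewrite rint_cst; last by rewrite lerDl ltW.
have -> : rint (- pi) (- pi + pi *+ 2)
    (fun x => complex.Re (conjc z * (e_ (- k) x * g x))) = pi *+ 2 * modulus z ^+ 2.
  transitivity (complex.Re (conjc z *
      cint (- pi) (- pi + pi *+ 2) (fun x => e_ (- k) x * g x))).
    by rewrite -cintZ //; exact: clint_eM.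
  have -> : cint (- pi) (- pi + pi *+ 2) (fun x => e_ (- k) x * g x) =
      (pi *+ 2)%:C * z.
    rewrite /z fourier_coefE // mulrA -rmorphM mulfV ?gt_eqF //.
    by rewrite rmorph1 mul1r.
  by rewrite sqr_modulus; clearbody z; case: z {E c1 l2} => p q /=; ring.
rewrite [- pi + pi *+ 2 - - pi]addrC opprK addNKr.
ring.
Qed.

(** Removing the modes one at a time keeps the energy nonnegative. *)
Lemma bessel g K (s : seq int) : uniq s -> cmeasurable g ->
  (forall x, modulus (g x) <= K) ->
  pi *+ 2 * (\sum_(k <- s) modulus (fourier_coef g k) ^+ 2) <= energy g.
Proof.
elim: s g K => [|k s IH] g K /=; first by rewrite big_nil mulr0 energy_ge0.
move=> /andP[ks us] mg gK; have cg := clint_bounded mg gK.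
pose g' x := g x - fourier_coef g k * e_ k x.
have mg' : cmeasurable g'.
  by apply: clint_meas; apply: clintB => //; apply: clintZ; exact: clint_e.
have gK' x : modulus (g' x) <= K + modulus (fourier_coef g k).
  apply: le_trans (modulusB _ _) _; rewrite modulusM modulus_e mulr1.
  by rewrite lerD2r.
have coefs : \sum_(j <- s) modulus (fourier_coef g' j) ^+ 2 =
    \sum_(j <- s) modulus (fourier_coef g j) ^+ 2.
  apply: eq_big_seq => j js; rewrite fourier_coefB //; last first.
    by apply: clintZ; exact: clint_e.
  rewrite fourier_coefZ ?fourier_coef_e; last exact: clint_e.
  by rewrite ifF ?mulr0 ?subr0 //; apply: contraNF ks => /eqP ->.
have := IH g' _ us mg' gK'; rewrite coefs (energy_sub_mode k mg gK) big_cons mulrDr.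
by rewrite lerBrDl.
Qed.

(** Otherwise infinitely many coefficients would exceed eps, against Bessel's
    inequality.  The pair of indices is the one left over by telescoping in
    chernoff_partial_sums. *)
Lemma small_coefficients g K eps N : cmeasurable g ->
  (forall x, modulus (g x) <= K) -> 0 < eps ->
  exists2 J, (N <= J)%N & modulus (fourier_coef g J%:Z) <= eps /\
    modulus (fourier_coef g (- J.+1%:Z)) <= eps.
Proof.
move=> mg gK e0; apply: contrapT => H.
have p2 := two_pi_gt0 R.
pose b (J : nat) := modulus (fourier_coef g J%:Z) ^+ 2 +
  modulus (fourier_coef g (- J.+1%:Z)) ^+ 2.
have bJ J : (N <= J)%N -> eps ^+ 2 <= b J.
  move=> NJ; rewrite leNgt; apply/negP => bsmall; apply: H; exists J => //.
  have s1 := sqr_ge0 (modulus (fourier_coef g J%:Z)).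
  have s2 := sqr_ge0 (modulus (fourier_coef g (- J.+1%:Z))).
  split; rewrite -ler_sqr ?nnegrE ?modulus_ge0 ?(ltW e0) //;
    apply: le_trans (ltW bsmall).
    by rewrite lerDl.
  by rewrite lerDr.
have up (m : nat) : pi *+ 2 * (m%:R * eps ^+ 2) <= energy g.
  pose s := [seq (J%:Z : int) | J <- iota N m] ++ [seq (- J.+1%:Z : int) | J <- iota N m].
  have us : uniq s.
    rewrite cat_uniq !map_inj_uniq ?iota_uniq /= ?andbT; last 2 first.
    - by move=> i j /eqP; rewrite eqr_opp => /eqP [].
    - by move=> i j [].
    by apply/hasPn => _ /mapP[j _ ->]; apply/mapP => -[i _]; lia.
  apply: le_trans (bessel us mg gK); rewrite ler_pM2l //.
  rewrite big_cat !big_map /= -big_split /=.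
  have -> : m%:R * eps ^+ 2 = \sum_(j <- iota N m) eps ^+ 2.
    by rewrite big_const_seq count_predT size_iota iter_addr_0 mulr_natl.
  rewrite big_seq [X in _ <= X]big_seq; apply: ler_sum => j.
  by rewrite mem_iota => /andP[Nj _]; exact: bJ.
have A0 : 0 <= energy g / (pi *+ 2 * eps ^+ 2).
  by rewrite divr_ge0 ?energy_ge0 // mulr_ge0 ?sqr_ge0 ?ltW.
have := archi_boundP A0; have := up (Num.bound (energy g / (pi *+ 2 * eps ^+ 2))).
rewrite ltr_pdivrMr; last by rewrite mulr_gt0 // exprn_gt0.
move: (Num.bound _)%:R => B; move: (eps ^+ 2) => e; rewrite [B * (_ * _)]mulrCA => h1 h2.
by have := le_lt_trans h1 h2; rewrite ltxx.
Qed.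

(** By the mean value theorem on [0, y/2] and the duplication formulas. *)
Lemma sin_ge_half y : 0 <= y <= pi / 2 -> y / 2 <= sin y :> R.
Proof.
move=> /andP[]; rewrite le_eqVlt => /predU1P[<-|y0 y2]; first by rewrite sin0 mul0r.
have pp := @pi_gt0 R.
pose z := y / 2.
have z0 : 0 < z by rewrite /z; lra.
have dsin (x : R) : x \in `]0, z[ -> is_derive x (1 : R) sin (cos x) by move=> _; exact: is_derive_sin.
have csin : {within `[0, z], continuous (@sin R)}.
  by apply: continuous_subspaceT; exact: continuous_sin.
have [xi] := MVT z0 dsin csin; rewrite in_itv /= sin0 !subr0 => /andP[x0 xz] E.
have cz : cos z <= cos xi.
  have zp : z <= pi by rewrite /z; lra.
  have xin : xi \in `[0, pi] by rewrite in_itv /= ltW // (le_trans (ltW xz)).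
  have zin : z \in `[0, pi] by rewrite in_itv /= ltW.
  by rewrite leNgt ltr_cos // -leNgt ltW.
have c0 : 0 <= cos y by apply: cos_ge0_pihalf; lra.
have -> : y = z *+ 2 by rewrite /z mulr2n; lra.
rewrite sin_mulr2n.
have c2 : cos y = cos z ^+ 2 *+ 2 - 1 by rewrite -cos_mulr2n; congr cos; rewrite /z mulr2n; lra.
have cz0 : 0 <= cos z by apply: cos_ge0_pihalf; rewrite /z; lra.
have -> : z *+ 2 / 2 = z by rewrite mulr2n; lra.
rewrite E mulr2n; have -> : cos z * (cos xi * z) = z * (cos z * cos xi) by ring.
have h1 : z * (cos z * cos z) <= z * (cos z * cos xi).
  by rewrite ler_pM2l // ler_wpM2l.
have h2 : z * 1 <= z * (2 * (cos z * cos z)).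
  by rewrite ler_pM2l //; rewrite c2 expr2 mulr2n in c0; lra.
by rewrite mulr1 in h2; lra.
Qed.

Lemma modulus_cis_sub1 t : `|t| <= pi -> `|t| / 2 <= modulus (cis t - 1).
Proof.
move=> tp.
have s0 : `|t| / 2 / 2 <= sin (`|t| / 2) :> R.
  by apply: sin_ge_half; have := normr_ge0 t; lra.
rewrite -ler_sqr ?nnegrE ?modulus_ge0 ?divr_ge0 // sqr_modulus.
rewrite ReD ImD ReN ImN /= subr0.
have -> : (cos t - 1) ^+ 2 + sin t ^+ 2 = 2 - 2 * cos `|t|.
  by rewrite cos_norm; have := cos2Dsin2 t; rewrite !expr2; lra.
have -> : `|t| = (`|t| / 2) *+ 2 by rewrite mulr2n; lra.
rewrite cos_mulr2n cos2sin2 mulr2n.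
move: s0; move: (sin _) => S; have := normr_ge0 t; move: `|t| => T; nra.
Qed.

Lemma cmeasurableV f : cmeasurable f -> cmeasurable (fun x => (f x)^-1).
Proof.
move=> mf; have [f1 f2] := mf.
have mi : lmeas (fun x => (modulus (f x) ^+ 2)^-1).
  have -> : (fun x => (modulus (f x) ^+ 2)^-1) =
      (fun x => (modulus (f x) * modulus (f x)) `^ (-1)).
    by apply/funext => x; rewrite powR_inv1 ?expr2 // mulr_ge0 ?modulus_ge0.
  apply: (lmeas_comp (measurable_powR (-1))); apply: lmeasM; exact: lmeas_modulus.
have E x : (f x)^-1 = (complex.Re (f x) * (modulus (f x) ^+ 2)^-1) +i*
    (- (complex.Im (f x)) * (modulus (f x) ^+ 2)^-1).
  by rewrite sqr_modulus; case: (f x) => a b; rewrite mulNr.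
split; under eq_fun do rewrite E /=; apply: lmeasM => //.
by apply: measurableT_comp.
Qed.

End RiemannLebesgue.

(** * Fourier inversion and decay of high frequencies *)

Section Inversion.
Context {R : realType}.
Implicit Types (f g v w : R -> R[i]) (x y a b t K L : R) (n m N : nat) (k : int).

Lemma fourier_coef_translate v x k : clint v -> periodic v (pi *+ 2) ->
  fourier_coef (fun t => v (t + x)) k = fourier_coef v k * e_ k x.
Proof.
move=> cv pv; rewrite !fourier_coefE //; last exact: clint_shift.
rewrite (cint_period_shift (- k) _ x cv pv) mulrC -mulrA mulrC; congr (_ * _).
by rewrite mulrC /e_ mulrNz opprK.
Qed.

(** Chernoff's argument: v(x + t) - v(x) vanishes at t = 0 to first order, so it
    is the product of exp(it) - 1 and a bounded g.  Its Fourier coefficients are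
    then differences of consecutive coefficients of g, the symmetric partial sum
    at t = 0 telescopes to two of these, and Bessel's inequality makes them small
    for some arbitrarily large J. *)
Lemma chernoff_partial_sums v x L eps N : clint v -> periodic v (pi *+ 2) ->
  (forall t, modulus (v (t + x) - v x) <= L * `|t|) -> 0 < eps ->
  exists2 J, (N <= J)%N & modulus (fourier_sum J v x - v x) <= eps.
Proof.
move=> cv pv vL e0; have pp := @pi_gt0 R.
pose F t := v (t + x) - v x.
have cF : clint F by apply: clintB; [exact: clint_shift | exact: clint_cst].
(* Cut off to |t| <= pi, where |exp(it) - 1| >= |t| / 2; a period is all that the
   Fourier coefficients of g see. *)
pose g t := (\1_(`[- pi, pi]%classic : set R) t)%:C * (F t * (e_ 1 t - 1)^-1).
have mg : cmeasurable g.
  apply: cmeasurableM.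
    apply: cmeasurable_real; apply: lmeas_borel; apply: measurable_indic.
    exact: measurable_itv.
  apply: cmeasurableM; first exact: clint_meas.
  apply: cmeasurableV; apply: clint_meas.
  by apply: clintB; [exact: clint_e | exact: clint_cst].
have L0 : 0 <= L.
  have := vL 1; rewrite normr1 mulr1; apply: le_trans; exact: modulus_ge0.
have Fg t : - pi <= t <= - pi + pi *+ 2 -> F t = (e_ 1 t - 1) * g t.
  rewrite mulr2n => tpi.
  have tp : `|t| <= pi by rewrite ler_norml; lra.
  rewrite /g indicE mem_set /=; last by rewrite in_itv /= -ler_norml.
  rewrite mul1r; have [E|E] := eqVneq (e_ 1 t - 1) 0; last by rewrite mulrCA mulfV ?mulr1.
  rewrite E mul0r; apply: modulus_eq0; apply/eqP; rewrite eq_le modulus_ge0 andbT.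
  apply: le_trans (vL t) _; rewrite (_ : `|t| = 0) ?mulr0 //.
  have := modulus_cis_sub1 tp; move: E; rewrite /e_ mul1r => ->.
  by rewrite modulus0; have := normr_ge0 t; lra.
have gK t : modulus (g t) <= 2 * L.
  rewrite /g modulusM modulus_real indicE.
  have [|_] := boolP (t \in _); last by rewrite normr0 mul0r mulr_ge0.
  move=> /set_mem /=; rewrite in_itv /= -ler_norml => tp.
  rewrite normr1 mul1r modulusM modulusV.
  have := modulus_cis_sub1 tp; rewrite /e_ mul1r.
  have := vL t; rewrite -/(F t); move: (modulus (F t)) (modulus_ge0 (F t)).
  move: (modulus (cis t - 1)) => d f f0 fL dt.
  have [t0|t0] := eqVneq t 0.
    have -> : f = 0 by move: fL; rewrite t0 normr0 mulr0; lra.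
    by rewrite mul0r mulr_ge0.
  have t1 : 0 < `|t| by rewrite normr_gt0.
  have d0 : 0 < d by lra.
  rewrite ler_pdivrMr //; apply: le_trans fL _.
  have : L * (`|t| / 2) <= L * d by rewrite ler_wpM2l.
  by lra.
have cg := clint_bounded mg gK.
have coefF k : fourier_coef F k = fourier_coef g (k - 1) - fourier_coef g k.
  rewrite -fourier_coef_modulate // -fourier_coefB //; last exact: clint_eM.
  have ceg : clint (fun t => e_ 1 t * g t - g t) by apply: clintB => //; exact: clint_eM.
  rewrite !fourier_coefE //; congr (_ * _); apply: eq_cint => t tpi.
  by rewrite Fg // mulrBl mul1r.
have telescope J : sym_sum J (fourier_coef F) =
    fourier_coef g (- J.+1%:Z) - fourier_coef g J%:Z.
  elim: J => [|J IH]; first by rewrite /sym_sum big_ord1 subrr coefF sub0r.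
  rewrite sym_sumS IH !coefF.
  have -> : J.+1%:Z - 1 = J%:Z by lia.
  have -> : - J.+1%:Z - 1 = - J.+2%:Z by lia.
  move: (fourier_coef g (- J.+1%:Z)) (fourier_coef g J%:Z)
    (fourier_coef g J.+1%:Z) (fourier_coef g (- J.+2%:Z)) => p q r s; ring.
have partial J : fourier_sum J v x - v x = sym_sum J (fourier_coef F).
  transitivity (sym_sum J (fun k => fourier_coef v k * e_ k x +
      (if k == 0 then - v x else 0))).
    by rewrite sym_sumD sym_sum_delta.
  apply: eq_sym_sum => k _; rewrite /F fourier_coefB ?fourier_coef_translate //.
  - congr (_ + _); have -> : (fun=> v x) = (fun t => v x * e_ 0 t).
      by apply/funext => t; rewrite e_0 mulr1.
    rewrite fourier_coefZ ?fourier_coef_e; last exact: clint_e.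
    by rewrite eq_sym; case: eqP; rewrite ?mulr1 ?mulr0 ?oppr0.
  - exact: clint_shift.
  - exact: clint_cst.
have e2 : 0 < eps / 2 by lra.
have [J NJ [J1 J2]] := small_coefficients N mg gK e2.
exists J => //; rewrite partial telescope; apply: le_trans (modulusB _ _) _; lra.
Qed.

(** 1/k^2 <= 1/(k-1) - 1/k telescopes. *)
Lemma fourier_sum_cauchy v x D n m : (0 < n)%N -> (n <= m)%N ->
  (forall k, k != 0 -> modulus (fourier_coef v k) <= D / (k%:~R ^+ 2)) -> 0 <= D ->
  modulus (fourier_sum m v x - fourier_sum n v x) <= 2 * D * (n%:R^-1 - m%:R^-1).
Proof.
move=> n0 nm vD D0; elim: m nm => [|m IH] nm; first by lia.
move: nm; rewrite leq_eqVlt => /predU1P[<-|nm].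
  by rewrite !subrr modulus0 mulr0.
rewrite ltnS in nm.
have m0 : (0 < m)%N by apply: leq_trans nm.
have step : 2 * (D / (m.+1%:R ^+ 2)) <= 2 * D * (m%:R^-1 - m.+1%:R^-1).
  have M0 : 0 < m%:R :> R by rewrite ltr0n.
  have -> : m.+1%:R = m%:R + 1 :> R by rewrite natr1.
  rewrite -[leRHS]mulrA; apply: ler_wpM2l => //; apply: ler_wpM2l => //.
  have -> : m%:R^-1 - (m%:R + 1)^-1 = (m%:R * (m%:R + 1))^-1 :> R.
    by field; lra.
  rewrite lef_pV2 ?posrE; [|nra|nra]; nra.
rewrite /fourier_sum sym_sumS -/(fourier_sum m v x) addrAC.
have H (k : int) : k != 0 -> `|k|%N = m.+1 -> modulus (fourier_coef v k *
    cis (k%:~R * x)) <= D / (m.+1%:R ^+ 2).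
  move=> k0 km; rewrite modulusM modulus_cis mulr1; apply: le_trans (vD _ k0) _.
  by rewrite -[k%:~R ^+ 2]real_normK ?num_real // -intr_norm -abszE km.
apply: le_trans (modulusD _ _) _.
apply: le_trans (lerD (IH nm) (le_trans (modulusD _ _)
  (lerD (H m.+1%:Z isT erefl) (H (- m.+1%:Z) isT erefl)))) _.
move: step; rewrite !mulrBr; move: (D / _) (2 * D * n%:R^-1) (2 * D * m%:R^-1).
by move: (2 * D * m.+1%:R^-1) => a b c d; lra.
Qed.

(** The partial sums converge at the stated rate by fourier_sum_cauchy, and a
    subsequence of them converges to v by chernoff_partial_sums. *)
Lemma fourier_sum_rate v x L D n : clint v -> periodic v (pi *+ 2) ->
  (forall t, modulus (v (t + x) - v x) <= L * `|t|) ->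
  (forall k, k != 0 -> modulus (fourier_coef v k) <= D / (k%:~R ^+ 2)) -> 0 <= D ->
  (0 < n)%N -> modulus (v x - fourier_sum n v x) <= 2 * D / n%:R.
Proof.
move=> cv pv vL vD D0 n0; apply/ler_addgt0Pr => eps e0.
have [J nJ Je] := chernoff_partial_sums n cv pv vL e0.
have -> : v x - fourier_sum n v x =
   (fourier_sum J v x - fourier_sum n v x) - (fourier_sum J v x - v x) by ring.
apply: le_trans (modulusB _ _) _; apply: lerD => //.
apply: le_trans (fourier_sum_cauchy x n0 nJ vD D0) _.
rewrite ler_wpM2l ?mulr_ge0 // gerBl invr_ge0 //; exact: ler0n.
Qed.

End Inversion.

Section HighFrequencies.
Context {R : realType} (X : banach_lattice R) (KA KS : R).
Hypothesis KA0 : 0 <= KA.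
Hypothesis HA : averages_bounded X KA.
Hypothesis KS0 : 0 <= KS.
Hypothesis HS : partial_sums_bounded X KS.
Implicit Types (f g u : R -> R[i]) (x t h : R) (n m J : nat) (k : int).

Let B h := @mean R 0 h.

Lemma fourier_coef_bound : exists2 c, 0 <= c & forall u k, bl_mem X u ->
  modulus (fourier_coef u k) <= c * bl_norm X u.
Proof.
have p2 := two_pi_gt0 R.
have [c c0 H] := bl_clint_bound X.
exists ((pi *+ 2)^-1 * (2 * c)); first by rewrite !mulr_ge0 ?invr_ge0 // ltW.
move=> u k mu; have [cu ub] := H u mu.
rewrite fourier_coefE // modulusM modulus_real gtr0_norm ?invr_gt0 //.
rewrite -[leRHS]mulrA ler_pM2l ?invr_gt0 //.
apply: le_trans (modulus_cint _ _ (clint_eM _ cu)) _.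
rewrite -[leRHS]mulrA ler_pM2l //; apply: le_trans ub.
have -> : - pi + pi *+ 2 = pi :> R by rewrite mulr2n addKr.
rewrite le_eqVlt; apply/orP; left; apply/eqP; apply: eq_rint => x _.
by rewrite modulusM modulus_e mul1r.
Qed.

(** One average makes u bounded. *)
Lemma fwd_bounded h u : 0 < h -> h <= pi *+ 2 -> bl_mem X u ->
  exists2 W, 0 <= W & forall x, modulus (B h u x) <= W.
Proof.
move=> h0 h2 mu; have cu := bl_clint mu; have lu := clint_modulus cu.
have p2 := two_pi_gt0 R.
exists (2 / h * rint 0 (0 + pi *+ 2) (fun y => modulus (u y))).
  rewrite mulr_ge0 ?divr_ge0 ?(ltW h0) //; apply: rint_ge0 => y; exact: modulus_ge0.
move=> x; apply: le_trans (modulus_mean x h0 cu) _.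
rewrite subr0 addr0 ler_pM2l ?divr_gt0 //.
apply: (@le_trans _ _ (rint x (x + pi *+ 2) (fun y => modulus (u y)))).
  apply: le_rint_itv => //; first by rewrite lerDl ltW.
    by rewrite lerD2l.
  by move=> y; exact: modulus_ge0.
have cm : clint (of_real (fun y => modulus (u y))).
  by split => //=; exact: lint_cst.
have pm : periodic (of_real (fun y => modulus (u y))) (pi *+ 2).
  by move=> y; rewrite /of_real (bl_periodic mu).
have E : rint x (x + pi *+ 2) (fun y => modulus (u y)) =
    rint 0 (0 + pi *+ 2) (fun y => modulus (u y)).
  have := cint_period x 0 cm pm; rewrite !cintE => /(congr1 (@complex.Re R)) E.
  exact: E.
by rewrite E.
Qed.

(** A second one makes it Lipschitz. *)
Lemma fwd_lipschitz h w W : 0 < h -> clint w ->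
  (forall x, modulus (w x) <= W) ->
  exists L, forall x t, modulus (B h w (t + x) - B h w x) <= L * `|t|.
Proof.
move=> h0 cw wW; exists (4 * W / h) => x t.
have W0 : 0 <= W by apply: le_trans (wW 0); exact: modulus_ge0.
wlog t0 : x t / 0 <= t => [H|].
  case: (leP 0 t) => [|/ltW] t0; first exact: H.
  have := H (t + x) (- t); rewrite oppr_ge0 => /(_ t0).
  by rewrite addKr -modulusN opprB normrN.
have -> : B h w (t + x) - B h w x =
   (h^-1)%:C * (cint (x + h) (x + h + t) w - cint x (x + t) w).
  rewrite /B /mean subr0 !addr0 -mulrBr [t + x]addrC; congr (_ * _).
  have E : cint x (x + t) w + cint (x + t) (x + t + h) w =
      cint x (x + h) w + cint (x + h) (x + h + t) w.
    have -> : x + h + t = x + t + h by rewrite addrAC.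
    by rewrite -!cint_cat //; lra.
  move: (cint x (x + t) w) (cint (x + t) (x + t + h) w) (cint x (x + h) w)
    (cint (x + h) (x + h + t) w) E => p q r s E.
  have -> : q = r + s - p by rewrite -E; ring.
  ring.
rewrite modulusM modulus_real gtr0_norm ?invr_gt0 //.
rewrite mulrC mulrAC ler_pM2r ?invr_gt0 // ger0_norm //.
apply: le_trans (modulusB _ _) _.
have b1 : modulus (cint (x + h) (x + h + t) w) <= 2 * (W * (x + h + t - (x + h))).
  by apply: modulus_cint_le => //; rewrite lerDl.
have b2 : modulus (cint x (x + t) w) <= 2 * (W * (x + t - x)).
  by apply: modulus_cint_le => //; rewrite lerDl.
move: b1 b2; rewrite ![_ + t]addrC !addrK => b1 b2; apply: le_trans (lerD b1 b2) _.
lra.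
Qed.

Lemma modulus_mean_mult h k : 0 < h -> k != 0 ->
  modulus (mean_mult 0 h k : R[i]) <= 2 / h / `|k%:~R|.
Proof.
move=> h0 k0; have k1 : 0 < `|k%:~R : R| by rewrite normr_gt0 intr_eq0.
have E := cint_cis k%:~R (ltW h0).
have E2 := congr1 modulus E.
rewrite modulusM modulus_imag in E2.
have : modulus (cis (k%:~R * h) - cis (k%:~R * 0) : R[i]) <= 2.
  by apply: le_trans (modulusB _ _) _; rewrite !modulus_cis.
rewrite -E2 => H; rewrite /mean_mult subr0 modulusM modulus_real.
rewrite gtr0_norm ?invr_gt0 // ler_pdivlMr // [2 / h]mulrC -mulrA.
by rewrite ler_pM2l ?invr_gt0 // mulrC.
Qed.

Lemma bl_sup_norm g K : bl_mem X g -> (forall x, modulus (g x) <= K) ->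
  bl_norm X g <= K * bl_norm X (of_real (fun=> 1)).
Proof. by move=> mg gK; exact: (bl_bounded X (bl_measurable mg) (bl_periodic mg) gK).2. Qed.

(** The second iterate of the average is Lipschitz and has coefficients O(1/k^2),
    as each average divides them by k; so Fourier inversion applies uniformly. *)
Lemma fwd2_approx h u : 0 < h -> h <= pi *+ 2 -> bl_mem X u ->
  exists2 E, 0 <= E & forall J, (0 < J)%N ->
    bl_norm X (fun x => B h (B h u) x - fourier_sum J (B h (B h u)) x) <= E / J%:R.
Proof.
move=> h0 h2 mu.
have mB g : bl_mem X g -> bl_mem X (B h g) by move=> mg; exact: (bl_mean_fwd KA0 HA h0 mg).1.
have mw := mB _ mu; have mv := mB _ mw.
have [W W0 wW] := fwd_bounded h0 h2 mu.
have [L vL] := fwd_lipschitz h0 (bl_clint mw) wW.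
have [c c0 ub] := fourier_coef_bound.
have N0 := bl_norm_ge0 mu; have N1 := bl_norm_ge0 (bl_mem1 X).
pose D := (2 / h) ^+ 2 * (c * bl_norm X u).
have D0 : 0 <= D by rewrite mulr_ge0 ?sqr_ge0 // mulr_ge0.
have vD k : k != 0 -> modulus (fourier_coef (B h (B h u)) k) <= D / (k%:~R ^+ 2).
  move=> k0; have k1 : 0 < `|k%:~R : R| by rewrite normr_gt0 intr_eq0.
  rewrite (fourier_coef_mean _ (ltW h0) (bl_clint mw) (bl_periodic mw) (bl_clint mv)).
  rewrite (fourier_coef_mean _ (ltW h0) (bl_clint mu) (bl_periodic mu) (bl_clint mw)).
  - rewrite modulusM [X in _ * X]modulusM /D [leLHS]mulrA -[k%:~R ^+ 2]real_normK ?num_real //.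
    rewrite [leRHS](_ : _ = (2 / h / `|k%:~R|) * (2 / h / `|k%:~R|) *
      (c * bl_norm X u)); last first.
      by field; rewrite !gt_eqF.
    have M := modulus_mean_mult h0 k0; have M0 := modulus_ge0 (mean_mult 0 h k : R[i]).
    apply: ler_pM.
    + exact: mulr_ge0.
    + exact: modulus_ge0.
    + exact: ler_pM.
    + exact: ub.
exists (2 * D * bl_norm X (of_real (fun=> 1))); first by rewrite mulr_ge0 // mulr_ge0.
move=> J J0; rewrite mulrAC; apply: bl_sup_norm.
  by apply: bl_memB => //; exact: (HS J0 mv).1.
move=> x; apply: (fourier_sum_rate (bl_clint mv) (bl_periodic mv) (vL x) vD D0 J0).
Qed.

Lemma fwd_trig_deriv n (c : int -> R[i]) h x : 0 < h ->
  B h (trig n (deriv_coef c)) x = (h^-1)%:C * (trig n c (x + h) - trig n c x).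
Proof.
by move=> h0; rewrite /B /mean subr0 addr0 trig_FTC // lerDl ltW.
Qed.

(** An average of a derivative is a difference quotient, so that one of the two
    averages cancels the derivative at the cost of 1/h. *)
Lemma fwd2_trig_deriv n (c : int -> R[i]) h : 0 < h ->
  bl_norm X (B h (B h (trig n (deriv_coef c)))) <= 12 * KA / h * bl_norm X (trig n c).
Proof.
move=> h0; have mT := bl_trig X n c; have cT := clint_trig n c.
have hh : h < 2 * h by lra.
have -> : B h (B h (trig n (deriv_coef c))) =
    (fun x => (h^-1)%:C * (mean h (2 * h) (trig n c) x - mean 0 h (trig n c) x)).
  apply/funext => x.
  have -> : B h (trig n (deriv_coef c)) = fun y => (h^-1)%:C * (trig n c (y + h) - trig n c y).
    by apply/funext => y; exact: fwd_trig_deriv.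
  have cs := clint_shift h cT.
  rewrite /B meanZ ?meanB //; last exact: clintB.
  congr (_ * (_ - _)); rewrite /mean cint_shift; last exact: clint_meas.
  have -> : h - 0 = 2 * h - h by lra.
  have -> : x + 0 + h = x + h by lra.
  by have -> : x + h + h = x + 2 * h by lra.
have l1 : - (4 * h / 2) <= h by lra.
have l2 : 2 * h <= 4 * h / 2 by lra.
have [m1 n1] := bl_mean KA0 HA hh l1 l2 mT.
have [m2 n2] := bl_mean_fwd KA0 HA h0 mT.
rewrite bl_normZ; last exact: bl_memB.
rewrite modulus_real gtr0_norm ?invr_gt0 //.
rewrite [12 * KA / h]mulrC -mulrA ler_pM2l ?invr_gt0 //.
apply: le_trans (bl_normB m1 m2) _; apply: le_trans (lerD n1 n2) _.
have -> : 2 * (4 * h) / (2 * h - h) = 8 by field; lra.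
lra.
Qed.

(** If u has no frequencies up to n, then S_J u is the derivative of a polynomial
    whose norm is O(1/n) times that of u, by the Bohr-Favard inequality, and
    B_h^2 applied to a derivative costs only 1/h.  Letting J tend to infinity
    requires that S_J B_h^2 u tend to B_h^2 u; two averages rather than one are
    taken for this convergence. *)
Lemma high_frequency_decay : exists2 Q, 0 <= Q & forall n h u, 0 < h -> h <= pi *+ 2 ->
  bl_mem X u -> (forall k, (`|k| <= n)%N -> fourier_coef u k = 0) ->
  bl_norm X (B h (B h u)) <= Q / (h * n.+1%:R) * bl_norm X u.
Proof.
exists (12 * KA * (5 * KS) * KS); first by rewrite !mulr_ge0.
move=> n h u h0 h2 mu uk.
have mB g : bl_mem X g -> bl_mem X (B h g) by move=> mg; exact: (bl_mean_fwd KA0 HA h0 mg).1.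
have mw := mB _ mu; have mv := mB _ mw.
have [E E0 HE] := fwd2_approx h0 h2 mu.
apply/ler_addgt0Pr => eps e0.
have A0 : 0 <= E / eps by rewrite divr_ge0 // ltW.
pose J := (Num.bound (E / eps)).+1.
have J0 : (0 < J)%N by [].
have JE : E / J%:R <= eps.
  rewrite ler_pdivrMr ?ltr0n // mulrC -ler_pdivrMr //.
  by apply: le_trans (ltW (archi_boundP A0)) _; rewrite ler_nat leqnSn.
have mS := (HS J0 mv).1.
pose U := antideriv_coef n (fourier_coef u).
have SE : fourier_sum J (B h (B h u)) = B h (B h (trig J (deriv_coef U))).
  rewrite /B !mean_trig fourier_sumE; apply: eq_trig => k _.
  rewrite (fourier_coef_mean _ (ltW h0) (bl_clint mw) (bl_periodic mw) (bl_clint mv)).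
  rewrite (fourier_coef_mean _ (ltW h0) (bl_clint mu) (bl_periodic mu) (bl_clint mw)).
  by rewrite deriv_antideriv_coef.
have bF := bohr_favard KS0 HS J n (fourier_coef u).
have dU : trig J (deriv_coef U) = fourier_sum J u.
  by apply: eq_trig => k _; rewrite deriv_antideriv_coef.
have bD := @fwd2_trig_deriv J U h h0.
have bS := (HS J0 mu).2.
have tri : bl_norm X (B h (B h u)) <=
   bl_norm X (fourier_sum J (B h (B h u))) +
   bl_norm X (fun x => B h (B h u) x - fourier_sum J (B h (B h u)) x).
  have -> : bl_norm X (B h (B h u)) = bl_norm X (fun x =>
     fourier_sum J (B h (B h u)) x + (B h (B h u) x - fourier_sum J (B h (B h u)) x)).
    by congr (bl_norm X _); apply/funext => x; rewrite addrC subrK.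
  by apply: bl_normD' => //; exact: bl_memB.
apply: le_trans tri _; apply: lerD; last exact: le_trans (HE _ J0) JE.
rewrite SE; apply: le_trans bD _.
have n0 : 0 < n.+1%:R :> R by rewrite ltr0n.
have k0 : 0 <= 12 * KA / h by rewrite divr_ge0 ?mulr_ge0 // ltW.
apply: le_trans (ler_wpM2l k0 bF) _.
have k1 : 0 <= 12 * KA / h * (5 / n.+1%:R * KS).
  by rewrite mulr_ge0 // mulr_ge0 // divr_ge0 // ltW.
rewrite [leLHS]mulrA -fourier_sumE; apply: le_trans (ler_wpM2l k1 bS) _.
rewrite le_eqVlt; apply/orP; left; apply/eqP; field.
by rewrite !gt_eqF.
Qed.

End HighFrequencies.

(** * Convergence rates and Jackson's inequality *)

Section Rates.
Context {R : realType}.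
Implicit Types (u : nat -> R) (alpha C : R) (n N : nat).

Lemma powR_nat_gt0 n alpha : (0 < n)%N -> 0 < (n%:R : R) `^ alpha.
Proof. by move=> n0; rewrite powR_gt0 // ltr0n. Qed.

Lemma rate_everywhere u alpha C N :
  (forall n, (N <= n)%N -> (0 < n)%N -> u n <= C * n%:R `^ (- alpha)) ->
  exists2 C', 0 <= C' & forall n, (0 < n)%N -> u n <= C' * n%:R `^ (- alpha).
Proof.
move=> uC; pose S := \sum_(n < N) `|u n| / (n%:R : R) `^ (- alpha).
have S0 : 0 <= S by apply: sumr_ge0 => n _; rewrite divr_ge0 ?powR_ge0.
exists (`|C| + S); first by rewrite addr_ge0.
move=> n n0; have p0 := powR_nat_gt0 (- alpha) n0.
case: (leqP N n) => [Nn|nN].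
  apply: le_trans (uC n Nn n0) _; rewrite ler_pM2r //.
  by apply: le_trans (ler_norm C) _; rewrite lerDl.
rewrite -ler_pdivrMr //; apply: (@le_trans _ _ (`|u n| / n%:R `^ (- alpha))).
  by rewrite ler_pM2r ?invr_gt0 // ler_norm.
rewrite /S (bigD1 (Ordinal nN)) //= addrCA lerDl addr_ge0 // sumr_ge0 // => m _.
Qed.

(** The finitely many first terms are absorbed by the constant because n^-alpha
    is positive for n > 0. *)
Lemma bigO_rate u alpha : (forall n, (0 < n)%N -> 0 <= u n) ->
  u =O_\oo (fun n : nat => n%:R `^ (- alpha)) <->
  exists2 C, 0 <= C & forall n, (0 < n)%N -> u n <= C * n%:R `^ (- alpha).
Proof.
move=> u0; split.
  move/eqO_exP => [k k0 [N _ HN]].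
  apply: (@rate_everywhere _ _ k N) => n Nn n0.
  have := HN n Nn; rewrite /= ger0_norm ?u0 // ger0_norm ?powR_ge0 //.
move=> [C C0 HC]; apply/eqO_exP; exists (C + 1); first by rewrite ltr_wpDl.
exists 1%N => // n /= n0; rewrite ger0_norm ?u0 // ger0_norm ?powR_ge0 //.
apply: le_trans (HC n n0) _; rewrite ler_wpM2r ?powR_ge0 //; lra.
Qed.

(** Iterating the recursion sums C m^b over m = n, n/2, n/4 and so on, a geometric
    series dominated by its first term since b > 0. *)
Lemma dyadic_sum (a : nat -> R) (b : R) C : 0 < b -> 0 <= C ->
  (forall n, (1 < n)%N -> a n <= a n./2 + C * n%:R `^ b) ->
  exists2 K, 0 <= K & forall n, (0 < n)%N -> a n <= K * n%:R `^ b.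
Proof.
move=> b0 C0 ha; set q := (2 : R) `^ (- b).
have q1 : q < 1.
  rewrite /q powRN invf_lt1 ?powR_gt0 //.
  have := gt0_ltr_powR b0 (_ : 1 \in Num.nneg) (_ : (2 : R) \in Num.nneg).
  by rewrite powR1; apply; rewrite ?nnegrE ?ltr1n.
have q0 : 0 < 1 - q by rewrite subr_gt0.
pose K := `|a 1%N| + C / (1 - q).
have K0 : 0 <= K by rewrite addr_ge0 // divr_ge0 // ltW.
exists K => // n; elim/ltn_ind: n => n IH n0.
have [->|n1] := eqVneq n 1%N.
  rewrite powR1 mulr1 /K; apply: le_trans (ler_norm _) _.
  by rewrite lerDl divr_ge0 // ltW.
have n2 : (1 < n)%N by lia.
apply: le_trans (ha n n2) _.
have h0 : (0 < n./2)%N by lia.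
have hn : (n./2 < n)%N by lia.
have step : n./2%:R `^ b <= q * n%:R `^ b.
  rewrite /q powRN ler_pdivlMl ?powR_gt0 // -powRM // -natrM.
  apply: ge0_ler_powR; [exact: ltW | by rewrite nnegrE | by rewrite nnegrE |].
  by rewrite ler_nat; lia.
apply: (@le_trans _ _ (K * (q * n%:R `^ b) + C * n%:R `^ b)).
  by rewrite lerD2r; apply: le_trans (IH _ hn h0) _; rewrite ler_wpM2l.
rewrite mulrA -mulrDl ler_pM2r ?powR_nat_gt0 //.
have : C <= K * (1 - q).
  by rewrite /K mulrDl mulfVK ?gt_eqF // lerDr mulr_ge0 // ltW.
lra.
Qed.

End Rates.

Section Jackson.
Context {R : realType} (X : banach_lattice R) (KA KS : R).
Hypothesis KA0 : 0 <= KA.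
Hypothesis HA : averages_bounded X KA.
Hypothesis KS0 : 0 <= KS.
Hypothesis HS : partial_sums_bounded X KS.
Implicit Types (f g u : R -> R[i]) (x t h C : R) (n m J s r : nat) (k : int).
Implicit Types (c : int -> R[i]).

Section DiffPow.
Variable T : (R -> R[i]) -> R -> R[i].
Variable K : R.
Hypothesis K0 : 0 <= K.
Hypothesis TX : forall f, bl_mem X f -> bl_mem X (T f).
Hypothesis TK : forall f, bl_mem X f -> bl_norm X (T f) <= K * bl_norm X f.
Hypothesis TB : forall f g, bl_mem X f -> bl_mem X g ->
  T (fun x => f x - g x) = (fun x => T f x - T g x).

Lemma diff_powSr s f : diff_pow T s.+1 f = diff_pow T s (fun x => f x - T f x).
Proof. exact: iterSr. Qed.

Lemma bl_mem_diff f : bl_mem X f -> bl_mem X (fun x => f x - T f x).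
Proof. by move=> mf; apply: bl_memB => //; exact: TX. Qed.

Lemma bl_diff f : bl_mem X f ->
  bl_norm X (fun x => f x - T f x) <= (1 + K) * bl_norm X f.
Proof.
move=> mf; apply: le_trans (bl_normB mf (TX mf)) _.
by rewrite mulrDl mul1r lerD2l; exact: TK.
Qed.

Lemma bl_mem_diff_pow s f : bl_mem X f -> bl_mem X (diff_pow T s f).
Proof.
elim: s f => [//|s IH] f mf; rewrite diff_powSr; apply: IH; exact: bl_mem_diff.
Qed.

Lemma bl_diff_pow s f : bl_mem X f ->
  bl_norm X (diff_pow T s f) <= (1 + K) ^+ s * bl_norm X f.
Proof.
have K1 : 0 <= 1 + K by rewrite addr_ge0.
elim: s f => [|s IH] f mf; first by rewrite mul1r.
rewrite diff_powSr exprSr -mulrA; apply: le_trans (IH _ (bl_mem_diff mf)) _.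
by rewrite ler_wpM2l ?exprn_ge0 //; exact: bl_diff.
Qed.

Lemma diff_powB s f g : bl_mem X f -> bl_mem X g ->
  diff_pow T s (fun x => f x - g x) = (fun x => diff_pow T s f x - diff_pow T s g x).
Proof.
elim: s f g => [//|s IH] f g mf mg; rewrite !diff_powSr TB //.
rewrite -IH; [|exact: bl_mem_diff|exact: bl_mem_diff].
by congr (diff_pow T s _); apply/funext => x; ring.
Qed.

End DiffPow.

Lemma bernstein_iter s n c : (0 < n)%N ->
  bl_norm X (trig_deriv s n c) <= (3 * KS * n%:R) ^+ s * bl_norm X (trig n c).
Proof.
move=> n0; elim: s => [|s IH]; first by rewrite mul1r.
have k0 : 0 <= 3 * KS * n%:R by rewrite !mulr_ge0.
rewrite /trig_deriv iterS; apply: le_trans (bernstein KS0 HS _ n0) _.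
by rewrite exprS -[leRHS]mulrA ler_wpM2l.
Qed.

Lemma bl_mem_steklov_fwd h f : 0 < h -> bl_mem X f -> bl_mem X (steklov_fwd h f).
Proof. by move=> h0 mf; rewrite steklov_fwdE; exact: (bl_mean_fwd KA0 HA h0 mf).1. Qed.

Lemma bl_steklov_fwd h f : 0 < h -> bl_mem X f ->
  bl_norm X (steklov_fwd h f) <= 4 * KA * bl_norm X f.
Proof. by move=> h0 mf; rewrite steklov_fwdE; exact: (bl_mean_fwd KA0 HA h0 mf).2. Qed.

Lemma steklov_fwdB h f g : bl_mem X f -> bl_mem X g ->
  steklov_fwd h (fun x => f x - g x) = (fun x => steklov_fwd h f x - steklov_fwd h g x).
Proof. by move=> mf mg; rewrite !steklov_fwdE (meanB _ _ (bl_clint mf) (bl_clint mg)). Qed.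

Lemma steklovB h f g : bl_mem X f -> bl_mem X g ->
  steklov h (fun x => f x - g x) = (fun x => steklov h f x - steklov h g x).
Proof. by move=> mf mg; rewrite !steklovE (meanB _ _ (bl_clint mf) (bl_clint mg)). Qed.

Lemma fourier_coef_steklov_fwd h f k : 0 < h -> bl_mem X f ->
  fourier_coef (steklov_fwd h f) k = mean_mult 0 h k * fourier_coef f k.
Proof.
move=> h0 mf; have := bl_mem_steklov_fwd h0 mf; rewrite steklov_fwdE => mw.
exact: (fourier_coef_mean k (ltW h0) (bl_clint mf) (bl_periodic mf) (bl_clint mw)).
Qed.

Lemma fourier_sumB n f g : bl_mem X f -> bl_mem X g ->
  fourier_sum n (fun x => f x - g x) = (fun x => fourier_sum n f x - fourier_sum n g x).
Proof.
move=> mf mg; apply/funext => x; rewrite !fourier_sumE -trigB.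
by congr (trig n _ x); apply/funext => k; rewrite (fourier_coefB k (bl_clint mf) (bl_clint mg)).
Qed.

Lemma fwd_fourier_sum h n f : 0 < h -> bl_mem X f ->
  steklov_fwd h (fourier_sum n f) = fourier_sum n (steklov_fwd h f).
Proof.
move=> h0 mf; rewrite steklov_fwdE mean_trig fourier_sumE.
by apply: eq_trig => k _; rewrite fourier_coef_steklov_fwd.
Qed.

(** Both operators act on Fourier coefficients by multiplication. *)
Lemma diff_pow_fourier_sum s h n f : (0 < n)%N -> 0 < h -> bl_mem X f ->
  diff_pow (steklov_fwd h) s (fourier_sum n f) =
  fourier_sum n (diff_pow (steklov_fwd h) s f).
Proof.
move=> n0 h0; elim: s f => [//|s IH] f mf; rewrite !diff_powSr.
have mB := bl_mem_steklov_fwd h0 mf.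
rewrite fwd_fourier_sum // -fourier_sumB // IH //; exact: bl_memB.
Qed.

(** Let u = f - S_n f and B = B_h.  If h n is large then |B^2 u| <= |u| / 2, and
    from u = (I + B) (I - B) u + B^2 u follows |u| <= 2 |I + B| |(I - B) u|.  As
    (I - B) u has again no frequencies up to n, this can be iterated; finally
    (I - B)^s commutes with I - S_n.  Here |u| is the norm of X. *)
Lemma jackson s : exists2 C, 0 <= C & exists2 K, 0 <= K &
  forall n h f, (0 < n)%N -> 0 < h -> h <= pi *+ 2 -> K <= h * n%:R -> bl_mem X f ->
  bl_norm X (fun x => f x - fourier_sum n f x) <=
  C * bl_norm X (diff_pow (steklov_fwd h) s f).
Proof.
have [Q Q0 HQ] := high_frequency_decay KA0 HA KS0 HS.
pose A : R := 2 * (1 + 4 * KA).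
have A0 : 0 <= A by rewrite mulr_ge0 // addr_ge0 // mulr_ge0.
exists (A ^+ s * (1 + KS)); first by rewrite mulr_ge0 ?exprn_ge0 ?addr_ge0.
exists (2 * Q); first by rewrite mulr_ge0.
move=> n h f n0 h0 h2 hn mf.
have mB g : bl_mem X g -> bl_mem X (steklov_fwd h g) by move=> mg; exact: bl_mem_steklov_fwd.
have lower p u : bl_mem X u -> (forall k, (`|k| <= n)%N -> fourier_coef u k = 0) ->
    bl_norm X u <= A ^+ p * bl_norm X (diff_pow (steklov_fwd h) p u).
  elim: p u => [|p IH] u mu uk; first by rewrite mul1r.
  pose w x := u x - steklov_fwd h u x.
  have mw : bl_mem X w by apply: bl_memB => //; exact: mB.
  have wk k : (`|k| <= n)%N -> fourier_coef w k = 0.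
    move=> kn; rewrite fourier_coefB; [|exact: bl_clint mu|exact: bl_clint (mB _ mu)].
    by rewrite fourier_coef_steklov_fwd // uk // mulr0 subr0.
  rewrite diff_powSr exprS -mulrA; apply: le_trans (_ : _ <= A * bl_norm X w) _; last first.
    by rewrite ler_wpM2l //; exact: IH.
  have half : bl_norm X (steklov_fwd h (steklov_fwd h u)) <= 2^-1 * bl_norm X u.
    rewrite !steklov_fwdE; apply: le_trans (HQ n h u h0 h2 mu uk) _.
    rewrite ler_wpM2r ?bl_norm_ge0 //.
    have hn1 : h * n%:R <= h * n.+1%:R by rewrite ler_pM2l // ler_nat.
    have hp : 0 < h * n.+1%:R by rewrite mulr_gt0 // ltr0n.
    by rewrite ler_pdivrMr //; lra.
  have E : u = (fun x => (w x + steklov_fwd h w x) + steklov_fwd h (steklov_fwd h u) x).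
    by apply/funext => x; rewrite /w (steklov_fwdB h mu (mB _ mu)); ring.
  have mBw := mB _ mw; have mBB := mB _ (mB _ mu).
  have t1 := bl_normD' (bl_memD mw mBw) mBB.
  have t2 := bl_normD' mw mBw.
  have t3 := bl_steklov_fwd h0 mw.
  rewrite -E in t1; rewrite /A; lra.
have mS := (HS n0 mf).1.
apply: le_trans (lower s (fun x => f x - fourier_sum n f x) (bl_memB mf mS) _) _.
  move=> k kn; rewrite fourier_coefB; [|exact: bl_clint mf|exact: bl_clint mS].
  by rewrite fourier_sumE fourier_coef_trig kn subrr.
rewrite -mulrA ler_wpM2l ?exprn_ge0 //.
rewrite (diff_powB mB (@steklov_fwdB h) s mf mS) diff_pow_fourier_sum //.
have mD := bl_mem_diff_pow mB s mf.
have [mSD nSD] := HS n0 mD.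
apply: le_trans (bl_normB mD mSD) _; lra.
Qed.

End Jackson.

(** * Equivalence of the two rates *)

Section Equivalence.
Context {R : realType} (X : banach_lattice R) (KA KS gamma : R).
Hypothesis KA0 : 0 <= KA.
Hypothesis HA : averages_bounded X KA.
Hypothesis KS0 : 0 <= KS.
Hypothesis HS : partial_sums_bounded X KS.
Hypothesis gamma0 : 0 < gamma.
Hypothesis gamma_gap : forall n, (0 < n)%N -> gamma / n%:R <= gap n.
Implicit Types (f g u : R -> R[i]) (x t h C alpha : R) (n m J s r : nat) (k : int).
Implicit Types (c d : int -> R[i]).

Lemma powR_neg_scale alpha q m n : 0 < alpha -> (0 < m)%N -> (0 < n)%N ->
  (n <= q * m)%N ->
  (m%:R : R) `^ (- alpha) <= q%:R `^ alpha * n%:R `^ (- alpha).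
Proof.
move=> a0 m0 n0 nqm; rewrite !powRN ler_pdivlMr ?powR_nat_gt0 //.
rewrite ler_pdivrMl ?powR_nat_gt0 // mulrC -powRM //.
apply: ge0_ler_powR; [exact: ltW | by rewrite nnegrE | by rewrite nnegrE mulr_ge0 |].
by rewrite -natrM ler_nat.
Qed.

Lemma iter_dcoefB s c d k : iter s deriv_coef (fun k => c k - d k) k =
  iter s deriv_coef c k - iter s deriv_coef d k.
Proof.
elim: s c d => [//|s IH] c d; rewrite !iterSr -IH.
congr (iter s deriv_coef _ k); apply/funext => j; exact: mulrBr.
Qed.

Lemma iter_dcoef_widen s m c : iter s deriv_coef (fun k => if (`|k| <= m)%N then c k else 0) =
  (fun k => if (`|k| <= m)%N then iter s deriv_coef c k else 0).
Proof.
elim: s => [//|s IH]; rewrite iterS IH; apply/funext => k; rewrite /deriv_coef /=.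
by case: ifP => _; rewrite ?mulr0.
Qed.

(** Consecutive dyadic approximants differ by O(n^-alpha), and Bernstein's
    inequality turns this into O(n^(s - alpha)) for derivatives of order s.  The
    sum over dyadic scales is geometric because alpha < s. *)
Lemma derivative_growth f s alpha C (c : nat -> int -> R[i]) : bl_mem X f ->
  0 < alpha -> alpha < s%:R -> 0 <= C ->
  (forall n, (0 < n)%N ->
     bl_norm X (fun x => f x - trig n (c n) x) <= C * n%:R `^ (- alpha)) ->
  exists2 K, 0 <= K & forall n, (0 < n)%N ->
    bl_norm X (trig_deriv s n (c n)) <= K * n%:R `^ (s%:R - alpha).
Proof.
move=> mf a0 als C0 HC.
pose C1 := (3 * KS) ^+ s * (C * (3%:R `^ alpha + 1)).
have C10 : 0 <= C1.
  by rewrite mulr_ge0 ?exprn_ge0 ?mulr_ge0 // addr_ge0 // powR_ge0.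
apply: (@dyadic_sum R (fun n => bl_norm X (trig_deriv s n (c n))) _ C1) => //.
  by rewrite subr_gt0.
move=> n n1; have n0 : (0 < n)%N by lia.
have m0 : (0 < n./2)%N by lia.
have mn : (n./2 <= n)%N by lia.
set m := n./2 in m0 mn *.
pose c' k := if (`|k| <= m)%N then c m k else 0.
have Em : trig m (c m) = trig n c' by exact: trig_widen.
have Edm : trig_deriv s m (c m) = trig_deriv s n c'.
  by rewrite /trig_deriv iter_dcoef_widen; exact: trig_widen.
have Ed : trig_deriv s n (c n) = (fun x => trig_deriv s n c' x +
    trig_deriv s n (fun k => c n k - c' k) x).
  apply/funext => x; rewrite /trig_deriv -trigD; congr (trig n _ x).
  by apply/funext => k; rewrite iter_dcoefB addrC subrK.
rewrite Ed; apply: le_trans (bl_normD' _ _) _; try exact: bl_trig.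
rewrite -Edm lerD2l; apply: le_trans (bernstein_iter KS0 HS s _ n0) _.
have -> : trig n (fun k => c n k - c' k) = (fun x => (f x - trig m (c m) x) -
    (f x - trig n (c n) x)).
  by apply/funext => x; rewrite trigB -Em; ring.
have mm j : bl_mem X (fun x => f x - trig j (c j) x).
  by apply: bl_memB => //; exact: bl_trig.
have N := bl_normB (mm m) (mm n).
have sc := @powR_neg_scale alpha 3 m n a0 m0 n0 (_ : n <= 3 * m)%N.
have {}sc : (m%:R : R) `^ (- alpha) <= 3%:R `^ alpha * n%:R `^ (- alpha).
  by apply: sc; rewrite /m; lia.
have B : bl_norm X (fun x => (f x - trig m (c m) x) - (f x - trig n (c n) x)) <=
    C * (3%:R `^ alpha + 1) * n%:R `^ (- alpha).
  apply: le_trans N _; apply: le_trans (lerD (HC m m0) (HC n n0)) _.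
  by rewrite -mulrDr -[leRHS]mulrA ler_wpM2l // mulrDl mul1r lerD2r.
have k0 : 0 <= (3 * KS * n%:R) ^+ s by rewrite exprn_ge0 // mulr_ge0 // mulr_ge0.
apply: le_trans (ler_wpM2l k0 B) _.
rewrite le_eqVlt; apply/orP; left; apply/eqP.
rewrite exprMn powRD; last by rewrite pnatr_eq0 -lt0n n0 implybT.
by rewrite powR_mulrn // /C1; ring.
Qed.

(** Node values of averages at the scale 1/n are controlled by the norm, so that
    in the discrete norm I - A changes f by at most a multiple of the norm of f. *)
Lemma discrete_diff_pow r : exists2 C, 0 <= C & forall n f, (0 < n)%N -> bl_mem X f ->
  discrete_norm X n (diff_pow (steklov (gamma / n%:R)) r f) <=
    discrete_norm X n f + C * bl_norm X f /\
  discrete_norm X n f <=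
    discrete_norm X n (diff_pow (steklov (gamma / n%:R)) r f) + C * bl_norm X f.
Proof.
pose q := 8 * pi / gamma * KA.
have q0 : 0 <= q by rewrite mulr_ge0 // divr_ge0 ?(ltW gamma0) // mulr_ge0 // pi_ge0.
have step n f : (0 < n)%N -> bl_mem X f ->
    discrete_norm X n (steklov (gamma / n%:R) f) <= q * bl_norm X f.
  move=> n0 mf; have N0 : 0 < n%:R :> R by rewrite ltr0n.
  have h0 : 0 < gamma / n%:R by rewrite divr_gt0.
  have hg := gamma_gap n0; rewrite steklovE; set h := gamma / n%:R in h0 hg *.
  have l1 : - (h / 2) < h / 2 by lra.
  have l2 : - gap n <= - (h / 2) by lra.
  have l3 : h / 2 <= gap n by lra.
  apply: le_trans (discrete_mean KA0 HA l1 l2 l3 mf) _.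
  rewrite ler_wpM2r ?bl_norm_ge0 // ler_wpM2r //.
  have -> : h / 2 - - (h / 2) = h by lra.
  have -> : 8 * gap n / h = 8 * (gap n * n%:R) / gamma.
    by rewrite /h invf_div; ring.
  by rewrite ler_pM2r ?invr_gt0 // ler_pM2l //; exact: gap_le.
elim: r => [|r [C C0 IH]].
  by exists 0 => // n f n0 mf; rewrite mul0r addr0.
exists (q + C * (1 + KA)); first by rewrite addr_ge0 // mulr_ge0 // addr_ge0.
move=> n f n0 mf; have h0 : 0 < gamma / n%:R by rewrite divr_gt0 // ltr0n.
rewrite diff_powSr; pose g x := f x - steklov (gamma / n%:R) f x.
have [mA nA] := HA h0 mf.
have mg : bl_mem X g by exact: bl_memB.
have ng : bl_norm X g <= (1 + KA) * bl_norm X f.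
  by apply: le_trans (bl_normB mf mA) _; rewrite mulrDl mul1r lerD2l.
have [I1 I2] := IH n g n0 mg; have S := step n f n0 mf.
have d1 : discrete_norm X n g <= discrete_norm X n f +
    discrete_norm X n (steklov (gamma / n%:R) f) by exact: discrete_normB.
have d2 : discrete_norm X n f <= discrete_norm X n g +
    discrete_norm X n (steklov (gamma / n%:R) f).
  have E : f = (fun x => g x + steklov (gamma / n%:R) f x).
    by apply/funext => x; rewrite /g subrK.
  by rewrite {1}E; exact: discrete_normD.
have Cg : C * bl_norm X g <= C * (1 + KA) * bl_norm X f.
  by rewrite -mulrA ler_wpM2l.
by rewrite !mulrDl; split; move: I1 I2 S d1 d2 Cg; rewrite -/g; lra.
Qed.

Lemma fwd_decay s : exists2 C, 0 <= C & forall n c, (0 < n)%N ->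
  bl_norm X (diff_pow (steklov_fwd (gamma / n%:R)) s (trig n c)) <=
  C / n%:R ^+ s * bl_norm X (trig_deriv s n c).
Proof.
exists ((8 * gamma * KA) ^+ s); first by rewrite exprn_ge0 // !mulr_ge0 // ltW.
move=> n c n0; have h0 : 0 < gamma / n%:R by rewrite divr_gt0 // ltr0n.
apply: le_trans (bl_fwd_diff_trig KA0 HA n s c h0) _.
rewrite -expr_div_n le_eqVlt; apply/orP; left; apply/eqP; congr (_ ^+ s * _).
by field; rewrite pnatr_eq0 -lt0n.
Qed.

(** The defect of A_h is of second order, so (I - A)^r gains n^-(2r) against 2 r
    derivatives; by Bernstein's inequality 2 r - s of these can be traded back for
    powers of n. *)
Lemma steklov_decay r s : (s <= 2 * r)%N -> exists2 C, 0 <= C & forall n c, (0 < n)%N ->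
  bl_norm X (diff_pow (steklov (gamma / n%:R)) r (trig n c)) <=
  C / n%:R ^+ s * bl_norm X (trig_deriv s n c).
Proof.
move=> sr; pose p := (r * 2 - s)%N.
have K30 : 0 <= (3 * KS) ^+ p by rewrite exprn_ge0 // mulr_ge0.
have K40 : 0 <= (4 * gamma ^+ 2 * KA) ^+ r.
  by rewrite exprn_ge0 // mulr_ge0 // mulr_ge0 // exprn_ge0 // ltW.
exists ((4 * gamma ^+ 2 * KA) ^+ r * (3 * KS) ^+ p); first by rewrite mulr_ge0.
move=> n c n0; have N0 : 0 < n%:R :> R by rewrite ltr0n.
have h0 : 0 < gamma / n%:R by rewrite divr_gt0.
apply: le_trans (bl_steklov_diff_trig KA0 HA n r c h0) _.
have B := bernstein_iter KS0 HS p (iter s deriv_coef c) n0.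
rewrite /trig_deriv -iterD (_ : (p + s = r * 2)%N) in B; last by rewrite /p; lia.
have k0 : 0 <= (4 * (gamma / n%:R) ^+ 2 * KA) ^+ r.
  by rewrite exprn_ge0 // mulr_ge0 // mulr_ge0 // exprn_ge0 // ltW.
apply: le_trans (ler_wpM2l k0 B) _.
rewrite [leLHS]mulrA ler_wpM2r ?bl_norm_ge0 //; first exact: bl_trig.
rewrite le_eqVlt; apply/orP; left; apply/eqP.
have E : (n%:R : R) ^+ (r * 2) = n%:R ^+ p * n%:R ^+ s.
  by rewrite -exprD /p subnK // mulnC.
have -> : 4 * (gamma / n%:R) ^+ 2 * KA = (4 * gamma ^+ 2 * KA) / n%:R ^+ 2.
  by field; rewrite gt_eqF.
rewrite expr_div_n -[(n%:R ^+ 2) ^+ r]exprM [(2 * r)%N]mulnC E.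
rewrite [(3 * KS * n%:R) ^+ p]exprMn.
have ns : (n%:R : R) ^+ s != 0 by rewrite expf_neq0 ?gt_eqF.
have np : (n%:R : R) ^+ p != 0 by rewrite expf_neq0 ?gt_eqF.
move: ((4 * gamma ^+ 2 * KA) ^+ r) ((3 * KS) ^+ p) (n%:R ^+ s) (n%:R ^+ p) ns np.
move=> u v a b ns np.
by field; rewrite ns np.
Qed.

(** Dividing n by p before applying a rate loses only a constant factor. *)
Lemma leq_double_divn p n : (0 < p)%N -> (p <= n)%N -> (n <= 2 * p * (n %/ p))%N.
Proof.
move=> p0 pn; have d0 : (0 < n %/ p)%N by rewrite divn_gt0.
rewrite -mulnA mul2n -addnn {1}(divn_eq n p) [(p * _)%N]mulnC leq_add2l.
by rewrite (leq_trans (ltnW (ltn_pmod n p0))) // leq_pmull.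
Qed.

(** Approximants with derivatives of order s growing at most
    like n^(s - alpha) contribute O(n^-alpha) to both terms of (ii), and these
    approximants are L_n f in one direction and S_n f in the other. *)
Theorem rate_equivalence r s f alpha : (s <= 2 * r)%N -> bl_mem X f ->
  0 < alpha -> alpha < s%:R ->
  (exists2 C, 0 <= C & forall n, (0 < n)%N ->
    bl_norm X (fun x => f x - interpolate n f x) <= C * n%:R `^ (- alpha)) <->
  (exists2 C, 0 <= C & forall n, (0 < n)%N ->
    discrete_norm X n (diff_pow (steklov (gamma / n%:R)) r f) +
    bl_norm X (diff_pow (steklov_fwd (gamma / n%:R)) s f) <= C * n%:R `^ (- alpha)).
Proof.
move=> sr mf a0 als.
have [CD CD0 HD] := discrete_diff_pow r.
have [CF CF0 HF] := fwd_decay s.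
have [CT CT0 HT] := steklov_decay sr.
pose MZ := 8 * KA + 48 * pi * KA * KS.
have MZ0 : 0 <= MZ by rewrite addr_ge0 ?mulr_ge0 // pi_ge0.
have hpos n : (0 < n)%N -> 0 < gamma / n%:R by move=> n0; rewrite divr_gt0 // ltr0n.
(* The contribution to (ii) of approximants with controlled derivatives. *)
have poly K (c : nat -> int -> R[i]) : 0 <= K -> (forall n, (0 < n)%N ->
      bl_norm X (trig_deriv s n (c n)) <= K * n%:R `^ (s%:R - alpha)) ->
    forall n, (0 < n)%N ->
      bl_norm X (diff_pow (steklov_fwd (gamma / n%:R)) s (trig n (c n))) <=
        CF * K * n%:R `^ (- alpha) /\
      discrete_norm X n (diff_pow (steklov (gamma / n%:R)) r (trig n (c n))) <=
        MZ * (CT * K) * n%:R `^ (- alpha).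
  move=> K0 HK n n0; have N0 : 0 < n%:R :> R by rewrite ltr0n.
  have E (C : R) : C / n%:R ^+ s * (K * n%:R `^ (s%:R - alpha)) =
      C * K * n%:R `^ (- alpha).
    rewrite powRD; last by rewrite pnatr_eq0 -lt0n n0 implybT.
    by rewrite powR_mulrn //; field; rewrite expf_neq0 ?gt_eqF.
  have nn (C : R) : 0 <= C -> 0 <= C / n%:R ^+ s.
    by move=> C0; rewrite divr_ge0 // exprn_ge0.
  split.
    by rewrite -E; apply: le_trans (HF n (c n) n0) _; rewrite ler_wpM2l ?nn ?HK.
  rewrite -mulrA -E; set T := diff_pow _ _ _.
  have -> : T = trig n (iter r (fun c k => (1 -
      mean_mult (- (gamma / n%:R / 2)) (gamma / n%:R / 2) k) * c k) (c n)).
    by apply: diff_pow_trig => g; exact: steklovE.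
  apply: le_trans (marcinkiewicz_zygmund KA0 HA KS0 HS _ n0) _.
  rewrite ler_wpM2l //.
  rewrite -(diff_pow_trig n r (c n) (fun g => steklovE (gamma / n%:R) g)).
  by apply: le_trans (HT n (c n) n0) _; rewrite ler_wpM2l ?nn ?HK.
have stX n g : (0 < n)%N -> bl_mem X g -> bl_mem X (steklov (gamma / n%:R) g).
  by move=> n0 mg; exact: (HA (hpos n n0) mg).1.
have fwX n g : (0 < n)%N -> bl_mem X g -> bl_mem X (steklov_fwd (gamma / n%:R) g).
  by move=> n0 mg; exact: (bl_mem_steklov_fwd KA0 HA (hpos n n0) mg).
have fwK n g : (0 < n)%N -> bl_mem X g ->
    bl_norm X (steklov_fwd (gamma / n%:R) g) <= 4 * KA * bl_norm X g.
  by move=> n0 mg; exact: (bl_steklov_fwd KA0 HA (hpos n n0) mg).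
split => -[C C0 HC].
- have HC' n : (0 < n)%N ->
      bl_norm X (fun x => f x - trig n (dft n f) x) <= C * n%:R `^ (- alpha).
    by rewrite -interpolateE; exact: HC.
  have [K K0 HK] := derivative_growth mf a0 als C0 HC'.
  exists (CD * C + MZ * (CT * K) + ((1 + 4 * KA) ^+ s * C + CF * K)).
    by rewrite !addr_ge0 ?mulr_ge0 // exprn_ge0 // addr_ge0 // mulr_ge0.
  move=> n n0; have [P1 P2] := poly K _ K0 HK n n0.
  pose T := trig n (dft n f); pose g x := f x - T x.
  have mT : bl_mem X T by exact: bl_trig.
  have mg : bl_mem X g by exact: bl_memB.
  have ng : bl_norm X g <= C * n%:R `^ (- alpha) by exact: HC'.
  have E : f = (fun x => g x - - T x) by apply/funext => x; rewrite /g opprK subrK.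
  have A4 : 0 <= 4 * KA by rewrite mulr_ge0.
  have fw1 : bl_norm X (diff_pow (steklov_fwd (gamma / n%:R)) s f) <=
      bl_norm X (diff_pow (steklov_fwd (gamma / n%:R)) s g) +
      bl_norm X (diff_pow (steklov_fwd (gamma / n%:R)) s T).
    have := diff_powB (fun g => fwX n g n0) (@steklov_fwdB _ X _) s mf mT => EE.
    have -> : diff_pow (steklov_fwd (gamma / n%:R)) s f = (fun x =>
      diff_pow (steklov_fwd (gamma / n%:R)) s g x +
      diff_pow (steklov_fwd (gamma / n%:R)) s T x).
      by rewrite EE; apply/funext => x; rewrite subrK.
    by apply: bl_normD'; apply: (bl_mem_diff_pow (fun g => fwX n g n0)).
  have fw2 := bl_diff_pow A4 (fun g => fwX n g n0) (fun g => fwK n g n0) s mg.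
  have st1 : discrete_norm X n (diff_pow (steklov (gamma / n%:R)) r f) <=
      discrete_norm X n (diff_pow (steklov (gamma / n%:R)) r g) +
      discrete_norm X n (diff_pow (steklov (gamma / n%:R)) r T).
    have := diff_powB (fun g => stX n g n0) (@steklovB _ X _) r mf mT => EE.
    have -> : diff_pow (steklov (gamma / n%:R)) r f = (fun x =>
      diff_pow (steklov (gamma / n%:R)) r g x +
      diff_pow (steklov (gamma / n%:R)) r T x).
      by rewrite EE; apply/funext => x; rewrite subrK.
    exact: discrete_normD.
  have [st2 _] := HD n g n0 mg.
  have g0 : discrete_norm X n g = 0.
    apply: discrete_norm0 => k kn.
    by rewrite /g /T -interpolateE interpolate_node // subrr.
  rewrite g0 add0r in st2.
  have b1 : CD * bl_norm X g <= CD * (C * n%:R `^ (- alpha)) by rewrite ler_wpM2l.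
  have b2 : (1 + 4 * KA) ^+ s * bl_norm X g <=
      (1 + 4 * KA) ^+ s * (C * n%:R `^ (- alpha)).
    by rewrite ler_wpM2l // exprn_ge0 // addr_ge0.
  rewrite /T in fw1 st1.
  apply: le_trans (lerD (le_trans st1 (lerD (le_trans st2 b1) P2))
    (le_trans fw1 (lerD (le_trans fw2 b2) P1))) _.
  move: (n%:R `^ _) ((1 + 4 * KA) ^+ s) => Z P.
  by rewrite le_eqVlt; apply/orP; left; apply/eqP; ring.
- have [CJ CJ0 [K0' K00 HJ]] := jackson KA0 HA KS0 HS s.
  have [CL CL0 HL] := interpolate_bound KA0 HA KS0 HS.
  have dn0 n := discrete_norm_ge0 X n (diff_pow (steklov (gamma / n%:R)) r f).
  have fw0 n : (0 < n)%N -> 0 <= bl_norm X (diff_pow (steklov_fwd (gamma / n%:R)) s f).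
    by move=> n0; apply: bl_norm_ge0; apply: (bl_mem_diff_pow (fun g => fwX n g n0)).
  have HC1 n : (0 < n)%N ->
      discrete_norm X n (diff_pow (steklov (gamma / n%:R)) r f) <= C * n%:R `^ (- alpha).
    by move=> n0; apply: le_trans (HC n n0); rewrite lerDl fw0.
  have HC2 n : (0 < n)%N ->
      bl_norm X (diff_pow (steklov_fwd (gamma / n%:R)) s f) <= C * n%:R `^ (- alpha).
    by move=> n0; apply: le_trans (HC n n0); rewrite lerDr dn0.
  have A0 : 0 <= K0' / gamma by rewrite divr_ge0 // ltW.
  (* Jackson's inequality needs h n >= K0', whereas (ii) is about h = gamma / n; so
     it is used with the rate at n / p, that is with h of the order p gamma / n. *)
  pose p := (Num.bound (K0' / gamma)).+1.
  have pK : K0' <= gamma * p%:R.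
    rewrite mulrC -ler_pdivrMr //; apply: le_trans (ltW (archi_boundP A0)) _.
    by rewrite ler_nat.
  have [C2 C20 HC2'] : exists2 C2, 0 <= C2 & forall n, (0 < n)%N ->
      bl_norm X (fun x => f x - trig n (fourier_coef f) x) <= C2 * n%:R `^ (- alpha).
    apply: (@rate_everywhere _ _ _ (CJ * (C * (2 * p)%:R `^ alpha)) p) => n pn n0.
    have d0 : (0 < n %/ p)%N by rewrite divn_gt0.
    have D0 : 0 < (n %/ p)%:R :> R by rewrite ltr0n.
    have G2 : gamma / (n %/ p)%:R <= pi *+ 2.
      apply: le_trans (gamma_gap d0) _; rewrite -(gapM (n %/ p)).
      by rewrite ler_peMr ?ler1n // ltW // gap_gt0.
    have GK : K0' <= gamma / (n %/ p)%:R * n%:R.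
      apply: le_trans pK _; rewrite mulrAC -mulrA ler_pM2l //.
      by rewrite ler_pdivlMr // -natrM ler_nat mulnC leq_divM.
    apply: le_trans (HJ n _ f n0 (hpos _ d0) G2 GK mf) _.
    rewrite -!mulrA ler_wpM2l //; apply: le_trans (HC2 _ d0) _.
    rewrite ler_wpM2l //; apply: powR_neg_scale => //.
    exact: leq_double_divn.
  have [K K0 HK] := derivative_growth (c := fun=> fourier_coef f) mf a0 als C20 HC2'.
  exists (C2 + CL * (C + MZ * (CT * K) + CD * C2)).
    by rewrite addr_ge0 // mulr_ge0 // !addr_ge0 ?mulr_ge0.
  move=> n n0; have [_ P2] := poly K (fun=> fourier_coef f) K0 HK n n0.
  pose T := trig n (fourier_coef f); pose g x := f x - T x.
  have mT : bl_mem X T by exact: bl_trig.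
  have mg : bl_mem X g by exact: bl_memB.
  have ng : bl_norm X g <= C2 * n%:R `^ (- alpha) by exact: HC2'.
  have Eg : interpolate n g = (fun x => interpolate n f x - T x).
    have ET x : T x = interpolate n T x by rewrite interpolate_trig.
    apply/funext => x; rewrite ET /interpolate -mulrBr -sumrB; congr (_ * _).
    by apply: eq_bigr => j _; rewrite /g mulrBl.
  have mLg : bl_mem X (interpolate n g) by rewrite interpolateE; exact: bl_trig.
  have -> : (fun x => f x - interpolate n f x) = (fun x => g x - interpolate n g x).
    by apply/funext => x; rewrite Eg /g; ring.
  apply: le_trans (bl_normB mg mLg) _.
  have L := HL n g n0.
  have [_ st2] := HD n g n0 mg.
  have st1 : discrete_norm X n (diff_pow (steklov (gamma / n%:R)) r g) <=
      discrete_norm X n (diff_pow (steklov (gamma / n%:R)) r f) +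
      discrete_norm X n (diff_pow (steklov (gamma / n%:R)) r T).
    rewrite (diff_powB (fun g => stX n g n0) (@steklovB _ X _) r mf mT).
    exact: discrete_normB.
  have b1 : CD * bl_norm X g <= CD * (C2 * n%:R `^ (- alpha)) by rewrite ler_wpM2l.
  have b2 := HC1 n n0.
  have dg : discrete_norm X n g <= (C + MZ * (CT * K) + CD * C2) * n%:R `^ (- alpha).
    move: st1 st2 b1 b2 P2; rewrite -/T.
    move: (discrete_norm _ _ _) (discrete_norm _ _ _) (discrete_norm _ _ _)
      (discrete_norm _ _ _) => w1 w2 w3 w4.
    move: (bl_norm X g) (n%:R `^ _) (MZ * _) => y Z M; lra.
  rewrite mulrDl; apply: lerD => //; apply: le_trans L _.
  by rewrite -mulrA ler_wpM2l.
Qed.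

End Equivalence.

Section FourierBound.
Context {R : realType} (X : banach_lattice R).

(** Uniform operator norms on the unit ball give a single constant for all of X. *)
Lemma fourier_bound : fourier_sums_bounded X ->
  exists2 K, 0 <= K & partial_sums_bounded X K.
Proof.
move=> [mS Sfin].
have norms_fin : (ereal_sup [set (bl_norm X (fourier_sum n f))%:E |
    n in [set n | (0 < n)%N] & f in unit_ball X] < +oo)%E.
  apply: le_lt_trans Sfin; apply: ge_ereal_sup => _ [n n0 [f uf <-]].
  apply: (@le_trans _ _ (opnorm X (fourier_sum n))); apply: ereal_sup_ubound.
    by exists f.
  by exists n.
have [K K0 HK] := ereal_sup_fin_bound norms_fin.
exists K => // n f n0 mf; split; first exact: mS.
apply: (ball_bound _ _ K0 mf) => [z g mg|g mg ng]; last by apply: HK; exists n => //; exists g.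
rewrite -bl_normZ; last exact: mS.
congr (bl_norm X _); apply/funext => x; rewrite !fourier_sumE -trigZ.
by congr (trig n _ x); apply/funext => k; rewrite fourier_coefZ //; exact: bl_clint mg.
Qed.

End FourierBound.

Local Close Scope complex_scope.

Theorem corollary3p7 (R : realType) (X : banach_lattice R) (gamma : R)
    (hgamma : 0 < gamma)
    (hgamma_nodes : forall n k : nat, (0 < n)%N ->
      gamma / n%:R <= node n k.+1 - node n k)
    (r s : nat) (hr : (0 < r)%N) (hs : (0 < s)%N) (hrs : (s <= 2 * r)%N)
    (hA : assumption_A X) (hS : fourier_sums_bounded X) :
  forall (f : R -> R[i]) (alpha : R),
    bl_mem X f -> 0 < alpha -> alpha < s%:R ->
    ((fun n : nat => bl_norm X (f - interpolate n f))
       =O_\oo (fun n : nat => n%:R `^ (- alpha)))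
    <->
    ((fun n : nat =>
        discrete_norm X n (diff_pow (steklov (gamma / n%:R)) r f) +
        bl_norm X (diff_pow (steklov_fwd (gamma / n%:R)) s f))
       =O_\oo (fun n : nat => n%:R `^ (- alpha))).
Proof.
move=> f alpha mf a0 als.
have [KA KA0 HA] := steklov_bound hA.
have [KS KS0 HS] := fourier_bound hS.
have gg n : (0 < n)%N -> gamma / n%:R <= gap n.
  by move=> n0; have := hgamma_nodes n 0%N n0; rewrite nodeS addrAC subrr add0r.
have E := rate_equivalence KA0 HA KS0 HS hgamma gg hrs mf a0 als.
have h0 n : (0 < n)%N -> 0 < gamma / n%:R by move=> n0; rewrite divr_gt0 // ltr0n.
apply: iff_trans (iff_trans (bigO_rate alpha _) E) (iff_sym (bigO_rate alpha _)).
  move=> n n0; apply: bl_norm_ge0; apply: bl_memB => //.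
  by rewrite interpolateE; exact: bl_trig.
move=> n n0; apply: addr_ge0; first exact: discrete_norm_ge0.
apply: bl_norm_ge0; apply: bl_mem_diff_pow => // g mg.
exact: (bl_mem_steklov_fwd KA0 HA (h0 n n0) mg).
Qed.
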